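(* Let $\sigma>0$ and let $m_n=e^{-\sigma n}$ for $n\ge1$. Let $z^*>0$, let $\tilde f:\mathbb R\to[0,+\infty)$ be strictly convex with $\tilde f(0)=0$, and let $$f(z)=\begin{cases}\tilde f(z)&\text{if }z\le z^*\\ \tilde f(z^* )&\text{if }z>z^*.\end{cases}$$ Then the set of locking states of $f$ for the kernel $(e^{-\sigma n})_n$ is $$\Big\{\frac1N:\ N\in\mathbb N,\ N\ge1\Big\}\cup\{0\}.$$
   Context: Standing assumptions: $f(z)\le c(z^2+1)$ for some $c>0$, and $\tilde f(z)\ge c_1z^2-c_2$ on $[0,+\infty)$ for some $c_1,c_2>0$ (which is not restrictive). $\mathcal A(k;z)$ is the set of $u:\{0,\dots,k\}\to\mathbb R$ with $u_0=0$, $u_k=kz$. For $u:\{0,\dots,N\}\to\mathbb R$, $$F_1(u;[0,N])=\sum_{i=1}^Nf(u_i-u_{i-1})+\sum_{i,j=0}^Ne^{-\sigma|i-j|}(u_i-u_j)^2,\qquad \widehat Q_\sigma f(z)=\lim_{k\to\infty}\frac1k\inf\{F_1(u;[0,k]):u\in\mathcal A(k;z)\}.$$ For $\theta\in\mathbb Q\cap[0,1]$ let $\mathcal V(N;\theta)$ be the set of $u:\{0,\dots,N\}\to\mathbb R$ with $\#\{i:u_i-u_{i-1}>z^*\}\le\theta N$ and $\#\{i:u_i-u_{i-1}<z^*\}\le(1-\theta)N$, and $$\widehat Q_\sigma f(\theta,z)=\liminf_{N\to\infty,\ \theta N\in\mathbb N}\frac1N\inf\{F_1(u;[0,N]):u\in\mathcal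 A(N;z)\cap\mathcal V(N;\theta)\}$$ (infimum of the empty set is $+\infty$). This function is convex in $(\theta,z)$ and is extended to irrational $\theta\in(0,1)$ by continuity. A value $\theta\in[0,1]$ is a locking state if $\{z\in\mathbb R:\widehat Q_\sigma f(\theta,z)=\widehat Q_\sigma f(z)\}$ contains an open interval. *)

(* Defs.v *)
From HB Require Import structures.
From mathcomp Require Import all_boot all_order all_algebra.
From mathcomp Require Import all_classical all_reals all_analysis.
Set Implicit Arguments.
Unset Strict Implicit.
Unset Printing Implicit Defensive.
Import Order.TTheory GRing.Theory Num.Theory.
Import numFieldNormedType.Exports.

Local Open Scope classical_set_scope.
Local Open Scope ring_scope.

Section Locking.
Variable R : realType.
Implicit Types (f ft : R -> R) (sigma zstar theta z : R) (N : nat).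

Definition strictly_convex (g : R -> R) : Prop :=
  forall x y t : R, x != y -> 0 < t < 1 ->
    g (t * x + (1 - t) * y) < t * g x + (1 - t) * g y.

Definition truncated ft zstar z : R :=
  if z <= zstar then ft z else ft zstar.

Definition exp_kernel sigma (n : nat) : R := expR (- (sigma * n%:R)).

(* A function on {0,...,N} is a map u : 'I_N.+1 -> R.  Its N increments are
   indexed from 0: incr u i = u_(i+1) - u_i for 0 <= i < N. *)
Definition incr N (u : 'I_N.+1 -> R) (i : 'I_N) : R :=
  u (lift ord0 i) - u (widen_ord (leqnSn N) i).

(* `|i - j|%N is the absolute difference, not the truncated subtraction. *)
Definition F1 f sigma N (u : 'I_N.+1 -> R) : R :=
  \sum_(i < N) f (incr u i) +
  \sum_(i < N.+1) \sum_(j < N.+1)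
    exp_kernel sigma `|(i : nat) - (j : nat)|%N * (u i - u j) ^+ 2.

Definition admissible N z : set ('I_N.+1 -> R) :=
  [set u | u ord0 = 0 /\ u ord_max = N%:R * z].

Definition prescribed_phases zstar N theta : set ('I_N.+1 -> R) :=
  [set u | #|[pred i | zstar < incr u i]|%:R <= theta * N%:R /\
           #|[pred i | incr u i < zstar]|%:R <= (1 - theta) * N%:R].

Definition min_energy f sigma N (A : set ('I_N.+1 -> R)) : \bar R :=
  ereal_inf [set (F1 f sigma u)%:E | u in A].

Definition Qhat f sigma z : \bar R :=
  lim ((fun k : nat => (k%:R^-1)%:E * min_energy f sigma (@admissible k z))%E
         @ \oo).

(* The inferior limit is taken along those N for which theta N is a natural
   number; there are infinitely many of them only if theta is rational. *)
Definition Qhat_rat f sigma zstar theta z : \bar R :=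
  limf_einf
    (fun N : nat => ((N%:R^-1)%:E *
       min_energy f sigma (@admissible N z `&` @prescribed_phases zstar N theta))%E)
    (within [set N : nat | theta * N%:R \is a Num.nat] \oo).

Definition Qhat_phase f sigma zstar theta z : \bar R :=
  if theta \in @rational R then Qhat_rat f sigma zstar theta z
  else lim (Qhat_rat f sigma zstar t z
              @[t --> within (@rational R `&` `[0, 1]) (nbhs theta)]).

Definition locking_state f sigma zstar theta : Prop :=
  0 <= theta <= 1 /\
  exists a b : R, a < b /\
    `]a, b[ `<=` [set z | Qhat_phase f sigma zstar theta z = Qhat f sigma z].

End Locking.

(* Main.v *)
Require Import Defs.
From HB Require Import structures.
From mathcomp Require Import all_boot all_order all_algebra.
From mathcomp Require Import all_classical all_reals all_analysis.
From mathcomp Require Import ring lra.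
Set Implicit Arguments.
Unset Strict Implicit.
Unset Printing Implicit Defensive.
Import Order.TTheory GRing.Theory Num.Theory.
Import numFieldNormedType.Exports.

Local Open Scope classical_set_scope.
Local Open Scope ring_scope.

(** Why the locking states are 0 and the inverses of the positive integers.

Write lam for the exponential of -sigma, C for the value of the potential at zstar (the
cost of a broken bond, that is, of an increment beyond zstar), and z_k for the increments.
Adding the nodes of a chain one after the other and recording the weighted mean and
variance of the previous ones shows that the pair energy is a sum of squares
al a_k^2 with a_k = lam a_(k-1) + z_k, up to effects that decay geometrically away from
the two ends [quad_excess, quad_le_excess, quad_ge_flux].  In the variables a_k the
nonlocal chain only has nearest-neighbour interactions.

By duality, a chain under the load p is described by the part y_k of the load that goes
through the bond k; a site costs fts y_k + ((1 - lam) p - y_k + lam y_(k+1))^2 / (4 al),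
with fts the convex conjugate of the potential.  A broken bond transmits nothing, y = 0
there, so the blocks between consecutive broken bonds decouple.  If g_n(p) is the least
cost of n sites between two zeros of y, the conjugate of the effective density at p is
the supremum over n of (g_n(p) - C) / n.  Two facts drive everything else.

First, g_n(p) is strictly concave in n [block_cost_concave]: duplicate the value of an
optimal flux at its summit in one copy and delete it in another.  Hence a load that
favours some finite block length favours either one or two consecutive ones.

Second, the break cost (n+1) g_n(p) - n g_(n+1)(p) at which the lengths n and n+1 tie is
strictly increasing in p [threshold_increasing], because longer blocks carry a larger
mean flux.  Hence n and n+1 tie at exactly one load, and n is optimal for a nondegenerate
interval of loads.

For 1/n: the strains of the periodic state of n-blocks, as p runs through that interval,
fill an interval, and there this state attains the unconstrained minimum; it respects the
phase constraint because a violation would let the truncated potential go below the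
dual lower bound [block_feasible].  For 0: a negative mean strain is best realised by
equal increments.

For theta strictly between 1/(m+1) and 1/m: the dual bound with a prescribed number of
broken bonds is governed by the chord of g between m and m+1, so equality at a strain z
forces the load at z to be the tie load of m and m+1, and z to be the derivative there of
a differentiable function [phase_conj_touch].  Thus equality holds for at most one
positive strain; for negative strains every broken bond costs a fixed extra amount.
All these lower bounds are affine in theta and so pass to irrational theta. *)

(** * The exponential pair energy in local form *)
Section Quadratic.
Variables (R : realFieldType) (lam : R).
Hypotheses (lam_gt0 : 0 < lam) (lam_lt1 : lam < 1).
Implicit Types (u x : nat -> R) (N n k : nat) (t : R).

Definition quad (N : nat) (u : nat -> R) : R :=
  \sum_(i < N.+1) \sum_(j < N.+1)
    lam ^+ `|(i : nat) - (j : nat)|%N * (u i - u j) ^+ 2.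

Lemma quadS N u :
  quad N.+1 u = quad N u +
    2 * \sum_(i < N.+1) lam ^+ (N.+1 - i) * (u N.+1 - u i) ^+ 2.
Proof.
rewrite /quad big_ord_recr /=.
under eq_bigr do rewrite big_ord_recr /=.
rewrite big_split /= [X in _ + X]big_ord_recr /= distnn subrr expr0n /= mulr0 addr0.
rewrite -addrA; congr (_ + _); rewrite mulr_natl mulr2n; congr (_ + _).
  apply: eq_bigr => i _; rewrite distnC distnEl; last by rewrite ltnW.
  by congr (_ * _); ring.
apply: eq_bigr => i _; rewrite distnEl //; last by rewrite ltnW.
Qed.

Variable mu : R.
Hypothesis mu_ge0 : 0 <= mu.

(** Mass, center and variance of the nodes 0, ..., n seen from the last one, the node i
having the weight lam^(n-i).  The extra weight mu of the node 0 stands for additional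
nodes on its left at the same height; with mu = lam / (1 - lam), the case of infinitely
many of them, the mass no longer depends on n. *)
Fixpoint mass (n : nat) : R := if n is m.+1 then 1 + lam * mass m else 1 + mu.

Fixpoint center (u : nat -> R) (n : nat) : R :=
  if n is m.+1 then center u m + (u n - center u m) / mass n else u 0%N.

Definition excess (u : nat -> R) (k : nat) : R := u k.+1 - center u k.

Fixpoint variance (u : nat -> R) (n : nat) : R :=
  if n is m.+1 then
    lam * variance u m + lam * mass m / mass n * excess u m ^+ 2
  else 0.

Lemma mass_ge1 n : 1 <= mass n.
Proof.
elim: n => [|n IH] /=; first by rewrite lerDl.
by rewrite lerDl mulr_ge0 ?(ltW lam_gt0) ?(le_trans _ IH).
Qed.

Lemma mass_gt0 n : 0 < mass n.
Proof. exact: lt_le_trans (mass_ge1 n). Qed.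

Lemma excessS u k :
  excess u k.+1 = u k.+2 - u k.+1 + lam * mass k / mass k.+1 * excess u k.
Proof.
have := lt0r_neq0 (mass_gt0 k.+1); rewrite /excess /= => m0.
by field.
Qed.

Lemma variance_ge0 u n : 0 <= variance u n.
Proof.
elim: n => [|n IH] //=; apply: addr_ge0; first by rewrite mulr_ge0 // ltW.
have := mass_gt0 n; have := mass_gt0 n.+1 => /= m1 m0.
by rewrite mulr_ge0 ?sqr_ge0 // divr_ge0 ?mulr_ge0 // ltW.
Qed.

Lemma weighted_dist u N t :
  \sum_(i < N.+1) lam ^+ (N - i) * (t - u i) ^+ 2 + mu * lam ^+ N * (t - u 0%N) ^+ 2
  = mass N * (t - center u N) ^+ 2 + variance u N.
Proof.
elim: N t => [|N IH] t.
  by rewrite big_ord1 /= expr0; ring.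
rewrite big_ord_recr /= subnn expr0 mul1r.
have -> : \sum_(i < N.+1) lam ^+ (N.+1 - i) * (t - u i) ^+ 2 =
   lam * \sum_(i < N.+1) lam ^+ (N - i) * (t - u i) ^+ 2.
  rewrite mulr_sumr; apply: eq_bigr => i _.
  by rewrite subSn ?exprS ?mulrA // -ltnS.
have := lt0r_neq0 (mass_gt0 N.+1); rewrite /excess /= (exprS lam); move: (IH t).
move: (\sum_(i < N.+1) _) (lam ^+ N) (mass N) (center u N) (variance u N) (u N.+1) (u 0%N).
move=> S L m c v w w0 E m0.
have -> : S = m * (t - c) ^+ 2 + v - mu * L * (t - w0) ^+ 2 by rewrite -E addrK.
by field.
Qed.

Let kap := 2 * lam / (1 - lam).

(** Adding a node creates pair terms that depend on the previous nodes only through their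
weighted mean and variance.  The multiple kap of the variance is the one that one step
reproduces unchanged, so that only the squares of the excesses remain. *)
Lemma quad_excess N u :
  quad N u + 2 * mu * (\sum_(j < N.+1) lam ^+ j * (u j - u 0%N) ^+ 2)
    + kap * variance u N =
  \sum_(k < N) (2 * lam * mass k + kap * (lam * mass k / mass k.+1))
     * excess u k ^+ 2.
Proof.
have l1 : 1 - lam != 0 by rewrite subr_eq0 gt_eqF.
elim: N => [|N IH].
  by rewrite big_ord0 /quad !big_ord1 /= !subrr; ring.
rewrite [RHS]big_ord_recr; have := IH; set Z := (X in _ = X) => IH1.
rewrite [X in _ = (X + _)%R](_ : _ = Z) //= -IH1 quadS [X in 2 * mu * X]big_ord_recr /=.
have := weighted_dist u N (u N.+1).
have -> : \sum_(i < N.+1) lam ^+ (N.+1 - i) * (u N.+1 - u i) ^+ 2 =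
   lam * \sum_(i < N.+1) lam ^+ (N - i) * (u N.+1 - u i) ^+ 2.
  rewrite mulr_sumr; apply: eq_bigr => i _.
  by rewrite subSn ?exprS ?mulrA // -ltnS.
have := lt0r_neq0 (mass_gt0 N.+1); rewrite /excess /kap /= (exprS lam).
move: (\sum_(i < N.+1) lam ^+ (N - i) * _) => W.
move: (\sum_(j < N.+1) _) (quad N u) => U Q.
move: (mass N) (center u N) (variance u N) (u N.+1) (u 0%N) (lam ^+ N) => m c v w w0 L m0 E.
have -> : W = m * (w - c) ^+ 2 + v - mu * L * (w - w0) ^+ 2 by rewrite -E addrK.
by field; apply/andP.
Qed.

End Quadratic.

Section QuadraticBounds.
Variables (R : realFieldType) (lam : R).
Hypotheses (lam_gt0 : 0 < lam) (lam_lt1 : lam < 1).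
Implicit Types (u x e : nat -> R) (N n k : nat).

Definition stiffness : R := 2 * lam * (1 + lam) / (1 - lam).

Lemma stiffness_ge : 2 * lam <= stiffness.
Proof.
rewrite /stiffness ler_pdivlMr ?subr_gt0 // ler_pM2l ?mulr_gt0 //.
by have := lam_gt0; lra.
Qed.

Lemma stiffness_gt0 : 0 < stiffness.
Proof. by apply: lt_le_trans stiffness_ge; rewrite mulr_gt0. Qed.

(** Infinitely many nodes added on the left at the height of the first one make the
coefficients constant, and only increase the energy. *)
Lemma quad_le_excess N u e :
  e 0%N = u 1%N - u 0%N ->
  (forall k, e k.+1 = u k.+2 - u k.+1 + lam * e k) ->
  quad lam N u <= stiffness * \sum_(k < N) e k ^+ 2.
Proof.
move=> e0 eS; set mu := lam / (1 - lam).
have l0 : 0 < 1 - lam by rewrite subr_gt0.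
have l1 := lt0r_neq0 l0.
have mu0 : 0 <= mu by rewrite divr_ge0 // ltW.
have massE n : mass lam mu n = (1 - lam)^-1.
  by elim: n => [|n IH] /=; rewrite ?IH /mu; field.
have ratioE n : lam * mass lam mu n / mass lam mu n.+1 = lam.
  by rewrite !massE; field.
have eE k : e k = excess lam mu u k.
  elim: k => [|k IH]; first by rewrite e0.
  by rewrite excessS // ratioE eS IH.
have := quad_excess lam_gt0 lam_lt1 mu0 N u.
rewrite [X in _ = X](_ : _ = stiffness * \sum_(k < N) e k ^+ 2); last first.
  rewrite mulr_sumr; apply: eq_bigr => k _ /=.
  rewrite -[1 + lam * _]/(mass lam mu k.+1) ratioE massE eE; congr (_ * _).
  by rewrite /stiffness; field.
have lge0 := ltW lam_gt0; have oge0 := ltW l0.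
move=> <-; rewrite -addrA lerDl addr_ge0 //.
  apply: mulr_ge0; first exact: mulr_ge0.
  by apply: sumr_ge0 => j _; rewrite mulr_ge0 ?sqr_ge0 ?exprn_ge0.
by apply: mulr_ge0; [rewrite divr_ge0 ?mulr_ge0|exact: variance_ge0].
Qed.

Lemma sum_geometric_le N : \sum_(k < N) lam ^+ k <= (1 - lam)^-1.
Proof.
rewrite -[leRHS]mul1r ler_pdivlMr ?subr_gt0 // mulrC.
have -> : (1 - lam) * (\sum_(k < N) lam ^+ k) = 1 - lam ^+ N.
  by rewrite -[RHS]opprB subrX1 -mulNr opprB.
by rewrite gerBl exprn_ge0 // ltW.
Qed.

Lemma variance_sum u N : variance lam 0 u N.+1 =
  \sum_(k < N.+1) lam ^+ (N - k)
    * (lam * mass lam 0 k / mass lam 0 k.+1) * excess lam 0 u k ^+ 2.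
Proof.
elim: N => [|N IH].
  by rewrite big_ord1 /= expr0; ring.
rewrite big_ord_recr subnn -[variance _ _ _ _]/(lam * variance lam 0 u N.+1 + _) IH.
rewrite mulr_sumr expr0 mul1r; congr (_ + _).
apply: eq_bigr => k _; have kN : (k <= N)%N by rewrite -ltnS.
rewrite -[nat_of_ord (widen_ord _ k)]/(nat_of_ord k) subSn // (exprS lam).
by rewrite !mulrA.
Qed.

(** The flux conjugate to an excess is a difference of consecutive bond fluxes, with a
boundary term at the last bond. *)
Lemma sum_flux_excess u x N :
  let r k := lam * mass lam 0 k / mass lam 0 k.+1 in
  let e := excess lam 0 u in
  \sum_(k < N.+1) x k * (u k.+1 - u k) =
  \sum_(k < N.+1) e k * (x k - r k * x k.+1) + r N * x N.+1 * e N.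
Proof.
move=> r e; elim: N => [|N IH].
  by rewrite !big_ord1 /e /excess /=; ring.
rewrite big_ord_recr IH [in RHS]big_ord_recr /=.
have -> : u N.+2 - u N.+1 = e N.+1 - r N * e N.
  by rewrite /e excessS // /r; ring.
ring.
Qed.

Let kap := 2 * lam / (1 - lam).

(** A finite window weakens the local form only near its two ends, and by geometrically
decaying amounts; against a bounded flux the total loss does not depend on the length. *)
Lemma quad_ge_flux : exists2 c : R, 0 <= c & forall N u x (X : R),
  (forall k, (k <= N)%N -> `|x k| <= X) ->
  \sum_(k < N) x k * (u k.+1 - u k)
    - (\sum_(k < N) (x k - lam * x k.+1) ^+ 2 / (4 * stiffness)) - c * X ^+ 2
  <= quad lam N u.
Proof.
have lge0 := ltW lam_gt0.
have l0 : 0 < 1 - lam by rewrite subr_gt0.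
have kap0 : 0 <= kap by rewrite divr_ge0 ?mulr_ge0 // ltW.
have al0 := stiffness_gt0; have al1 := stiffness_ge.
(* The three terms of c1 pay for the last bond, for the ratios r k that are smaller than
   lam near the left end, and for the weakened stiffness near both ends. *)
pose c1 := (8 * lam)^-1 + (2 * lam)^-1 + kap / (2 * lam ^+ 2).
have c10 : 0 <= c1.
  apply: addr_ge0; first by rewrite addr_ge0 // invr_ge0 mulr_ge0.
  by apply: divr_ge0 => //; rewrite mulr_ge0 ?sqr_ge0.
exists (c1 * (2 / (1 - lam))); first by rewrite mulr_ge0 // divr_ge0 // ltW.
case=> [|N] u x X xX.
  rewrite !big_ord0 subrr sub0r (@le_trans _ _ 0) //.
    by rewrite oppr_le0 mulr_ge0 ?sqr_ge0 // mulr_ge0 // divr_ge0 // ltW.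
  by rewrite /quad !big_ord1 (subrr (u _)) expr0n mulr0.
pose m k := mass lam 0 k; pose r k := lam * m k / m k.+1.
pose e := excess lam 0 u.
have m_ge1 k : 1 <= m k by exact: mass_ge1.
have m_gt0 k : 0 < m k by exact: mass_gt0.
have mE k : m k = (1 - lam ^+ k.+1) / (1 - lam).
  elim: k => [|k IH]; first by rewrite /m /= expr1 addr0 divff // lt0r_neq0.
  rewrite -[m _]/(1 + lam * m k) IH !(exprS lam); field; exact: lt0r_neq0.
have r_ge0 k : 0 <= r k by rewrite divr_ge0 ?mulr_ge0 // ltW.
have rE k : r k = 1 - (m k.+1)^-1.
  rewrite /r; have := lt0r_neq0 (m_gt0 k.+1); rewrite -[m k.+1]/(1 + lam * m k) => h.
  by field.
have r_le k : r k <= lam.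
  rewrite rE lerBlDr -lerBlDl mE invf_div ler_pdivlMr.
    by rewrite ger_pMr // gerBl exprn_ge0.
  by rewrite subr_gt0 exprn_ilt1 // ltW.
have r_ge k : lam - r k <= lam ^+ k.+1.
  have p0 : 0 < 1 - lam ^+ k.+2 by rewrite subr_gt0 exprn_ilt1 // ltW.
  rewrite rE mE invf_div opprB addrCA.
  have -> : (1 - lam) / (1 - lam ^+ k.+2) + (lam - 1) = (1 - lam) * lam ^+ k.+2 / (1 - lam ^+ k.+2).
    by field; exact: lt0r_neq0.
  rewrite ler_pdivrMr // (exprS lam k.+1).
  have L0 : 0 <= lam ^+ k.+1 by rewrite exprn_ge0.
  have L1 : lam ^+ k.+1 <= 1 by rewrite exprn_ile1 // ltW.
  rewrite -subr_ge0; set L := lam ^+ k.+1 in L0 L1 *.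
  have -> : L * (1 - lam * L) - (1 - lam) * (lam * L) =
    L * ((1 - lam) ^+ 2 + lam * (1 - L)) by ring.
  by rewrite mulr_ge0 // addr_ge0 ?sqr_ge0 // mulr_ge0 // subr_ge0.
pose B k := 2 * lam * m k + kap * r k - kap * r k * lam ^+ (N - k).
have quadE : quad lam N.+1 u = \sum_(k < N.+1) B k * e k ^+ 2.
  have := quad_excess lam_gt0 lam_lt1 (lexx 0) N.+1 u.
  rewrite mulr0 mul0r addr0 variance_sum => /(canRL (addrK _)) ->.
  rewrite mulr_sumr -sumrB; apply: eq_bigr => k _.
  by rewrite /B /r /m /e -/kap; ring.
have B_ge k : 2 * lam <= B k.
  have L1 : lam ^+ (N - k) <= 1 by rewrite exprn_ile1 // ltW.
  have p1 : 0 <= kap * r k by rewrite mulr_ge0.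
  rewrite /B -addrA; apply: ler_wpDr; last by rewrite ler_pMr // mulr_gt0.
  by rewrite -{1}(mulr1 (kap * r k)) -mulrBr mulr_ge0 // subr_ge0.
have B_gt0 k : 0 < B k by rewrite (lt_le_trans _ (B_ge k)) // mulr_gt0.
have alB k : stiffness - B k <= kap * (2 * lam ^+ k + lam ^+ (N - k)).
  have -> : stiffness - B k = kap * lam ^+ k.+1 + kap * (lam - r k)
      + kap * (r k * lam ^+ (N - k)).
    by rewrite /B mE /stiffness /kap; field; exact: lt0r_neq0.
  have Lk : lam ^+ k.+1 <= lam ^+ k by rewrite exprS ger_pMl ?exprn_gt0 // ltW.
  rewrite -!mulrDr ler_wpM2l // mulr2n mulrDl mul1r !lerD //.
    exact: le_trans (r_ge k) Lk.
  by rewrite ger_pMl ?exprn_gt0 // (le_trans (r_le k)) // ltW.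
(* Cutting the flux off after the last bond removes the boundary term of the summation
   by parts. *)
pose x' k := if (k <= N)%N then x k else 0.
have xE : \sum_(k < N.+1) x k * (u k.+1 - u k) =
    \sum_(k < N.+1) e k * (x' k - r k * x' k.+1).
  have x'N : x' N.+1 = 0 by rewrite /x' ltnn.
  have := sum_flux_excess u x' N; cbv zeta; rewrite x'N mulr0 mul0r addr0 => <-.
  by apply: eq_bigr => k _; rewrite /x' -ltnS ltn_ord.
have X_ge0 : 0 <= X by rewrite (le_trans _ (xX 0%N _)).
have term (k : 'I_N.+1) : (x' k - r k * x' k.+1) ^+ 2 / (4 * B k) <=
    (x k - lam * x k.+1) ^+ 2 / (4 * stiffness)
      + c1 * X ^+ 2 * (lam ^+ k + lam ^+ (N - k)).
  have X2 : 0 <= X ^+ 2 by rewrite sqr_ge0.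
  have Lk : 0 <= lam ^+ k by rewrite exprn_ge0.
  have LN : 0 <= lam ^+ (N - k) by rewrite exprn_ge0.
  have kN : (k <= N)%N by rewrite -ltnS.
  have xk := xX _ (leqW kN); have xl := xX _ (ltn_ord k).
  have [kN1|kN1] := leqP k.+1 N; last first.
    have kE : k = N :> nat by apply/eqP; rewrite eqn_leq kN.
    rewrite /x' kE leqnn ltnn mulr0 subr0 -kE subnn expr0.
    have h1 : x k ^+ 2 / (4 * B k) <= X ^+ 2 / (8 * lam).
      rewrite ler_pM ?sqr_ge0 ?invr_ge0 ?mulr_ge0 // ?(ltW (B_gt0 _)) //.
        by rewrite -[leLHS]real_normK ?num_real // lerXn2r ?nnegrE ?xk ?xl.
      by rewrite lef_pV2 ?posrE ?mulr_gt0 //; have := B_ge k; lra.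
    apply: (le_trans h1); apply: ler_wpDl.
      by rewrite divr_ge0 ?sqr_ge0 // mulr_ge0 // ltW.
    have h2 : (8 * lam)^-1 <= c1.
      rewrite /c1 -addrA lerDl; apply: addr_ge0; first by rewrite invr_ge0 mulr_ge0.
      by apply: divr_ge0 => //; rewrite mulr_ge0 ?sqr_ge0.
    rewrite [leLHS]mulrC; apply: (@le_trans _ _ (c1 * X ^+ 2)).
      by rewrite ler_wpM2r.
    by rewrite ler_peMr ?mulr_ge0 // lerDr.
  rewrite /x' kN kN1; set s := x k - r k * x k.+1; set t := x k - lam * x k.+1.
  have bnd c : 0 <= c -> c <= 1 -> `|x k - c * x k.+1| <= 2 * X.
    move=> c0' c1'; apply: (le_trans (ler_normB _ _)).
    rewrite mulr2n mulrDl mul1r lerD ?xk ?xl // normrM (ger0_norm c0').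
    by rewrite (le_trans (ler_wpM2r _ c1')) ?mul1r ?xk ?xl.
  have sX : `|s| <= 2 * X by rewrite bnd // (le_trans (r_le k)) // ltW.
  have tX : `|t| <= 2 * X by rewrite bnd // ltW.
  have s2 : s ^+ 2 <= 4 * X ^+ 2.
    rewrite -[s ^+ 2]real_normK ?num_real // (_ : 4 * X ^+ 2 = (2 * X) ^+ 2); last by ring.
    by rewrite lerXn2r ?nnegrE ?mulr_ge0.
  have d0 : 0 <= lam - r k by rewrite subr_ge0.
  have dL : lam - r k <= lam ^+ k.
    by rewrite (le_trans (r_ge k)) // exprS ger_pMl ?exprn_gt0 // ltW.
  have st : s ^+ 2 - t ^+ 2 <= 4 * X ^+ 2 * lam ^+ k.
    have -> : s ^+ 2 - t ^+ 2 = (lam - r k) * (x k.+1 * (s + t)) by rewrite /s /t; ring.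
    have h : x k.+1 * (s + t) <= 4 * X ^+ 2.
      apply: (le_trans (ler_norm _)); rewrite normrM.
      apply: (@le_trans _ _ (X * (4 * X))); last by rewrite mulrCA -expr2.
      rewrite ler_pM ?xk ?xl // (le_trans (ler_normD _ _)) //.
      rewrite (_ : 4 * X = 2 * X + 2 * X); last by ring.
      exact: lerD.
    apply: (le_trans (ler_wpM2l d0 h)); rewrite mulrC ler_wpM2l // mulr_ge0 //.
  have step1 : s ^+ 2 / (4 * B k) = s ^+ 2 / (4 * stiffness)
      + s ^+ 2 / 4 * ((stiffness - B k) / (stiffness * B k)).
    field; rewrite !lt0r_neq0 //.
  have step2 : s ^+ 2 / 4 * ((stiffness - B k) / (stiffness * B k)) <=
      X ^+ 2 * (kap * (2 * lam ^+ k + lam ^+ (N - k)) / (4 * lam ^+ 2)).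
    have p0 : 0 <= kap * (2 * lam ^+ k + lam ^+ (N - k)).
      by rewrite mulr_ge0 // addr_ge0 // mulr_ge0.
    apply: (@le_trans _ _ (s ^+ 2 / 4 * (kap * (2 * lam ^+ k + lam ^+ (N - k)) / (4 * lam ^+ 2)))).
      rewrite ler_wpM2l ?divr_ge0 ?sqr_ge0 //.
      apply: (@le_trans _ _ (kap * (2 * lam ^+ k + lam ^+ (N - k)) / (stiffness * B k))).
        by rewrite ler_wpM2r // invr_ge0 mulr_ge0 // ltW.
      have p1 : 0 < stiffness * B k by exact: mulr_gt0.
      have p2 : 0 < 4 * lam ^+ 2 by rewrite mulr_gt0 ?exprn_gt0.
      rewrite ler_wpM2l // lef_pV2 //.
      rewrite (_ : 4 * lam ^+ 2 = (2 * lam) * (2 * lam)); last by ring.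
      by rewrite ler_pM ?mulr_ge0.
    have p3 : 0 <= kap * (2 * lam ^+ k + lam ^+ (N - k)) / (4 * lam ^+ 2).
      by apply: divr_ge0 => //; rewrite mulr_ge0 // sqr_ge0.
    by rewrite ler_wpM2r // ler_pdivrMr // mulrC.
  have step3 : s ^+ 2 / (4 * stiffness) <= t ^+ 2 / (4 * stiffness) + X ^+ 2 * lam ^+ k / (2 * lam).
    rewrite -lerBlDl -mulrBl.
    apply: (@le_trans _ _ (4 * X ^+ 2 * lam ^+ k / (4 * stiffness))).
      by rewrite ler_wpM2r // invr_ge0 mulr_ge0 // ltW.
    rewrite -[4 * X ^+ 2 * _]mulrA invfM mulrACA divff ?pnatr_eq0 // mul1r.
    have p1 : 0 < 2 * lam by exact: mulr_gt0.
    by rewrite ler_wpM2l ?mulr_ge0 // lef_pV2.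
  rewrite step1; apply: (le_trans (lerD step3 step2)); rewrite -addrA lerD2l.
  rewrite -subr_ge0.
  have -> : c1 * X ^+ 2 * (lam ^+ k + lam ^+ (N - k)) -
     (X ^+ 2 * lam ^+ k / (2 * lam) +
     X ^+ 2 * (kap * (2 * lam ^+ k + lam ^+ (N - k)) / (4 * lam ^+ 2))) =
     X ^+ 2 * ((8 * lam)^-1 * (lam ^+ k + lam ^+ (N - k))
       + (2 * lam)^-1 * lam ^+ (N - k) + kap / (4 * lam ^+ 2) * lam ^+ (N - k)).
    by rewrite /c1; move: (lam ^+ k) (lam ^+ (N - k)) => L1 L2; field; exact: lt0r_neq0.
  apply: mulr_ge0 => //; apply: addr_ge0; first apply: addr_ge0.
  - by rewrite mulr_ge0 ?addr_ge0 // invr_ge0 mulr_ge0.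
  - by rewrite mulr_ge0 // invr_ge0 mulr_ge0.
  - by rewrite mulr_ge0 // divr_ge0 // mulr_ge0 // sqr_ge0.
have amgm (k : 'I_N.+1) : e k * (x' k - r k * x' k.+1) <=
    B k * e k ^+ 2 + (x' k - r k * x' k.+1) ^+ 2 / (4 * B k).
  set s := _ - _; rewrite -subr_ge0.
  have -> : B k * e k ^+ 2 + s ^+ 2 / (4 * B k) - e k * s =
     (2 * B k * e k - s) ^+ 2 / (4 * B k) by field; rewrite lt0r_neq0.
  by rewrite divr_ge0 ?sqr_ge0 // mulr_ge0 // ltW.
have geo : \sum_(k < N.+1) (lam ^+ k + lam ^+ (N - k)) <= 2 / (1 - lam).
  rewrite big_split /= (reindex_inj rev_ord_inj) /= mulr2n mulrDl mul1r lerD //.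
    rewrite (eq_bigr (fun k : 'I_N.+1 => lam ^+ (N - k))); last by move=> i _; rewrite subSS.
    rewrite (reindex_inj rev_ord_inj) /=.
    rewrite (eq_bigr (fun k : 'I_N.+1 => lam ^+ k)) ?sum_geometric_le // => i _.
    by rewrite subSS subKn // -ltnS.
  rewrite (reindex_inj rev_ord_inj) /=.
  rewrite (eq_bigr (fun k : 'I_N.+1 => lam ^+ k)) ?sum_geometric_le // => i _.
  by rewrite subSS subKn // -ltnS.
rewrite xE quadE lerBlDr lerBlDr.
apply: (@le_trans _ _ (\sum_(k < N.+1) (B k * e k ^+ 2
    + ((x k - lam * x k.+1) ^+ 2 / (4 * stiffness)
      + c1 * X ^+ 2 * (lam ^+ k + lam ^+ (N - k)))))).
  by apply: ler_sum => k _; apply: (le_trans (amgm k)); rewrite lerD2l.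
rewrite big_split /= -addrA lerD2l big_split /= addrC lerD2r -mulr_sumr.
by rewrite -[leRHS]mulrAC ler_wpM2l // mulr_ge0 // sqr_ge0.
Qed.

End QuadraticBounds.

(** * Subgradients and the convex conjugate of the potential *)
Record potential (R : realType) (ft : R -> R) : Prop := Potential {
  potential_convex : strictly_convex ft;
  potential0 : ft 0 = 0;
  potential_ge0 : forall z, 0 <= ft z;
  potential_growth : exists c1 c2 : R, 0 < c1 /\ 0 < c2 /\
     forall z : R, 0 <= z -> c1 * z ^+ 2 - c2 <= ft z }.

Section Convex.
Variables (R : realType) (ft : R -> R).
Hypothesis Hft : potential ft.
Let ft_convex := potential_convex Hft.
Let ft0 := potential0 Hft.
Let ft_ge0 := potential_ge0 Hft.
Let ft_growth := potential_growth Hft.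
Implicit Types (s x y z w : R).

Definition subgradient s z : Prop := forall w, ft z + s * (w - z) <= ft w.

Lemma convex_between x y w : x < y -> y < w ->
  (w - x) * ft y < (w - y) * ft x + (y - x) * ft w.
Proof.
move=> xy yw; have xw := lt_trans xy yw; have d0 : 0 < w - x by rewrite subr_gt0.
have dn := lt0r_neq0 d0.
have := @ft_convex x w ((w - y) / (w - x)).
rewrite lt_eqF // => /(_ isT).
have -> : (w - y) / (w - x) * x + (1 - (w - y) / (w - x)) * w = y by field.
have t01 : 0 < (w - y) / (w - x) < 1.
  by rewrite divr_gt0 ?subr_gt0 //= ltr_pdivrMr // mul1r ltrD2l ltrN2.
move=> /(_ t01); rewrite -(ltr_pM2l d0) => h; apply: (lt_le_trans h).
by rewrite le_eqVlt; apply/orP; left; apply/eqP; field.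
Qed.

Lemma subgradient_exists z : exists s, subgradient s z.
Proof.
pose S := [set (ft z - ft w) / (z - w) | w in [set w | w < z]].
have ub v : z < v -> ubound S ((ft v - ft z) / (v - z)).
  move=> zv _ [w /= wz <-]; rewrite ler_pdivrMr ?subr_gt0 //.
  rewrite mulrAC ler_pdivlMr ?subr_gt0 //.
  by have := convex_between wz zv; lra.
have S0 : S !=set0.
  by exists ((ft z - ft (z - 1)) / (z - (z - 1))), (z - 1); rewrite //= ltrBlDr ltrDl.
have hS : has_sup S.
  by split=> //; exists ((ft (z + 1) - ft z) / (z + 1 - z)); apply: ub; rewrite ltrDl.
exists (sup S) => w; have [wz|zw|->] := ltgtP w z.
- have : (ft z - ft w) / (z - w) <= sup S.
    by apply: ub_le_sup; [exact: hS.2|exists w].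
  by rewrite ler_pdivrMr ?subr_gt0 //; lra.
- have : sup S <= (ft w - ft z) / (w - z) by apply: ge_sup => //; exact: ub.
  by rewrite ler_pdivlMr ?subr_gt0 //; lra.
- by rewrite subrr mulr0 addr0.
Qed.

Lemma subgradient_lt s z w : subgradient s z -> w != z -> ft z + s * (w - z) < ft w.
Proof.
move=> sz wz; have := sz (2^-1 * z + (1 - 2^-1) * w).
have h : 0 < (2^-1 : R) < 1 by apply/andP; split; lra.
have zw : z != w by rewrite eq_sym.
by have := ft_convex zw h; lra.
Qed.

Lemma subgradient_mono s s' z z' :
  subgradient s z -> subgradient s' z' -> z < z' -> s < s'.
Proof.
move=> sz sz' zz'; have d0 : 0 < z' - z by rewrite subr_gt0.
have h1 := subgradient_lt sz (negbT (gt_eqF zz')).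
have h2 := subgradient_lt sz' (negbT (lt_eqF zz')).
by rewrite -(ltr_pM2r d0); lra.
Qed.

Lemma subgradient0 : subgradient 0 0.
Proof. by move=> w; rewrite mul0r addr0 ft0. Qed.

Lemma ft_increasing a b : 0 <= a -> a < b -> ft a < ft b.
Proof.
rewrite le_eqVlt => /predU1P[<-|a0] ab.
  by have := subgradient_lt subgradient0 (negbT (gt_eqF ab)); rewrite mul0r addr0.
have b0 := lt_trans a0 ab.
have := convex_between a0 ab; rewrite ft0 mulr0 add0r !subr0 => h.
have : b * ft a < b * ft b by apply: (lt_le_trans h); rewrite ler_wpM2r // ltW.
by rewrite ltr_pM2l.
Qed.

(** The point is the supremum Z of the points with a subgradient of slope at most y.  A
subgradient at Z bounds the function from below near Z; with this bound, the tangents at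
points just below and just above Z pass to the limit. *)
Lemma legendre_point y : 0 <= y -> exists2 z, 0 <= z & subgradient y z.
Proof.
move=> y0; case: ft_growth => c1 [c2 [c10 [c20 g]]].
pose A := [set z | 0 <= z /\ exists2 s, s <= y & subgradient s z].
have A0 : A 0 by split=> //; exists 0 => //; exact: subgradient0.
have ub : ubound A ((y + 1) / c1 + c2).
  move=> z [z0 [s sy sz]].
  have := sz 0; rewrite ft0 sub0r => h; have := g z z0 => h2.
  rewrite leNgt; apply/negP => zbig.
  have z1 : (y + 1) / c1 < z by apply: le_lt_trans zbig; rewrite lerDl ltW.
  have z2 : c2 < z by apply: le_lt_trans zbig; rewrite lerDr divr_ge0 ?addr_ge0 // ltW.
  move: z1; rewrite ltr_pdivrMr // => z1.
  have : s * z <= y * z by rewrite ler_wpM2r.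
  have : (y + 1) * z <= z * c1 * z by rewrite ler_wpM2r // ltW.
  by rewrite expr2 in h2; lra.
have hA : has_sup A by split; [exists 0|exists ((y + 1) / c1 + c2)].
set Z := sup A; have Z0 : 0 <= Z by apply: ub_le_sup => //; exact: hA.2.
exists Z => // w; have [s' sZ] := subgradient_exists Z.
suff H e : 0 < e -> ft Z + y * (w - Z) <= ft w + e by apply/ler_addgt0Pr.
move=> e0; have M0 : 0 < `|s'| + `|y| + 1 by rewrite ltr_wpDl ?addr_ge0.
set d := e / (`|s'| + `|y| + 1); have d0 : 0 < d by rewrite divr_gt0.
have close z : `|z - Z| <= d -> ft Z + y * (w - Z) <= ft z + y * (w - z) + e.
  move=> zd; have := sZ z => h.
  have : (s' - y) * (Z - z) <= e.
    apply: (le_trans (ler_norm _)); rewrite normrM distrC.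
    have -> : e = (`|s'| + `|y| + 1) * d by rewrite /d mulrC divfK // lt0r_neq0.
    rewrite ler_pM // 1?distrC // (le_trans (ler_normB _ _)) // lerDl.
    done.
  lra.
have [wZ|Zw|wZ] := ltgtP w Z; last first.
- by rewrite -wZ subrr mulr0 addr0 lerDl ltW.
- pose z := Z + Num.min d ((w - Z) / 2).
  have m0 : 0 < Num.min d ((w - Z) / 2) by rewrite lt_min d0 divr_gt0 ?subr_gt0.
  have zZ : Z < z by rewrite ltrDl.
  have zw : z < w.
    apply: (@le_lt_trans _ _ (Z + (w - Z) / 2)); last by lra.
    by rewrite lerD2l ge_min lexx orbT.
  have [s sz] := subgradient_exists z.
  have sy : y < s.
    rewrite ltNge; apply/negP => sy.
    have : z <= Z by apply: ub_le_sup; [exact: hA.2|split; [exact: le_trans Z0 (ltW zZ)|exists s]].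
    by rewrite leNgt zZ.
  apply: (le_trans (close z _)).
    by rewrite /z addrC addKr ger0_norm ?(ltW m0) // ge_min lexx.
  have := sz w; have : y * (w - z) <= s * (w - z) by rewrite ler_wpM2r ?subr_ge0 // ltW.
  lra.
- have dw : 0 < Num.min d (Z - w) by rewrite lt_min d0 subr_gt0.
  have [z [z0 [s sy sz]] zd] := sup_adherent dw hA.
  have zZ : z <= Z.
    by apply: ub_le_sup; [exact: hA.2|split=> //; exists s].
  move: zd; rewrite -/Z => zd.
  have zd1 : Z - d < z by apply: le_lt_trans zd; rewrite lerD2l lerN2 ge_min lexx.
  have zd2 : w < z.
    apply: le_lt_trans zd; rewrite -{1}(subKr Z w) lerD2l lerN2.
    by rewrite ge_min lexx orbT.
  apply: (le_trans (close z _)).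
    by rewrite distrC ger0_norm ?subr_ge0 // lerBlDl -lerBlDr ltW.
  have := sz w; have : y * (w - z) <= s * (w - z) by rewrite ler_wnM2r // subr_le0 ltW.
  lra.
Qed.

(** The derivative of the convex conjugate; negative slopes are sent to 0, which keeps it
monotone and continuous on the whole line. *)
Definition zeta y : R := xget 0 [set z | 0 <= z /\ subgradient (Num.max y 0) z].

Lemma zetaP y : 0 <= zeta y /\ subgradient (Num.max y 0) (zeta y).
Proof.
rewrite /zeta; case: xgetP => [z -> //|].
have y0 : 0 <= Num.max y 0 by rewrite le_max lexx orbT.
by have [z z0 sz] := legendre_point y0 => /(_ z)[].
Qed.

Lemma zeta_ge0 y : 0 <= zeta y. Proof. by case: (zetaP y). Qed.

Lemma zeta_subgradient y : 0 <= y -> subgradient y (zeta y).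
Proof. by move=> y0; case: (zetaP y) => _; rewrite max_l. Qed.

Lemma zeta_unique y z : 0 <= y -> subgradient y z -> zeta y = z.
Proof.
move=> y0 sz; apply/eqP/negPn/negP => ne.
have h1 := subgradient_lt sz ne; rewrite eq_sym in ne.
by have h2 := subgradient_lt (zeta_subgradient y0) ne; lra.
Qed.

Lemma zeta_neg y : y <= 0 -> zeta y = 0.
Proof.
move=> y0; rewrite -(@zeta_unique 0 0) //; last exact: subgradient0.
rewrite /zeta maxxx; congr xget.
by rewrite max_r.
Qed.

Lemma zeta_mono x y : x <= y -> zeta x <= zeta y.
Proof.
move=> xy; have [x0|x0] := ltP 0 x; last by rewrite zeta_neg // zeta_ge0.
have y0 := lt_le_trans x0 xy; rewrite leNgt; apply/negP => h.
have := subgradient_mono (zeta_subgradient (ltW y0)) (zeta_subgradient (ltW x0)) h.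
by rewrite ltNge xy.
Qed.

Lemma zeta_surj z : 0 <= z -> exists2 y, 0 <= y & zeta y = z.
Proof.
rewrite le_eqVlt => /predU1P[<-|z0]; first by exists 0 => //; exact: zeta_neg.
have [s sz] := subgradient_exists z; have s0 := ltW (subgradient_mono subgradient0 sz z0).
by exists s => //; exact: zeta_unique.
Qed.

(** A monotone function whose range has no gaps has no jumps. *)
Lemma zeta_continuous : continuous zeta.
Proof.
move=> x; apply/cvgrPdist_le => e e0.
have [y1 y10 y1E] := zeta_surj (addr_ge0 (zeta_ge0 x) (ltW e0)).
have xy1 : x < y1.
  by rewrite ltNge; apply/negP => /zeta_mono; rewrite y1E; lra.
have [y0 xy0 y0E] : exists2 y0, y0 < x & zeta x - e <= zeta y0.
  have [h|h] := leP (zeta x - e) 0.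
    by exists (x - 1); [lra|rewrite (le_trans h) // zeta_ge0].
  have [y _ yE] := zeta_surj (ltW h); exists y; last by rewrite yE.
  by rewrite ltNge; apply/negP => /zeta_mono; rewrite yE; lra.
near=> t.
have : t \in `]y0, y1[ by near: t; apply: near_in_itvoo; rewrite in_itv /= xy0.
rewrite in_itv /= => /andP[/ltW/zeta_mono h0 /ltW/zeta_mono h1].
rewrite y1E in h1; rewrite ler_norml; apply/andP; split; lra.
Unshelve. all: end_near. Qed.

(** The convex conjugate, written through the point that realises it. *)
Definition fts y : R := y * zeta y - ft (zeta y).

Lemma fenchel y w : 0 <= y -> y * w - fts y <= ft w.
Proof. by move=> y0; have := zeta_subgradient y0 w; rewrite /fts; lra. Qed.

Lemma fts_tangent y y' : 0 <= y' -> fts y + zeta y * (y' - y) <= fts y'.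
Proof. by move=> y0; have := zeta_subgradient y0 (zeta y); rewrite /fts; lra. Qed.

Lemma fts0 : fts 0 = 0.
Proof. by rewrite /fts mul0r zeta_neg // ft0 subrr. Qed.

Lemma ft_zeta y : ft (zeta y) = y * zeta y - fts y.
Proof. by rewrite /fts subKr. Qed.

End Convex.

(** * The flux through a block between two broken bonds *)
Record chain (R : realType) (ft : R -> R) (lam al : R) : Prop := Chain {
  chain_potential : potential ft;
  chain_lam_gt0 : 0 < lam;
  chain_lam_lt1 : lam < 1;
  chain_al_gt0 : 0 < al }.

Section Flux.
Variables (R : realType) (ft : R -> R) (lam al : R).
Hypothesis M : chain ft lam al.
Let Hft := chain_potential M.
Let lam_gt0 := chain_lam_gt0 M.
Let lam_lt1 := chain_lam_lt1 M.
Let al_gt0 := chain_al_gt0 M.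
Local Notation zeta := (zeta ft).
Local Notation fts := (fts ft).
Implicit Types (p s t : R) (n k j : nat) (y : nat -> R).

(** Stationarity of the cost of a flux y reads y_(k+1) = bend y_k - y_(k-1). *)
Definition bend p (t : R) : R :=
  ((1 + lam ^+ 2) * t + 2 * al * zeta t - (1 - lam) ^+ 2 * p) / lam.

Fixpoint traj2 p s n : R * R :=
  if n is m.+1 then ((traj2 p s m).2, bend p (traj2 p s m).2 - (traj2 p s m).1)
  else (0, s).

Definition traj p s n : R := (traj2 p s n).1.

Lemma traj1 p s : traj p s 1 = s. Proof. by []. Qed.

Lemma trajSS p s k : traj p s k.+2 = bend p (traj p s k.+1) - traj p s k.
Proof. by []. Qed.

(** The coefficient (1 + lam^2) / lam is at least 2, so solutions that start with
different slopes separate at least linearly. *)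
Lemma bend_expand p t t' : t <= t' -> 2 * (t' - t) <= bend p t' - bend p t.
Proof.
move=> tt'; rewrite -mulrBl ler_pdivlMr //.
have := zeta_mono Hft tt' => h; have : 0 <= al * (zeta t' - zeta t).
  by rewrite mulr_ge0 ?subr_ge0 // ltW.
have : 0 <= (1 - lam) ^+ 2 * (t' - t) by rewrite mulr_ge0 ?sqr_ge0 ?subr_ge0.
lra.
Qed.

Lemma bend_nonpos p t : t <= 0 -> bend p t <= 2 * t - (1 - lam) ^+ 2 * p / lam.
Proof.
move=> t0; rewrite /bend (zeta_neg Hft t0) mulr0 addr0 mulrBl lerD2r ler_pdivrMr //.
have : 0 <= (1 - lam) ^+ 2 * - t by rewrite mulr_ge0 ?sqr_ge0 ?oppr_ge0.
lra.
Qed.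

Lemma bend_above p t : p <= t -> 2 * t <= bend p t.
Proof.
move=> pt; rewrite ler_pdivlMr //.
have : 0 <= al * zeta t by rewrite mulr_ge0 ?(zeta_ge0 Hft) // ltW.
have : 0 <= (1 - lam) ^+ 2 * (t - p) by rewrite mulr_ge0 ?sqr_ge0 ?subr_ge0.
lra.
Qed.

Lemma traj_spread p s s' k : s <= s' ->
  0 <= traj p s' k - traj p s k /\
  s' - s <= (traj p s' k.+1 - traj p s k.+1) - (traj p s' k - traj p s k).
Proof.
move=> ss'; elim: k => [|k [IH1 IH2]].
  by rewrite !traj1 /traj /= !subr0.
have h : traj p s k.+1 <= traj p s' k.+1 by rewrite -subr_ge0; lra.
split; first by rewrite subr_ge0.
by have := bend_expand p h; rewrite !trajSS; lra.
Qed.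

Lemma traj_spread_lin p s s' k : s <= s' ->
  k%:R * (s' - s) <= traj p s' k - traj p s k.
Proof.
move=> ss'; elim: k => [|k IH]; first by rewrite mul0r /traj subrr.
by have [_] := traj_spread p k ss'; rewrite -natr1; lra.
Qed.

Lemma traj_lt p s s' k : s < s' -> (0 < k)%N -> traj p s k < traj p s' k.
Proof.
move=> ss' k0; rewrite -subr_gt0; apply: lt_le_trans (traj_spread_lin p k (ltW ss')).
by rewrite mulr_gt0 ?ltr0n // subr_gt0.
Qed.

Lemma bend_continuous p : continuous (bend p).
Proof.
move=> t; apply: cvgM; last exact: cvg_cst.
apply: cvgB; last exact: cvg_cst.
apply: cvgD; apply: cvgM; try exact: cvg_cst; first exact: cvg_id.
exact: (zeta_continuous Hft).
Qed.

Lemma traj_continuous p k : continuous (fun s => traj p s k).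
Proof.
suff : continuous (fun s => traj p s k) /\ continuous (fun s => traj p s k.+1) by case.
elim: k => [|k [IH1 IH2]].
  by split=> s; [exact: cvg_cst|exact: cvg_id].
split=> // s; apply: cvgB; last exact: IH1.
by apply: (@continuous_comp _ _ _ (fun s => traj p s k.+1) (bend p));
  [exact: IH2|exact: bend_continuous].
Qed.

(** Below 0 the solution is strictly concave, above p it is convex: a solution that
crosses either level in the outward direction never returns. *)
Lemma traj_descend p s k j : 0 < p ->
  traj p s k.+1 <= traj p s k -> traj p s k.+1 <= 0 ->
  traj p s (k + j).+2 < traj p s (k + j).+1 <= 0.
Proof.
move=> p0 d1 d0; have c0 : 0 < (1 - lam) ^+ 2 * p / lam.
  by rewrite divr_gt0 // mulr_gt0 // exprn_gt0 // subr_gt0.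
elim: j => [|j /andP[IH1 IH2]].
  by rewrite addn0 d0 andbT trajSS; have := bend_nonpos p d0; lra.
rewrite addnS (le_trans (ltW IH1) IH2) andbT.
by rewrite [ltLHS]trajSS; have := bend_nonpos p (le_trans (ltW IH1) IH2); lra.
Qed.

Lemma traj_ascend p s k j :
  traj p s k <= traj p s k.+1 -> p <= traj p s k.+1 ->
  p <= traj p s (k + j).+1 <= traj p s (k + j).+2.
Proof.
move=> d1 d0; elim: j => [|j /andP[IH1 IH2]].
  by rewrite addn0 d0 trajSS; have := bend_above d0; lra.
rewrite addnS (le_trans IH1 IH2) [leRHS]trajSS.
by have := bend_above (le_trans IH1 IH2); lra.
Qed.

(** The value at n is continuous in the initial slope, at most 0 for the slope 0, and
grows at least linearly with the slope. *)
Lemma shoot p n : 0 < p -> (0 < n)%N -> exists s, traj p s n = 0.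
Proof.
case: n => // n p0 _.
have T0 k : traj p 0 k.+1 <= 0.
  case: k => [|k]; first by rewrite traj1.
  by have /andP[/ltW h] := @traj_descend p 0 0 k p0 (lexx _) (lexx _); exact: le_trans.
have S0 : 0 <= - traj p 0 n.+1 by rewrite oppr_ge0.
have TS : 0 <= traj p (- traj p 0 n.+1) n.+1.
  have := traj_spread_lin p n.+1 S0; rewrite subr0 => h.
  have : 0 <= n%:R * - traj p 0 n.+1 by rewrite mulr_ge0.
  by rewrite -natr1 in h; lra.
have [||s _ sE] := @IVT R (fun s => traj p s n.+1) 0 (- traj p 0 n.+1) 0 S0.
- by apply: continuous_subspaceT => x; exact: traj_continuous.
- by rewrite ge_min le_max (T0 n) TS orbT.
by exists s.
Qed.

Definition initial_slope p n : R := xget 0 [set s | traj p s n = 0].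

(** The optimal flux of a block; its zeros 0 and n are the broken bonds that delimit it. *)
Definition block p n : nat -> R := traj p (initial_slope p n).

Lemma block0 p n : block p n 0 = 0. Proof. by []. Qed.

Lemma blockSS p n k : block p n k.+2 = bend p (block p n k.+1) - block p n k.
Proof. exact: trajSS. Qed.

Lemma block_end p n : 0 < p -> (0 < n)%N -> block p n n = 0.
Proof.
move=> p0 n0; rewrite /block /initial_slope; case: xgetP => [s -> //|].
by have [s sE] := shoot p0 n0 => /(_ s).
Qed.

Lemma block_unique p n s : 0 < p -> (0 < n)%N -> traj p s n = 0 -> s = initial_slope p n.
Proof.
move=> p0 n0 sE; have e := block_end p0 n0.
have [h|h|//] := ltgtP s (initial_slope p n).
- by have := traj_lt p h n0; rewrite sE -/(block _ _) e ltxx.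
- by have := traj_lt p h n0; rewrite sE -/(block _ _) e ltxx.
Qed.

Lemma block_gt0 p n k : 0 < p -> (0 < k)%N -> (k < n)%N -> 0 < block p n k.
Proof.
move=> p0 k0 kn; rewrite ltNge; apply/negP => yk.
have ex : exists k, (0 < k)%N && (block p n k <= 0) by exists k; rewrite k0.
case: (ex_minnP ex) => -[//|m] /andP[_ ym] mmin.
have mn : (m.+1 < n)%N by apply: leq_ltn_trans kn; apply: mmin; rewrite k0.
have d : block p n m.+1 <= block p n m.
  case: m ym mmin mn => [//|m] ym mmin _; rewrite (le_trans ym) // leNgt; apply/negP => ym'.
  by have := mmin m.+1; rewrite ltnn /= (ltW ym') => /(_ isT).
have := @traj_descend p (initial_slope p n) m (n - m.+2) p0 d ym.
have -> : (m + (n - m.+2)).+2 = n by rewrite -!addSn subnKC.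
rewrite -/(block _ _) (block_end p0 (ltn_trans (ltn0Sn _) mn)) => /andP[+ h2].
by rewrite ltNge h2.
Qed.

Lemma block_ge0 p n k : 0 < p -> (k <= n)%N -> 0 <= block p n k.
Proof.
move=> p0; rewrite leq_eqVlt => /predU1P[->|kn].
  by case: n => [|n]; rewrite ?block0 // block_end.
by case: k kn => [|k] kn; rewrite ?block0 // ltW // block_gt0.
Qed.

Lemma block_le p n k : 0 < p -> (k <= n)%N -> block p n k <= p.
Proof.
move=> p0 kn; rewrite leNgt; apply/negP => yk.
have ex : exists k, p < block p n k by exists k.
case: (ex_minnP ex) => -[|m] ym mmin; first by rewrite block0 ltNge (ltW p0) in ym.
have mk : (m.+1 <= k)%N by exact: mmin.
have mn := leq_trans mk kn.
have d : block p n m <= block p n m.+1.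
  rewrite (le_trans _ (ltW ym)) // leNgt; apply/negP => /mmin; by rewrite ltnn.
have := @traj_ascend p (initial_slope p n) m (n - m.+1) d (ltW ym).
have -> : (m + (n - m.+1)).+2 = n.+1 by rewrite -!addSn addSn subnKC.
have -> : (m + (n - m.+1)).+1 = n by rewrite -addSn subnKC.
rewrite -/(block _ _) (block_end p0 (leq_trans (ltn0Sn _) mn)) => /andP[].
by rewrite leNgt p0.
Qed.

(** The recursion is symmetric, so the reversed flux is the solution with the same zeros. *)
Lemma block_reverse p n k : 0 < p -> (k <= n)%N -> block p n (n - k) = block p n k.
Proof.
move=> p0; case: n => [|n]; first by case: k.
pose s := block p n.+1 n.
have H j : (j <= n)%N -> traj p s j = block p n.+1 (n.+1 - j) /\
    traj p s j.+1 = block p n.+1 (n - j).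
  elim: j => [|j IH] jn; first by rewrite !subn0 block_end.
  have [IH1 IH2] := IH (ltnW jn); rewrite subSS; split=> //.
  rewrite trajSS IH1 IH2 subSn ?(ltnW jn) // -(subnSK jn) blockSS; ring.
have sE : s = initial_slope p n.+1.
  apply: block_unique => //; have [_] := H n (leqnn n); rewrite subnn block0 //.
case: k => [|k] kn; first by rewrite subn0 block_end.
by have [_] := H k kn; rewrite sE subSS.
Qed.

(** At n the flux of the longer block is still positive, so it started more steeply, and
solutions are ordered by their initial slopes. *)
Lemma block_lt_succ p n k : 0 < p -> (0 < n)%N -> (0 < k)%N ->
  block p n k < block p n.+1 k.
Proof.
move=> p0 n0 k0; apply: traj_lt => //; rewrite ltNge; apply/negP.
rewrite le_eqVlt => /predU1P[e|h].
  have := block_gt0 p0 n0 (ltnSn n); rewrite /block e -/(block p n) block_end //.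
  by rewrite ltxx.
have := block_gt0 p0 n0 (ltnSn n); have := traj_lt p h n0; rewrite -!/(block _ _) block_end //.
by move=> h1 h2; have := lt_trans h1 h2; rewrite ltxx.
Qed.

(** By symmetry the flux b of the longer block dominates the flux a of the shorter one
aligned at either end; weighting the two comparisons at k by n - k and k + 1 compares the
means. *)
Lemma block_mean_lt p n : 0 < p -> (0 < n)%N ->
  n.+1%:R * \sum_(k < n) block p n k < n%:R * \sum_(k < n.+1) block p n.+1 k.
Proof.
move=> p0 n0; set a := block p n; set b := block p n.+1.
have ab k : a k <= b k.
  by case: k => [|k]; [rewrite /a /b !block0|rewrite ltW // block_lt_succ].
have ab' k : (k < n)%N -> a k <= b k.+1.
  move=> kn; have kn1 : (k.+1 < n.+1)%N by [].
  rewrite /a /b -(block_reverse p0 (ltnW kn)) -(block_reverse p0 (ltnW kn1)).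
  by rewrite subSS; exact: ab.
have -> : n%:R * \sum_(k < n.+1) b k =
   \sum_(k < n) (n - k)%:R * b k + \sum_(k < n) k.+1%:R * b k.+1.
  have -> : \sum_(k < n) (n - k)%:R * b k = \sum_(k < n.+1) (n%:R - k%:R) * b k.
    rewrite [RHS]big_ord_recr /= subrr mul0r addr0; apply: eq_bigr => k _.
    by rewrite natrB // ltnW.
  have -> : \sum_(k < n) k.+1%:R * b k.+1 = \sum_(k < n.+1) k%:R * b k.
    by rewrite [RHS]big_ord_recl /= mul0r add0r.
  by rewrite -big_split mulr_sumr; apply: eq_bigr => k _ /=; ring.
have -> : n.+1%:R * \sum_(k < n) a k =
   \sum_(k < n) (n - k)%:R * a k + \sum_(k < n) k.+1%:R * a k.
  rewrite -big_split mulr_sumr; apply: eq_bigr => k _ /=.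
  by rewrite -mulrDl -natrD addnS subnK // ltnW.
apply: ler_ltD; first by apply: ler_sum => k _; rewrite ler_wpM2l.
case: n n0 @a @b ab ab' => // n _ a b ab ab'.
rewrite [ltLHS]big_ord_recl [ltRHS]big_ord_recl /=; apply: ltr_leD.
  by rewrite /a block0 mulr0 mul1r /b block_gt0.
by apply: ler_sum => k _; rewrite ler_wpM2l // ab' // ltnS ltn_ord.
Qed.

End Flux.

(** * The cost of a block *)
Section Cost.
Variables (R : realType) (ft : R -> R) (lam al : R).
Hypothesis M : chain ft lam al.
Let Hft := chain_potential M.
Let lam_gt0 := chain_lam_gt0 M.
Let lam_lt1 := chain_lam_lt1 M.
Let al_gt0 := chain_al_gt0 M.
Local Notation zeta := (zeta ft).
Local Notation fts := (fts ft).
Local Notation block := (block ft lam al).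
Implicit Types (p s t : R) (n k j m : nat) (y d : nat -> R).

(** The dual cost of a site with flux a whose successor has flux b; the square is the
conjugate of the energy of the excess at that site. *)
Definition link p (a b : R) : R :=
  fts a + ((1 - lam) * p - a + lam * b) ^+ 2 / (4 * al).

Definition cost p n y : R := \sum_(k < n) link p (y k) (y k.+1).

Definition block_cost p n : R := cost p n (block p n).

(** Up to the factor 1 / (2 al), the excess that is dual to the flux y. *)
Definition tension p y k : R := (1 - lam) * p - y k + lam * y k.+1.

(** The derivative of the block cost with respect to the load, which is also the total
strain of the block. *)
Definition cost_slope p n : R :=
  (1 - lam) ^+ 2 / (2 * al) * (n%:R * p - \sum_(k < n) block p n k).

Lemma block_euler p n k : 2 * al * zeta (block p n k.+1) =
  tension p (block p n) k.+1 - lam * tension p (block p n) k.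
Proof.
have l0 := lt0r_neq0 lam_gt0.
by rewrite /tension blockSS /bend; field.
Qed.

Lemma sum_tension p n : 0 < p -> (0 < n)%N ->
  \sum_(k < n) tension p (block p n) k = (1 - lam) * (n%:R * p - \sum_(k < n) block p n k).
Proof.
move=> p0 n0; rewrite !big_split /= sumrN sumr_const card_ord -mulr_sumr.
have -> : \sum_(k < n) block p n k.+1 = \sum_(k < n) block p n k.
  case: n n0 => // n _; rewrite big_ord_recr [RHS]big_ord_recl /=.
  by rewrite (block_end M) // addr0 block0 add0r.
by rewrite -mulr_natl; ring.
Qed.

Lemma cost_slope_tension p n : 0 < p -> (0 < n)%N ->
  cost_slope p n = (1 - lam) / (2 * al) * \sum_(k < n) tension p (block p n) k.
Proof. by move=> p0 n0; rewrite sum_tension // /cost_slope; ring. Qed.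

(** The first variation of the cost vanishes at an optimal block: by stationarity the sum
telescopes. *)
Lemma block_sum_by_parts p n d : 0 < p -> (0 < n)%N -> d 0%N = 0 -> d n = 0 ->
  \sum_(k < n) (zeta (block p n k) * d k +
    tension p (block p n) k * (- d k + lam * d k.+1) / (2 * al)) = 0.
Proof.
move=> p0 n0 d0 dn; have a0 := lt0r_neq0 al_gt0.
pose T k := if k is j.+1 then lam * tension p (block p n) j * d k / (2 * al) else 0.
rewrite (eq_bigr (fun k : 'I_n => T k.+1 - T k)); last first.
  move=> [[|k] kn] _ /=; first by rewrite d0; ring.
  have -> : zeta (block p n k.+1) =
      (tension p (block p n) k.+1 - lam * tension p (block p n) k) / (2 * al).
    by rewrite -block_euler; field.
  by field.
rewrite -(big_mkord predT (fun k => T k.+1 - T k)) telescope_sumr //.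
by case: n n0 @T dn => // n _ T dn; rewrite /T dn mulr0 mul0r subrr.
Qed.

(** The cost is jointly convex in the load and the flux.  The quadratic remainder is kept
exactly, since uniqueness of the optimal flux and strict convexity in the load come from
it. *)
Lemma cost_tangent p p' n y : 0 < p -> (0 < n)%N -> y 0%N = 0 -> y n = 0 ->
  (forall k, (k <= n)%N -> 0 <= y k) ->
  block_cost p n + cost_slope p n * (p' - p) +
   (\sum_(k < n) ((1 - lam) * (p' - p) - (y k - block p n k)
       + lam * (y k.+1 - block p n k.+1)) ^+ 2) / (4 * al) <= cost p' n y.
Proof.
move=> p0 n0 y0 yn yge; have a0 := lt0r_neq0 al_gt0.
set B := block p n; pose d k := y k - B k.
have d0 : d 0%N = 0 by rewrite /d y0 /B block0 subrr.
have dn : d n = 0 by rewrite /d yn /B (block_end M) // subrr.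
have E : cost_slope p n * (p' - p) =
    \sum_(k < n) (tension p B k * ((1 - lam) * (p' - p)) / (2 * al)).
  by rewrite -!mulr_suml cost_slope_tension // -/B; field.
have := block_sum_by_parts p0 n0 d0 dn; rewrite -/B => S0.
rewrite -[leLHS]addr0 -[X in _ + X <= _]S0 E /block_cost /cost mulr_suml -!big_split /=.
apply: ler_sum => k _; have h := fts_tangent Hft (B k) (yge k (ltnW (ltn_ord k))).
rewrite /link -[(1 - lam) * p - block p n k + _]/(tension p B k) -/B.
have -> : (1 - lam) * p' - y k + lam * y k.+1 = tension p B k +
   ((1 - lam) * (p' - p) - (y k - B k) + lam * (y k.+1 - B k.+1)).
  by rewrite /tension; ring.
set t := tension p B k; rewrite -subr_ge0.
set r := (1 - lam) * (p' - p) - (y k - B k) + lam * (y k.+1 - B k.+1).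
have -> : fts (y k) + (t + r) ^+ 2 / (4 * al) -
  (fts (B k) + t ^+ 2 / (4 * al) + t * ((1 - lam) * (p' - p)) / (2 * al) +
   r ^+ 2 / (4 * al) +
   (zeta (B k) * d k + t * (- d k + lam * d k.+1) / (2 * al)))
  = fts (y k) - (fts (B k) + zeta (B k) * (y k - B k)).
  by rewrite /r /d; field.
by rewrite subr_ge0.
Qed.

Lemma block_cost_le p n y : 0 < p -> (0 < n)%N -> y 0%N = 0 -> y n = 0 ->
  (forall k, (k <= n)%N -> 0 <= y k) -> block_cost p n <= cost p n y.
Proof.
move=> p0 n0 y0 yn yge; apply: le_trans (cost_tangent p p0 n0 y0 yn yge).
rewrite subrr mulr0 addr0 lerDl divr_ge0 ?sumr_ge0 ?mulr_ge0 ?(ltW al_gt0) //.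
by move=> i _; rewrite sqr_ge0.
Qed.

(** The quadratic remainder vanishes, which gives a one-step recursion for the difference
of the two fluxes; it is solved backwards from the last zero. *)
Lemma block_cost_attained p n y : 0 < p -> (0 < n)%N -> y 0%N = 0 -> y n = 0 ->
  (forall k, (k <= n)%N -> 0 <= y k) -> cost p n y <= block_cost p n ->
  forall k, (k <= n)%N -> y k = block p n k.
Proof.
move=> p0 n0 y0 yn yge cg.
have := le_trans (cost_tangent p p0 n0 y0 yn yge) cg.
rewrite subrr mulr0 addr0 gerDl pmulr_lle0 ?invr_gt0 ?mulr_gt0 // => le0.
have /psumr_eq0P eq0 : forall i : 'I_n, true -> 0 <= ((1 - lam) * 0 - (y i - block p n i)
       + lam * (y i.+1 - block p n i.+1)) ^+ 2 by move=> i _; rewrite sqr_ge0.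
have E0 := eq0 (le_anti (introT andP (conj le0 (sumr_ge0 _ (fun i _ => sqr_ge0 _))))).
have step k : (k < n)%N -> y k.+1 = block p n k.+1 -> y k = block p n k.
  move=> kn e; have /eqP := E0 (Ordinal kn) isT; rewrite sqrf_eq0 /= e.
  by rewrite subrr !mulr0 addr0 sub0r oppr_eq0 subr_eq0 => /eqP.
move=> k kn; rewrite -(subKn kn); elim: (n - k)%N (leq_subr k n) => [|j IH] jn.
  by rewrite subn0 yn (block_end M).
apply: step; first by rewrite ltn_subrL.
by rewrite subnSK //; apply: IH; exact: ltnW.
Qed.

Lemma block_cost_convex p p' n : 0 < p -> 0 < p' -> (0 < n)%N ->
  block_cost p n + cost_slope p n * (p' - p) <= block_cost p' n.
Proof.
move=> p0 p'0 n0.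
have h := cost_tangent p' p0 n0 (block0 _ _ _ p' n) (block_end M p'0 n0)
   (fun k => block_ge0 M p'0).
apply: le_trans h; rewrite lerDl divr_ge0 ?sumr_ge0 ?mulr_ge0 ?(ltW al_gt0) //.
by move=> i _; rewrite sqr_ge0.
Qed.

Lemma block_cost_sconvex p p' n : 0 < p -> 0 < p' -> (0 < n)%N -> p != p' ->
  block_cost p n + cost_slope p n * (p' - p) < block_cost p' n.
Proof.
move=> p0 p'0 n0 pp'.
have h := cost_tangent p' p0 n0 (block0 _ _ _ p' n) (block_end M p'0 n0)
   (fun k => block_ge0 M p'0).
apply: lt_le_trans h; rewrite ltrDl divr_gt0 ?mulr_gt0 //.
rewrite lt_neqAle sumr_ge0 ?andbT; last by move=> i _; rewrite sqr_ge0.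
apply/negP => /eqP/esym/psumr_eq0P eq0.
have {}eq0 := eq0 (fun i _ => sqr_ge0 _).
pose w k := (p' - p) - (block p' n k - block p n k).
have step k : (k < n)%N -> w k = lam * w k.+1.
  move=> kn; have /eqP := eq0 (Ordinal kn) isT; rewrite sqrf_eq0 /= => /eqP.
  by rewrite /w; lra.
have wn : w n = p' - p by rewrite /w !(block_end M) // subrr subr0.
have w0 : w 0%N = p' - p by rewrite /w !block0 subrr subr0.
have wk k : (k <= n)%N -> w (n - k)%N = lam ^+ k * (p' - p).
  elim: k => [|k IH] kn; first by rewrite subn0 expr0 mul1r.
  by rewrite step ?ltn_subrL // subnSK // IH ?(ltnW kn) // exprS mulrA.
have := wk n (leqnn n); rewrite subnn w0 => /eqP.
rewrite -subr_eq0 -{1}(mul1r (p' - p)) -mulrBl mulf_eq0.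
rewrite subr_eq0 [p' - p == 0]subr_eq0 [p' == p]eq_sym (negbTE pp') orbF.
by rewrite gt_eqF // exprn_ilt1 // ?ltW // -lt0n.
Qed.

Lemma cost_slope_lt p p' n : 0 < p -> (0 < n)%N -> p < p' -> cost_slope p n < cost_slope p' n.
Proof.
move=> p0 n0 pp'; have p'0 := lt_trans p0 pp'.
have h1 := block_cost_sconvex p0 p'0 n0 (negbT (lt_eqF pp')).
have h2 := block_cost_sconvex p'0 p0 n0 (negbT (gt_eqF pp')).
have d : 0 < p' - p by rewrite subr_gt0.
by rewrite -(ltr_pM2r d); lra.
Qed.

Definition curv : R := (1 - lam) ^+ 2 / (4 * al).

Lemma curv_gt0 : 0 < curv.
Proof. by rewrite divr_gt0 ?mulr_gt0 ?exprn_gt0 // subr_gt0. Qed.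

(** Keeping the flux while changing the load is admissible. *)
Lemma block_cost_upper p p' n : 0 < p -> 0 < p' -> (0 < n)%N ->
  block_cost p' n <= block_cost p n + cost_slope p n * (p' - p) + n%:R * curv * (p' - p) ^+ 2.
Proof.
move=> p0 p'0 n0.
have := block_cost_le p'0 n0 (block0 _ _ _ p n) (block_end M p0 n0) (fun k => block_ge0 M p0).
move/le_trans; apply; have a0 := lt0r_neq0 al_gt0.
have E : cost_slope p n * (p' - p) =
    \sum_(k < n) (tension p (block p n) k * ((1 - lam) * (p' - p)) / (2 * al)).
  by rewrite -!mulr_suml cost_slope_tension //; field.
have -> : n%:R * curv * (p' - p) ^+ 2 = \sum_(k < n) (curv * (p' - p) ^+ 2).
  by rewrite sumr_const card_ord -[RHS]mulr_natl mulrA.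
rewrite E /block_cost /cost -!big_split /= le_eqVlt; apply/orP; left; apply/eqP.
by apply: eq_bigr => k _; rewrite /link /tension /curv; field.
Qed.

Lemma cost_slope_ge0 p n : 0 < p -> 0 <= cost_slope p n.
Proof.
move=> p0; rewrite mulr_ge0 ?divr_ge0 ?sqr_ge0 ?mulr_ge0 ?(ltW al_gt0) //.
rewrite subr_ge0 mulr_natl -[n in p *+ n]card_ord -sumr_const.
by apply: ler_sum => k _; rewrite (block_le M) // ltnW.
Qed.

Lemma cost_slope_le p n : 0 < p -> cost_slope p n <= n%:R * (2 * curv * p).
Proof.
move=> p0; have -> : n%:R * (2 * curv * p) = (1 - lam) ^+ 2 / (2 * al) * (n%:R * p).
  by rewrite /curv; field; rewrite lt0r_neq0.
rewrite ler_wpM2l ?divr_ge0 ?sqr_ge0 ?mulr_ge0 ?(ltW al_gt0) //.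
rewrite gerBl sumr_ge0 // => k _.
by rewrite (block_ge0 M) // ltnW.
Qed.

Lemma block_cost_lipschitz p p' P n : 0 < p -> p <= p' -> p' <= P -> (0 < n)%N ->
  0 <= block_cost p' n - block_cost p n <= n%:R * (2 * curv * P) * (p' - p).
Proof.
move=> p0 pp' p'P n0; have p'0 := lt_le_trans p0 pp'.
have d : 0 <= p' - p by rewrite subr_ge0.
have h1 := block_cost_convex p0 p'0 n0; have h2 := block_cost_convex p'0 p0 n0.
have h3 : 0 <= cost_slope p n * (p' - p) by rewrite mulr_ge0 ?cost_slope_ge0.
have h4 : cost_slope p' n * (p' - p) <= n%:R * (2 * curv * P) * (p' - p).
  rewrite ler_wpM2r // (le_trans (cost_slope_le n p'0)) // ler_wpM2l // ler_wpM2l //.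
  by rewrite mulr_ge0 // ltW // curv_gt0.
by apply/andP; split; lra.
Qed.

Lemma block_cost_quadratic p n : 0 < p -> (0 < n)%N -> block_cost p n <= n%:R * (curv * p ^+ 2).
Proof.
move=> p0 n0; apply: (@le_trans _ _ (cost p n (fun=> 0))); first exact: block_cost_le.
rewrite /cost /link (eq_bigr (fun=> curv * p ^+ 2)); last first.
  move=> k _; rewrite (fts0 Hft) /curv; field; by rewrite lt0r_neq0.
by rewrite sumr_const card_ord mulr_natl.
Qed.

Lemma gcost1 p : 0 < p -> block_cost p 1 = curv * p ^+ 2.
Proof.
move=> p0; rewrite /block_cost /cost big_ord1 /link !(block_end M p0) // block0 (fts0 Hft) /curv.
by field; rewrite lt0r_neq0.
Qed.

End Cost.

(** * Concavity in the block length and break thresholds *)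
Section LipschitzFacts.
Variables (R : realType) (f : R -> R) (a b L : R).
Hypothesis L_ge0 : 0 <= L.
Hypothesis f_lip : forall x y, a <= x -> x <= y -> y <= b -> `|f y - f x| <= L * (y - x).

Lemma lipschitz_within : {within `[a, b], continuous f}.
Proof.
apply/subspace_continuousP => x /=; rewrite in_itv /= => /andP[ax xb].
have L1 : 0 < L + 1 by rewrite ltr_wpDl.
apply/cvgrPdist_le => e e0; apply/nbhs_ballP; exists (e / (L + 1)) => /=.
  by rewrite divr_gt0.
move=> t; rewrite -ball_normE /= => xt; rewrite in_itv /= => /andP[at' tb].
have le : L * `|x - t| <= e.
  apply: (@le_trans _ _ ((L + 1) * (e / (L + 1)))).
    by rewrite ler_pM ?lerDl // ltW.
  by rewrite mulrC divfK // lt0r_neq0.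
apply: le_trans le; have [xt'|/ltW tx] := leP x t.
  by rewrite distrC (le_trans (f_lip ax xt' tb)) // ler_wpM2l // distrC ler_norm.
by rewrite (le_trans (f_lip at' tx xb)) // ler_wpM2l // ler_norm.
Qed.

(** The maximum over the segment cannot be attained before its right end. *)
Lemma increasing_of_local : a < b ->
  (forall x, a <= x -> x < b -> exists2 x', x < x' <= b & f x < f x') -> f a < f b.
Proof.
move=> ab loc; have [c cab cmax] := EVT_max (ltW ab) lipschitz_within.
have cb : c = b.
  move: (cab); rewrite in_itv /= => /andP[ac]; rewrite le_eqVlt => /predU1P[//|cb].
  have [x' /andP[cx x'b] /lt_geF] := loc c ac cb.
  by rewrite cmax // in_itv /= x'b (le_trans ac (ltW cx)).
have [x' /andP[ax x'b] lt] := loc a (lexx a) ab.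
apply: (lt_le_trans lt); rewrite -cb; apply: cmax.
by rewrite in_itv /= x'b ltW.
Qed.

End LipschitzFacts.

Section Concavity.
Variables (R : realType) (ft : R -> R) (lam al : R).
Hypothesis M : chain ft lam al.
Let Hft := chain_potential M.
Let lam_gt0 := chain_lam_gt0 M.
Let lam_lt1 := chain_lam_lt1 M.
Let al_gt0 := chain_al_gt0 M.
Local Notation zeta := (zeta ft).
Local Notation fts := (fts ft).
Local Notation block := (block ft lam al).
Local Notation link := (link ft lam al).
Local Notation cost := (cost ft lam al).
Local Notation g := (block_cost ft lam al).
Local Notation cost_slope := (cost_slope ft lam al).
Local Notation curv := (curv lam al).
Implicit Types (p s t : R) (n k j m : nat) (y d : nat -> R).

Lemma cost_cons p n y :
  cost p n.+1 y = link p (y 0%N) (y 1%N) + cost p n (fun i => y i.+1).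
Proof. by rewrite /cost big_ord_recl. Qed.

Lemma eq_cost p n y y' : (forall k, (k <= n)%N -> y k = y' k) ->
  cost p n y = cost p n y'.
Proof. by move=> e; apply: eq_bigr => k _; rewrite !e // ltnW. Qed.

Lemma cost_insert p n j y : (j <= n)%N ->
  cost p n.+1 (fun i => if (i <= j)%N then y i else y i.-1) =
  cost p n y + link p (y j) (y j).
Proof.
elim: j n y => [|j IH] n y; first by rewrite cost_cons addrC.
case: n => // n jn; rewrite cost_cons [in RHS]cost_cons /= -[RHS]addrA.
have /= <- := IH n (fun i => y i.+1) jn; congr (_ + _).
by apply: eq_cost => -[|k] _.
Qed.

Lemma cost_delete p n j y : (j < n)%N ->
  cost p n (fun i => if (i <= j)%N then y i else y i.+1) =
  cost p n.+1 y + link p (y j) (y j.+2) - link p (y j) (y j.+1)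
    - link p (y j.+1) (y j.+2).
Proof.
elim: j n y => [|j IH] [|n] y // jn; first by rewrite !cost_cons /=; ring.
by rewrite cost_cons (IH n (fun i => y i.+1)) //= [in RHS]cost_cons; ring.
Qed.

(** Take the first summit of the optimal flux with n + 1 sites, duplicate it in one copy
and delete it in another.  Neighbouring values attract each other, so the total cost does
not increase, and strictly decreases unless the next value is equal to the summit.  In
that case the longer flux has three equal values at a place where it is not stationary. *)
Lemma block_cost_concave p n : 0 < p -> (0 < n)%N -> g p n.+2 + g p n < 2 * g p n.+1.
Proof.
move=> p0 n0; set y := block p n.+1.
have y0 : y 0%N = 0 by exact: block0.
have yn : y n.+1 = 0 by exact: (block_end M).
have ypos k : (k <= n.+1)%N -> 0 <= y k by move=> kn; exact: (block_ge0 M).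
have ex : exists k, y k.+1 <= y k by exists n; rewrite yn ypos.
case: (ex_minnP ex) => -[|j] yj jmin.
  by have := block_gt0 M p0 (ltn0Sn 0) (n0 : (1 < n.+1)%N); rewrite -/y ltNge -[X in _ <= X]y0 yj.
have jn : (j < n)%N by apply: jmin; rewrite yn ypos.
have yj1 : y j < y j.+1 by rewrite ltNge; apply/negP => /jmin; rewrite ltnn.
pose long i := if (i <= j.+1)%N then y i else y i.-1.
pose short i := if (i <= j)%N then y i else y i.+1.
have longE : cost p n.+2 long = g p n.+1 + link p (y j.+1) (y j.+1).
  exact: (cost_insert p y (leqW jn)).
have shortE : cost p n short = g p n.+1 + link p (y j) (y j.+2)
    - link p (y j) (y j.+1) - link p (y j.+1) (y j.+2) by exact: (cost_delete p y jn).
have swap : cost p n.+2 long + cost p n short =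
    2 * g p n.+1 - lam / (2 * al) * ((y j.+1 - y j) * (y j.+1 - y j.+2)).
  by rewrite longE shortE /link; field; rewrite lt0r_neq0.
have gs : g p n <= cost p n short.
  apply: (block_cost_le M) => //; first by rewrite /short leqNgt jn.
  by move=> k kn; rewrite /short; case: ifP => _; apply: ypos => //; exact: leqW.
have long0 : long 0%N = 0 by [].
have longn : long n.+2 = 0 by rewrite /long leqNgt ltnS ltnW.
have longpos k : (k <= n.+2)%N -> 0 <= long k.
  move=> kn; rewrite /long; case: ifP => kj; apply: ypos.
    by rewrite (leq_trans kj) // ltnW.
  by rewrite -ltnS prednK // lt0n; case: (k) kj.
have gl : g p n.+2 <= cost p n.+2 long by exact: (block_cost_le M).
have c0 : 0 < lam / (2 * al) * (y j.+1 - y j) by rewrite mulr_gt0 ?divr_gt0 ?mulr_gt0 ?subr_gt0.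
rewrite ltNge; apply/negP => le2.
have : lam / (2 * al) * (y j.+1 - y j) * (y j.+1 - y j.+2) <= 0 by rewrite -mulrA; lra.
rewrite pmulr_rle0 // subr_le0 => yj2.
have {yj} yj : y j.+2 = y j.+1 by apply/eqP; rewrite eq_le yj yj2.
have att : cost p n.+2 long <= g p n.+2 by move: swap; rewrite yj subrr !mulr0 subr0; lra.
have B k : (k <= n.+2)%N -> long k = block p n.+2 k by apply: (block_cost_attained M).
have := blockSS ft lam al p n.+2 j.+1; rewrite -!B // ?ltnS ?(ltnW jn) // ?leqW // ?(ltnW jn) //.
have := blockSS ft lam al p n.+1 j; rewrite -/y.
by rewrite /long ltnn !leqnn ltnNge leqnSn /= yj; lra.
Qed.

(** A concave sequence lies below its chords extended. *)
Lemma block_cost_chord p m n : 0 < p -> (0 < m)%N -> (0 < n)%N ->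
  g p n <= g p m + (n%:R - m%:R) * (g p m.+1 - g p m).
Proof.
move=> p0 m0 n0; pose inc k := g p k.+1 - g p k.
have dec i : (0 < i)%N -> inc i.+1 <= inc i.
  by move=> i0; have := block_cost_concave p0 i0; rewrite /inc; lra.
have decl i j : (0 < i)%N -> inc (i + j)%N <= inc i.
  move=> i0; elim: j => [|j IH]; first by rewrite addn0.
  by rewrite addnS (le_trans (dec _ _)) // ltn_addr.
have up j : g p (m + j)%N <= g p m + j%:R * inc m.
  elim: j => [|j IH]; first by rewrite addn0 mul0r addr0.
  by rewrite addnS; have := decl m j m0; rewrite {1}/inc -natr1; lra.
have down j : (0 < m - j)%N -> g p (m - j)%N <= g p m - j%:R * inc m.
  elim: j => [|j IH] mj; first by rewrite subn0 mul0r subr0.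
  have mj' : (0 < m - j)%N by rewrite -(subnSK (m := j)) // -subn_gt0 (leq_trans mj) // leq_sub2l.
  have := decl (m - j.+1)%N j.+1 mj; rewrite subnK; last by rewrite ltnW // -subn_gt0.
  have := IH mj'; rewrite {3}/inc subnSK; last by rewrite -subn_gt0.
  by rewrite -natr1; lra.
have [mn|/ltnW nm] := leqP m n.
  by have := up (n - m)%N; rewrite subnKC // natrB.
by have := down (m - n)%N; rewrite subKn // natrB // => /(_ n0); rewrite -/(inc m); lra.
Qed.

(** The break cost at which, under the load p, blocks of n and of n + 1 bonds have the same
gain per bond; for larger break costs the longer blocks are better. *)
Definition threshold p n : R := n.+1%:R * g p n - n%:R * g p n.+1.

Lemma threshold_lt p n : 0 < p -> (0 < n)%N -> threshold p n < threshold p n.+1.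
Proof.
move=> p0 n0; have n1 : (0 : R) < n.+1%:R by rewrite ltr0n.
have := block_cost_concave p0 n0; rewrite -subr_gt0 -(pmulr_rgt0 _ n1) /threshold -!natr1.
lra.
Qed.

Lemma threshold_le p m n : 0 < p -> (0 < m)%N -> (m <= n)%N -> threshold p m <= threshold p n.
Proof.
move=> p0 m0 /subnKC <-; elim: (n - m)%N => [|j IH]; first by rewrite addn0.
by rewrite addnS (le_trans IH) // ltW // threshold_lt // ltn_addr.
Qed.

Lemma threshold_lipschitz p p' P n : 0 < p -> p <= p' -> p' <= P -> (0 < n)%N ->
  `|threshold p' n - threshold p n| <= (2 * n.+1%:R * n.+1%:R * (2 * curv * P)) * (p' - p).
Proof.
move=> p0 pp' p'P n0; have /andP[h1 h2] := block_cost_lipschitz M p0 pp' p'P n0.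
have /andP[h3 h4] := block_cost_lipschitz M p0 pp' p'P (ltn0Sn n).
have nn : (n%:R : R) <= n.+1%:R by rewrite ler_nat.
have n1 : (0 : R) <= n.+1%:R by [].
have n2 : (0 : R) <= n%:R by [].
have L0 : 0 <= 2 * curv * P * (p' - p).
  have c0 := ltW (curv_gt0 M); apply: mulr_ge0; last by rewrite subr_ge0.
  by apply: mulr_ge0; [exact: mulr_ge0|rewrite (le_trans (ltW p0)) // (le_trans pp')].
have -> : threshold p' n - threshold p n =
  n.+1%:R * (g p' n - g p n) - n%:R * (g p' n.+1 - g p n.+1) by rewrite /threshold; ring.
apply: (le_trans (ler_normB _ _)); rewrite !normrM !ger0_norm //.
apply: (@le_trans _ _ (n.+1%:R * (n.+1%:R * (2 * curv * P * (p' - p))) +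
     n.+1%:R * (n.+1%:R * (2 * curv * P * (p' - p))))); last first.
  by rewrite le_eqVlt; apply/orP; left; apply/eqP; ring.
apply: lerD; apply: ler_pM => //.
  by apply: (le_trans h2); rewrite -mulrA ler_wpM2r.
by apply: (le_trans h4); rewrite -mulrA.
Qed.

Let lipschitz_const_ge0 n p : 0 <= p -> 0 <= 2 * n.+1%:R * n.+1%:R * (2 * curv * p).
Proof.
have c0 := ltW (curv_gt0 M); move=> P0; apply: mulr_ge0; first by rewrite !mulr_ge0.
by apply: mulr_ge0 => //; exact: mulr_ge0.
Qed.

Lemma threshold_within p p' n : 0 < p -> p <= p' -> (0 < n)%N ->
  {within `[p, p'], continuous (threshold^~ n)}.
Proof.
move=> p0 pp' n0; have P0 : 0 <= p' by rewrite (le_trans (ltW p0)).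
apply: (@lipschitz_within _ _ _ _ (2 * n.+1%:R * n.+1%:R * (2 * curv * p'))).
  exact: lipschitz_const_ge0.
by move=> x y px xy yp; apply: threshold_lipschitz => //; exact: lt_le_trans px.
Qed.

(** The derivative in the load compares the mean fluxes of the two block lengths. *)
Lemma threshold_increasing p p' n : 0 < p -> p < p' -> (0 < n)%N ->
  threshold p n < threshold p' n.
Proof.
move=> p0 pp' n0; have P0 : 0 <= p' by rewrite (le_trans (ltW p0)) // ltW.
apply: (@increasing_of_local _ (threshold^~ n) _ _ (2 * n.+1%:R * n.+1%:R * (2 * curv * p'))) => //.
- exact: lipschitz_const_ge0.
- by move=> x y px xy yp; apply: threshold_lipschitz => //; exact: lt_le_trans px.
move=> x px xp'; have x0 := lt_le_trans p0 px.
pose D := n.+1%:R * cost_slope x n - n%:R * cost_slope x n.+1.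
have D0 : 0 < D.
  have -> : D = (1 - lam) ^+ 2 / (2 * al) *
    (n%:R * \sum_(k < n.+1) block x n.+1 k - n.+1%:R * \sum_(k < n) block x n k).
    by rewrite /D /cost_slope; ring.
  rewrite mulr_gt0 ?divr_gt0 ?mulr_gt0 ?exprn_gt0 ?subr_gt0 //.
  exact: (block_mean_lt M).
have c0 := curv_gt0 M; have K0 : 0 < n%:R * (n.+1%:R * curv).
  by apply: mulr_gt0; [rewrite ltr0n|apply: mulr_gt0].
pose h := Num.min (p' - x) (D / (n%:R * (n.+1%:R * curv)) / 2).
have h0 : 0 < h by rewrite lt_min subr_gt0 xp' !divr_gt0.
exists (x + h); first by rewrite ltrDl h0 -lerBrDl ge_min lexx.
have xh0 : 0 < x + h by rewrite addr_gt0.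
have l := block_cost_convex M x0 xh0 n0; have u := block_cost_upper M x0 xh0 (ltn0Sn n).
rewrite [x + h - x]addrC addKr in l u.
have hK : n%:R * (n.+1%:R * curv) * h < D.
  rewrite -ltr_pdivlMl // mulrC; apply: (@le_lt_trans _ _ (D / (n%:R * (n.+1%:R * curv)) / 2)).
    by rewrite ge_min lexx orbT.
  by rewrite ltr_pdivrMr // ltr_pMr ?divr_gt0 // ltr1n.
have n1 : (0 : R) <= n.+1%:R by [].
have n2 : (0 : R) <= n%:R by [].
have {}l := ler_wpM2l n1 l; have {}u := ler_wpM2l n2 u.
have : 0 < h * (D - n%:R * (n.+1%:R * curv) * h) by rewrite mulr_gt0 // subr_gt0.
rewrite /threshold /D; lra.
Qed.

End Concavity.

(** * Optimal block lengths and the conjugate density *)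
Section Conjugate.
Variables (R : realType) (ft : R -> R) (lam al C : R).
Hypothesis M : chain ft lam al.
Hypothesis C_gt0 : 0 < C.
Let Hft := chain_potential M.
Let lam_gt0 := chain_lam_gt0 M.
Let lam_lt1 := chain_lam_lt1 M.
Let al_gt0 := chain_al_gt0 M.
Local Notation zeta := (zeta ft).
Local Notation fts := (fts ft).
Local Notation block := (block ft lam al).
Local Notation link := (link ft lam al).
Local Notation cost := (cost ft lam al).
Local Notation g := (block_cost ft lam al).
Local Notation cost_slope := (cost_slope ft lam al).
Local Notation curv := (curv lam al).
Local Notation threshold := (threshold ft lam al).
Implicit Types (p s t : R) (n k j m : nat) (y d : nat -> R).

Lemma threshold_small n : (0 < n)%N ->
  exists2 p0, 0 < p0 & forall p, 0 < p -> p <= p0 -> threshold p n < C.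
Proof.
move=> n0; have c0 := curv_gt0 M.
have K0 : 0 < n.+1%:R * (n%:R * curv) by apply: mulr_gt0; [rewrite ltr0n|rewrite mulr_gt0 ?ltr0n].
pose p1 := Num.min 1 (C / (n.+1%:R * (n%:R * curv)) / 2).
exists p1; first by rewrite lt_min ltr01 !divr_gt0.
move=> p p0; rewrite le_min => /andP[p1' p2].
have g1 : 0 <= g p n.+1.
  apply: sumr_ge0 => k _; rewrite addr_ge0 ?divr_ge0 ?sqr_ge0 ?mulr_ge0 ?(ltW al_gt0) //.
  have y0 := block_ge0 M p0 (ltnW (ltn_ord k)).
  by have := fts_tangent Hft 0 y0; rewrite (fts0 Hft) (zeta_neg Hft (lexx 0)) mul0r addr0.
have g2 := block_cost_quadratic M p0 n0.
apply: (@le_lt_trans _ _ (n.+1%:R * (n%:R * (curv * p ^+ 2)))).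
  rewrite /threshold; have := ler_wpM2l (ler0n R n.+1) g2.
  by have := mulr_ge0 (ler0n R n) g1; lra.
have -> : n.+1%:R * (n%:R * (curv * p ^+ 2)) = n.+1%:R * (n%:R * curv) * p * p by ring.
apply: (@le_lt_trans _ _ (n.+1%:R * (n%:R * curv) * p)).
  by rewrite ger_pMr // mulr_gt0.
rewrite -ltr_pdivlMl // mulrC; apply: (le_lt_trans p2).
by rewrite ltr_pdivrMr // ltr_pMr ?divr_gt0 // ltr1n.
Qed.

(** Testing the block of two bonds with the flux 1 at the intact bond gains an amount
linear in the load. *)
Lemma threshold_large : exists2 p0, 0 < p0 & forall p, p0 <= p -> C < threshold p 1.
Proof.
have d0 : 0 < 1 - lam by rewrite subr_gt0.
have b0 : 0 < 2 * (1 - lam) ^+ 2 / (4 * al) by rewrite divr_gt0 ?mulr_gt0 ?exprn_gt0.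
pose K := `|C| + (1 + lam ^+ 2) / (4 * al) + `|fts 1| + 1.
have K0 : 0 < K.
  by rewrite ltr_wpDl // !addr_ge0 // divr_ge0 ?addr_ge0 ?sqr_ge0 // mulr_ge0 // ltW.
exists (K / (2 * (1 - lam) ^+ 2 / (4 * al))); first by rewrite divr_gt0.
move=> p; rewrite ler_pdivrMr // => Kp.
have p0 : 0 < p by rewrite -(pmulr_lgt0 _ b0) (lt_le_trans K0).
pose y (k : nat) : R := if k == 1%N then 1 else 0.
have := @block_cost_le _ _ _ _ M p 2 y p0 isT erefl erefl.
move=> h.
have {}h : g p 2 <= cost p 2 y by apply: h => k _; rewrite /y; case: ifP => _ //; exact: ler01.
have cE : cost p 2 y = 2 * (curv * p ^+ 2) - p * (2 * (1 - lam) ^+ 2 / (4 * al))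
    + (1 + lam ^+ 2) / (4 * al) + fts 1.
  rewrite /cost big_ord_recl big_ord1 /link /y /= (fts0 Hft) /curv.
  by field; rewrite lt0r_neq0.
rewrite /threshold mul1r (gcost1 M p0).
have := ler_norm C; have := ler_norm (fts 1); rewrite /K in Kp; lra.
Qed.

(** Intermediate values, between small loads, where the threshold is below C, and large
ones. *)
Lemma threshold_hit n : (0 < n)%N -> exists2 p, 0 < p & threshold p n = C.
Proof.
move=> n0; have [a a0 aP] := threshold_small n0; have [b b0 bP] := threshold_large.
pose b' := Num.max a b.
have ab : a <= b' by rewrite le_max lexx.
have b'0 := lt_le_trans a0 ab.
have hb : C <= threshold b' n.
  apply: le_trans (ltW (bP b' _)) _; first by rewrite le_max lexx orbT.
  exact: (threshold_le M).
have [|p pab pE] := IVT ab (threshold_within M a0 ab n0) (v := C).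
  by rewrite ge_min (ltW (aP _ a0 (lexx _))) le_max hb orbT.
exists p => //; move: pab; rewrite in_itv /= => /andP[ap _]; exact: lt_le_trans ap.
Qed.

Definition optimal p n : Prop :=
  forall m, (0 < m)%N -> n%:R * (g p m - C) <= m%:R * (g p n - C).

(** Thresholds increase with the length, so comparing n with its two neighbours is
enough: the gain per bond increases up to n and decreases afterwards. *)
Lemma optimalP p n : 0 < p -> (0 < n)%N -> C <= threshold p n ->
  (forall m, n = m.+2 -> threshold p m.+1 <= C) -> optimal p n.
Proof.
move=> p0 n0 hi lo m m0; have pos k : (0 < k)%N -> (0 : R) < k%:R by rewrite ltr0n.
have [nm|mn] := leqP n m.
  rewrite -(subnKC nm); elim: (m - n)%N => [|j IH]; first by rewrite addn0.
  rewrite addnS; set k := (n + j)%N in IH *.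
  have k0 : (0 < k)%N by rewrite /k ltn_addr.
  have := le_trans hi (threshold_le M p0 n0 (leq_addr j n)); rewrite -/k /threshold => h.
  rewrite -(ler_pM2l (pos _ k0)).
  have := ler_wpM2l (ler0n R k.+1) IH; have := ler_wpM2l (ler0n R n) h.
  by rewrite -natr1; lra.
have lo' k : (0 < k)%N -> (k < n)%N -> threshold p k <= C.
  move=> k0 kn; case: n n0 hi lo mn kn => [|[|n]] // _ _ lo _ kn; first by case: k k0 kn.
  exact: le_trans (threshold_le M p0 k0 kn) (lo n erefl).
have down j : (0 < n - j)%N -> n%:R * (g p (n - j)%N - C) <= (n - j)%:R * (g p n - C).
  elim: j => [|j IH] nj; first by rewrite subn0.
  have nj' : (j < n)%N by rewrite -subn_gt0 (leq_trans nj) // leq_sub2l.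
  have := IH; rewrite subn_gt0 => /(_ nj').
  have := lo' _ nj; rewrite ltn_subrL n0 => /(_ isT).
  rewrite /threshold subnSK //; set k := (n - j.+1)%N in nj *.
  have -> : (n - j)%N = k.+1 by rewrite /k subnSK.
  move=> h1 h2; rewrite -(ler_pM2l (pos _ (ltn0Sn k))).
  have := ler_wpM2l (ler0n R k) h2; have := ler_wpM2l (ler0n R n) h1.
  by rewrite -natr1; lra.
by have := down (n - m)%N; rewrite subKn ?(ltnW mn) //; apply.
Qed.

(** The convex conjugate, at the load p, of the effective energy density. *)
Definition conj_density p : R :=
  sup [set (g p n - C) / n%:R | n in [set n | (0 < n)%N]].

Lemma conj_density_has_sup p : 0 < p ->
  has_sup [set (g p n - C) / n%:R | n in [set n | (0 < n)%N]].
Proof.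
move=> p0; split; first by exists ((g p 1 - C) / 1%:R); exists 1%N.
exists (curv * p ^+ 2) => _ [n /= n0 <-]; rewrite ler_pdivrMr ?ltr0n // mulrC.
by have := block_cost_quadratic M p0 n0; have := C_gt0; lra.
Qed.

Lemma conj_density_ge p n : 0 < p -> (0 < n)%N -> g p n - C <= n%:R * conj_density p.
Proof.
move=> p0 n0; rewrite mulrC -ler_pdivrMr ?ltr0n //.
by apply: ub_le_sup; [exact: (conj_density_has_sup p0).2|exists n].
Qed.

Lemma conj_density_le p q : (forall n, (0 < n)%N -> g p n - C <= n%:R * q) -> conj_density p <= q.
Proof.
move=> H; apply: ge_sup; first by exists ((g p 1 - C) / 1%:R); exists 1%N.
by move=> _ [n /= n0 <-]; rewrite ler_pdivrMr ?ltr0n // mulrC H.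
Qed.

Lemma conj_density_quadratic p : 0 < p -> conj_density p <= curv * p ^+ 2.
Proof.
move=> p0; apply: conj_density_le => n n0.
by have := block_cost_quadratic M p0 n0; have := C_gt0; lra.
Qed.

Lemma conj_density_optimal p n : 0 < p -> (0 < n)%N -> optimal p n ->
  g p n - C = n%:R * conj_density p.
Proof.
move=> p0 n0 opt; have n1 : (0 : R) < n%:R by rewrite ltr0n.
apply/eqP; rewrite eq_le conj_density_ge //= mulrC -ler_pdivlMr //.
apply: conj_density_le => m m0; rewrite mulrA ler_pdivlMr // mulrC.
exact: opt.
Qed.

Lemma conj_density_lipschitz p p' P : 0 < p -> p <= p' -> p' <= P ->
  0 <= conj_density p' - conj_density p <= 2 * curv * P * (p' - p).
Proof.
move=> p0 pp' p'P; have p'0 := lt_le_trans p0 pp'; apply/andP; split.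
  rewrite subr_ge0; apply: conj_density_le => n n0; apply: le_trans (conj_density_ge p'0 n0).
  by have /andP[h _] := block_cost_lipschitz M p0 pp' p'P n0; lra.
rewrite lerBlDr; apply: conj_density_le => n n0; have := conj_density_ge p0 n0.
by have /andP[_ h] := block_cost_lipschitz M p0 pp' p'P n0; lra.
Qed.

(** If longer blocks are always better, the gain per bond is at most its limit for long
blocks, and this limit is the gain of a constant flux: a constant flux cut down to 0 at
the ends of a block costs a bounded amount more. *)
Lemma uniform_flux p : 0 < p -> (forall n, (0 < n)%N -> threshold p n < C) ->
  exists y : R, [/\ 0 <= y, y <= p, (1 - lam) ^+ 2 * (p - y) = 2 * al * zeta y &
    conj_density p <= link p y y].
Proof.
move=> p0 thr.
have [||y yp yE] := @IVT R (fun y : R => 2 * al * zeta y + (1 - lam) ^+ 2 * (y - p)) 0 p 0 (ltW p0).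
- apply: continuous_subspaceT => x; apply: cvgD.
    by apply: cvgM; [exact: cvg_cst|exact: (zeta_continuous Hft)].
  by apply: cvgM; [exact: cvg_cst|apply: cvgB; [exact: cvg_id|exact: cvg_cst]].
- rewrite subrr mulr0 addr0 (zeta_neg Hft (lexx 0)) mulr0 add0r sub0r.
  have h1 : (1 - lam) ^+ 2 * - p <= 0 by rewrite mulr_ge0_le0 ?sqr_ge0 // oppr_le0 ltW.
  have h2 : 0 <= 2 * al * zeta p by rewrite mulr_ge0 ?(zeta_ge0 Hft) // mulr_ge0 // ltW.
  by rewrite ge_min h1 le_max h2 orbT.
move: yp; rewrite in_itv /= => /andP[y0 yp]; exists y; split => //; first by lra.
set ginf := link p y y.
have ft0 : 0 <= fts y.
  by have := fts_tangent Hft 0 y0; rewrite (fts0 Hft) (zeta_neg Hft (lexx 0)) mul0r addr0.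
have ginf0 : 0 <= ginf.
  by rewrite addr_ge0 // divr_ge0 ?sqr_ge0 // mulr_ge0 // ltW.
pose c := link p 0 y + link p y 0.
have bound m : g p m.+2 <= m.+2%:R * ginf + c.
  pose w (k : nat) := if (0 < k < m.+2)%N then y else 0.
  have wn : w m.+2 = 0 by rewrite /w ltnn andbF.
  have := @block_cost_le _ _ _ _ M p m.+2 w p0 isT erefl wn.
  have wge k : (k <= m.+2)%N -> 0 <= w k by move=> _; rewrite /w; case: ifP.
  have wE k : (0 < k)%N -> (k < m.+2)%N -> w k = y by move=> k0 km; rewrite /w k0 km.
  move=> /(_ wge) /le_trans; apply; rewrite cost_cons /cost big_ord_recr /=.
  rewrite wn (erefl : w 0%N = 0) !wE //.
  rewrite (eq_bigr (fun=> ginf)); last first.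
    by move=> i _; rewrite !wE ?ltnS ?ltn_ord // ltnW.
  rewrite sumr_const card_ord.
  by rewrite -[ginf *+ m]mulr_natl /c -!natr1; move: ginf0; lra.
have mono n m : (0 < n)%N -> (n + m)%:R * (g p n - C) <= n%:R * (g p (n + m)%N - C).
  move=> n0; elim: m => [|m IH]; first by rewrite addn0.
  rewrite addnS; set k := (n + m)%N in IH *.
  have k0 : (0 < k)%N by rewrite /k ltn_addr.
  have kR : (0 : R) < k%:R by rewrite ltr0n.
  have := ltW (thr k k0); rewrite /threshold => h.
  rewrite -(ler_pM2l kR); have := ler_wpM2l (ler0n R k.+1) IH.
  by have := ler_wpM2l (ler0n R n) h; rewrite -natr1; lra.
apply: conj_density_le => n n0; rewrite leNgt; apply/negP; rewrite -subr_gt0.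
set e := _ - _ => e0.
have nR : (0 : R) < n%:R by rewrite ltr0n.
have K m : m.+2%:R * e <= n%:R * `|c|.
  have h := mono n m.+2 n0.
  have := bound (n + m)%N; rewrite -!addnS => b.
  have := ler_wpM2l (ltW nR) b; have := ler_wpM2l (ltW nR) (ler_norm c).
  have : 0 <= n%:R * C by rewrite mulr_ge0 // ltW.
  have : 0 <= n%:R * e by rewrite mulr_ge0 // ltW.
  by move: h; rewrite /e natrD; lra.
pose m := Num.truncn (n%:R * `|c| / e).
have := K m; rewrite leNgt => /negP; apply.
rewrite -ltr_pdivrMr //; apply: (lt_le_trans (truncnS_gt _)).
by rewrite ler_nat.
Qed.

End Conjugate.

(** * Lower bounds for the energy of a finite chain *)
Section LowerBound.
Variables (R : realType) (ft f : R -> R) (lam : R).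
Local Notation al := (stiffness lam).
Hypothesis M : chain ft lam al.
Let Hft := chain_potential M.
Let lam_gt0 := chain_lam_gt0 M.
Let lam_lt1 := chain_lam_lt1 M.
Let al_gt0 := chain_al_gt0 M.
Local Notation zeta := (zeta ft).
Local Notation fts := (fts ft).
Local Notation block := (block ft lam al).
Local Notation link := (link ft lam al).
Local Notation cost := (cost ft lam al).
Local Notation g := (block_cost ft lam al).
Implicit Types (p s t A B : R) (n k j m N : nat) (y d u : nat -> R) (b : pred nat).

Lemma link_ge0 p (r t : R) : 0 <= r -> 0 <= link p r t.
Proof.
move=> r0; rewrite addr_ge0 //; last by rewrite divr_ge0 ?sqr_ge0 // mulr_ge0 // ltW.
by have := fts_tangent Hft 0 r0; rewrite (fts0 Hft) (zeta_neg Hft (lexx 0)) mul0r addr0.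
Qed.

Lemma cost_cat p m n y y' : y m = y' 0%N ->
  cost p (m + n) (fun k => if (k <= m)%N then y k else y' (k - m)%N) =
  cost p m y + cost p n y'.
Proof.
elim: m y => [|m IH] y e.
  rewrite add0n (_ : cost p 0 y = 0) ?add0r; last by rewrite /cost big_ord0.
  by apply: eq_cost => -[|k] _ //=; rewrite subn0.
rewrite addSn cost_cons [in RHS]cost_cons /= -[RHS]addrA.
by have /= <- := IH (fun i => y i.+1) e.
Qed.

(** Optimal blocks are placed between consecutive broken bonds, the two ends of the chain
counting as broken.  An affine bound on the block costs is all that remembers their
lengths. *)
Lemma broken_flux p A B b N : 0 < p ->
  (forall m, (0 < m)%N -> g p m <= A + B * m%:R) ->
  exists y, [/\ y 0%N = 0, y N.+1 = 0,
     forall k, (k <= N.+1)%N -> 0 <= y k <= p,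
     forall k, (k < N)%N -> b k -> y k.+1 = 0 &
     cost p N.+1 y <= A * (1 + \sum_(k < N) (b k)%:R) + B * N.+1%:R].
Proof.
move=> p0 gAB.
(* Complete a flux that ends at the broken site j by one block of n bonds. *)
have close j n y c r : (0 < n)%N -> y 0%N = 0 -> y j = 0 ->
    (forall k, (k <= j)%N -> 0 <= y k <= p) ->
    (forall k, (k < j)%N -> b k -> y k.+1 = 0) ->
    (forall k, (j <= k < c)%N -> ~~ b k) -> c.+1 = (j + n)%N ->
    cost p j y <= A * r + B * j%:R ->
  exists y, [/\ y 0%N = 0, y c.+1 = 0,
     forall k, (k <= c.+1)%N -> 0 <= y k <= p,
     forall k, (k < c.+1)%N -> (k < c)%N || b k -> b k -> y k.+1 = 0 &
     cost p c.+1 y <= A * (1 + r) + B * c.+1%:R].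
  move=> n0 y0 yj yp yb nb cE yc.
  exists (fun k => if (k <= j)%N then y k else block p n (k - j)%N).
  have E : (c.+1 <= j)%N = false by rewrite cE -[X in (_ <= X)%N]addn0 leq_add2l leqn0 eqn0Ngt n0.
  split=> //=.
  - by rewrite E cE addKn (block_end M).
  - move=> k kc; case: leqP => [|jk]; first exact: yp.
    have kn : (k - j <= n)%N by rewrite leq_subLR -cE.
    by rewrite (block_ge0 M) // (block_le M).
  - move=> k kc kb bk; case: ltnP => [kj|jk]; first exact: yb.
    have [kc'|kc'] := ltnP k c.
      by have := nb k; rewrite jk kc' bk => /(_ isT).
    have -> : k = c by apply/eqP; rewrite eqn_leq kc' -ltnS kc.
    by rewrite cE addKn (block_end M).
  - have e : y j = block p n 0%N by rewrite yj block0.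
    rewrite cE cost_cat //.
    have := gAB n n0; rewrite natrD; have := yc; rewrite /block_cost; lra.
(* Induction on the length, the site j being the last broken one so far. *)
have start : exists j y, [/\ [/\ (j <= N)%N, y 0%N = 0 & y j = 0],
    forall k, (k <= j)%N -> 0 <= y k <= p,
    forall k, (k < j)%N -> b k -> y k.+1 = 0,
    forall k, (j <= k < N)%N -> ~~ b k &
    cost p j y <= A * (\sum_(k < N) (b k)%:R) + B * j%:R].
  elim: N => [|N [j [y [[jN y0 yj] yp yb nb yc]]]].
    exists 0%N, (fun=> 0); split => //.
      by move=> k _; rewrite lexx ltW.
    by rewrite /cost !big_ord0 !mulr0 addr0.
  have [bN|bN] := boolP (b N).
    have cE : N.+1 = (j + (N.+1 - j))%N by rewrite subnKC // leqW.
    have n0 : (0 < N.+1 - j)%N by rewrite subn_gt0 ltnS.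
    have [y' [y'0 y'N y'p y'b y'c]] := close j _ y N _ n0 y0 yj yp yb nb cE yc.
    exists N.+1, y'; split => //.
    - by move=> k kN bk; apply: y'b => //; rewrite bk orbT.
    - by move=> k /andP[h1 h2]; have := leq_trans h2 h1; rewrite ltnn.
    - by rewrite big_ord_recr /= bN addrC.
  exists j, y; split => //.
  - by split => //; exact: leqW.
  - move=> k /andP[jk]; rewrite ltnS leq_eqVlt => /predU1P[->//|kN].
    by apply: nb; rewrite jk.
  - by rewrite big_ord_recr /= (negbTE bN) addr0.
have [j [y [[jN y0 yj] yp yb nb yc]]] := start.
have cE : N.+1 = (j + (N.+1 - j))%N by rewrite subnKC // leqW.
have n0 : (0 < N.+1 - j)%N by rewrite subn_gt0 ltnS.
have [y' [y'0 y'N y'p y'b y'c]] := close j _ y N _ n0 y0 yj yp yb nb cE yc.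
exists y'; split => // k kN bk; apply: y'b => //; first exact: ltnW.
by rewrite kN.
Qed.

Definition energy N u : R := \sum_(k < N) f (u k.+1 - u k) + quad lam N u.

(** Fenchel's inequality at every bond, for the flux of [broken_flux]: the bond k of the
chain corresponds to the site k + 1 there, the site 0 being a virtual broken bond. *)
Lemma energy_lower : exists2 c : R, 0 <= c & forall p A B C N u b, 0 < p ->
  (forall m, (0 < m)%N -> g p m <= A + B * m%:R) ->
  (forall k, (k < N)%N -> b k -> C <= f (u k.+1 - u k)) ->
  (forall k, (k < N)%N -> ~~ b k -> ft (u k.+1 - u k) <= f (u k.+1 - u k)) ->
  p * (u N - u 0%N) - (A - C) * (\sum_(k < N) (b k)%:R) - A - B * N.+1%:R - c * p ^+ 2
    <= energy N u.
Proof.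
have [c c0 cP] := quad_ge_flux lam_gt0 lam_lt1; exists c => // p A B C N u b p0 gAB fb fnb.
have [y [y0 yN yp yb yc]] := broken_flux b N p0 gAB.
have xb k : (k <= N)%N -> `|p - y k.+1| <= p.
  move=> kN; have /andP[h1 h2] := yp k.+1 kN.
  by rewrite ger0_norm ?subr_ge0 // gerBl.
have := cP N u (fun k => p - y k.+1) p xb => Q.
have telesc : p * (u N - u 0%N) = \sum_(k < N) p * (u k.+1 - u k).
  by rewrite -mulr_sumr -(big_mkord predT (fun k => u k.+1 - u k)) telescope_sumr.
have F : \sum_(k < N) (y k.+1 * (u k.+1 - u k) - fts (y k.+1) + C * (b k)%:R) <=
    \sum_(k < N) f (u k.+1 - u k).
  apply: ler_sum => k _; have [bk|bk] := boolP (b k).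
    by rewrite (yb _ (ltn_ord k) bk) (fts0 Hft) mul0r mulr1 subrr add0r fb.
  rewrite mulr0 addr0 (le_trans _ (fnb _ (ltn_ord k) bk)) //.
  by apply: (fenchel Hft); have /andP[] := yp k.+1 (leqW (ltn_ord k)).
have yc' : \sum_(k < N) link p (y k.+1) (y k.+2) <=
    A * (1 + \sum_(k < N) (b k)%:R) + B * N.+1%:R.
  apply: le_trans yc; rewrite /cost big_ord_recl lerDr.
  by rewrite link_ge0 ?y0.
rewrite /energy telesc.
have E1 : \sum_(k < N) p * (u k.+1 - u k) - (\sum_(k < N) link p (y k.+1) (y k.+2))
    + C * \sum_(k < N) (b k)%:R =
   \sum_(k < N) (y k.+1 * (u k.+1 - u k) - fts (y k.+1) + C * (b k)%:R) +
   (\sum_(k < N) (p - y k.+1) * (u k.+1 - u k) -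
    \sum_(k < N) (p - y k.+1 - lam * (p - y k.+2)) ^+ 2 / (4 * al)).
  rewrite mulr_sumr -!sumrB -!big_split /=; apply: eq_bigr => k _.
  have -> : p - y k.+1 - lam * (p - y k.+2) = (1 - lam) * p - y k.+1 + lam * y k.+2.
    by ring.
  by rewrite /link; ring.
move: F Q yc' E1.
set S1 := \sum_(k < N) _; set S2 := \sum_(k < N) _; set S3 := \sum_(k < N) _.
lra.
Qed.

(** The energy per bond of equal increments z, whose excess is z / (1 - lam). *)
Definition uniform_density (z : R) : R := ft z + al * z ^+ 2 / (1 - lam) ^+ 2.

(** The same duality with a constant flux s.  The amount de, gained at the bonds of b,
measures how much the potential exceeds its tangent there. *)
Lemma energy_lower_neg : exists2 c : R, 0 <= c & forall s z de N u b,
  (forall k, (k < N)%N -> ft z + s * (u k.+1 - u k - z) + de * (b k)%:R <= f (u k.+1 - u k)) ->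
  u N - u 0%N = N%:R * z ->
  N%:R * uniform_density z + de * (\sum_(k < N) (b k)%:R)
    - c * (2 * al * z / (1 - lam) ^+ 2) ^+ 2 <= energy N u.
Proof.
have [c c0 cP] := quad_ge_flux lam_gt0 lam_lt1; exists c => // s z de N u b fb uN.
have l0 : 1 - lam != 0 by rewrite subr_eq0 gt_eqF.
set x := 2 * al * z / (1 - lam) ^+ 2.
have Q := cP N u (fun=> x) `|x| (fun k _ => lexx _).
have telesc : \sum_(k < N) (u k.+1 - u k) = N%:R * z.
  by rewrite -uN -(big_mkord predT (fun k => u k.+1 - u k)) telescope_sumr.
have F : \sum_(k < N) (ft z + s * (u k.+1 - u k - z) + de * (b k)%:R) <=
   \sum_(k < N) f (u k.+1 - u k) by apply: ler_sum => k _; exact: fb.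
move: Q F; rewrite -mulr_sumr telesc real_normK ?num_real // sumr_const card_ord.
rewrite big_split /= -mulr_sumr big_split /= sumr_const card_ord -mulr_sumr sumrB telesc.
rewrite sumr_const card_ord /energy -[((x - lam * x) ^+ 2 / (4 * al)) *+ N]mulr_natl.
rewrite -[ft z *+ N]mulr_natl -[z *+ N]mulr_natl.
have -> : x * (N%:R * z) - N%:R * ((x - lam * x) ^+ 2 / (4 * al)) =
    N%:R * (al * z ^+ 2 / (1 - lam) ^+ 2).
  by rewrite /x; field; rewrite l0 lt0r_neq0.
rewrite /uniform_density subrr mulr0 addr0; lra.
Qed.

End LowerBound.

(** * Energies of finite lists of increments *)
Section Accumulation.
Variables (R : realType) (f : R -> R) (lam al : R).
Hypotheses (lam_gt0 : 0 < lam) (lam_lt1 : lam < 1) (al_gt0 : 0 < al).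
Implicit Types (a w z e t : R) (s : seq R) (n k m : nat).
Let lam_ge0 := ltW lam_gt0.
Let al_ge0 := ltW al_gt0.

(** The parameter a is the excess just before the list; the excess after it is
[last_excess]. *)
Fixpoint local_energy a s : R :=
  if s is w :: s' then f w + al * (lam * a + w) ^+ 2 + local_energy (lam * a + w) s'
  else 0.

Fixpoint last_excess a s : R := if s is w :: s' then last_excess (lam * a + w) s' else a.

Lemma local_energy_cat a s s' :
  local_energy a (s ++ s') = local_energy a s + local_energy (last_excess a s) s'.
Proof. by elim: s a => [|w s IH] a /=; rewrite ?add0r // IH addrA. Qed.

Lemma last_excess_cat a s s' : last_excess a (s ++ s') = last_excess (last_excess a s) s'.
Proof. by elim: s a => [|w s IH] a /=. Qed.

Lemma last_excess_ge a s : {in s, forall w, 0 <= w} -> lam ^+ size s * a <= last_excess a s.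
Proof.
elim: s a => [|w s IH] a sp /=; first by rewrite mul1r.
apply: le_trans (IH _ _); last by move=> v vs; rewrite sp // inE vs orbT.
rewrite exprSr -mulrA ler_wpM2l ?exprn_ge0 // lerDl.
by rewrite sp // inE eqxx.
Qed.

Lemma last_excess_ge0 a s : {in s, forall w, 0 <= w} -> 0 <= a -> 0 <= last_excess a s.
Proof. by move=> sp a0; apply: le_trans (last_excess_ge a sp); rewrite mulr_ge0 ?exprn_ge0. Qed.

Lemma local_energy_le a a' s : {in s, forall w, 0 <= w} -> 0 <= a -> a <= a' ->
  local_energy a s <= local_energy a' s.
Proof.
elim: s a a' => [|w s IH] a a' sp a0 aa' //=.
have w0 : 0 <= w by rewrite sp // inE eqxx.
have l1 : lam * a + w <= lam * a' + w by rewrite lerD2r ler_wpM2l.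
have l0 : 0 <= lam * a + w by rewrite addr_ge0 // mulr_ge0.
rewrite lerD ?IH //; last by move=> v vs; rewrite sp // inE vs orbT.
by rewrite lerD2l ler_wpM2l // lerXn2r ?nnegrE // (le_trans l0).
Qed.

Lemma last_excess_bound a s A : {in s, forall w, 0 <= w <= (1 - lam) * A} -> a <= A ->
  last_excess a s <= A.
Proof.
elim: s a => [|w s IH] a sp aA //=; apply: IH.
  by move=> v vs; rewrite sp // inE vs orbT.
have /andP[_ h] := sp w (mem_head _ _).
by have := ler_wpM2l lam_ge0 aA; lra.
Qed.

(** The influence of the initial excess decays geometrically, so a change of it costs an
amount that does not depend on the length of the list. *)
Lemma local_energy_shift a s A D : {in s, forall w, 0 <= w <= (1 - lam) * A} ->
  0 <= a -> a <= A -> 0 <= D ->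
  local_energy (a + D) s <= local_energy a s + al * (2 * A * D + D ^+ 2) / (1 - lam).
Proof.
have l1 : 0 < 1 - lam by rewrite subr_gt0.
elim: s a D => [|w s IH] a D sp a0 aA D0 /=; have A0 := le_trans a0 aA.
  rewrite add0r divr_ge0 ?(ltW l1) //.
  by rewrite mulr_ge0 // addr_ge0 ?sqr_ge0 // mulr_ge0 // mulr_ge0.
have /andP[w0 wA] := sp w (mem_head _ _).
have b0 : 0 <= lam * a + w by rewrite addr_ge0 // mulr_ge0.
have bA : lam * a + w <= A by have := ler_wpM2l lam_ge0 aA; lra.
have sp' : {in s, forall v, 0 <= v <= (1 - lam) * A}.
  by move=> v vs; rewrite sp // inE vs orbT.
have D'0 : 0 <= lam * D by rewrite mulr_ge0.
have := IH _ _ sp' b0 bA D'0.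
have -> : lam * (a + D) + w = lam * a + w + lam * D by ring.
move: b0 bA; set b := lam * a + w => b0 bA h.
apply: le_trans (_ : f w + al * (b + lam * D) ^+ 2 + (local_energy b s +
   al * (2 * A * (lam * D) + (lam * D) ^+ 2) / (1 - lam)) <= _); first by rewrite lerD2l.
have step : (b + lam * D) ^+ 2 + (2 * A * (lam * D) + (lam * D) ^+ 2) / (1 - lam)
    <= b ^+ 2 + (2 * A * D + D ^+ 2) / (1 - lam).
  rewrite -subr_ge0.
  have -> : b ^+ 2 + (2 * A * D + D ^+ 2) / (1 - lam) -
   ((b + lam * D) ^+ 2 + (2 * A * (lam * D) + (lam * D) ^+ 2) / (1 - lam)) =
   2 * lam * D * (A - b) + 2 * A * D * (1 - lam) + D ^+ 2 + D ^+ 2 * lam * (1 - lam).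
    by field; rewrite lt0r_neq0.
  by rewrite !addr_ge0 ?mulr_ge0 ?sqr_ge0 ?subr_ge0 // ltW.
have := ler_wpM2l al_ge0 step; rewrite !mulrDr !mulrA; lra.
Qed.

Lemma local_energy_periodic a s m : last_excess a s = a ->
  last_excess a (flatten (nseq m s)) = a /\
  local_energy a (flatten (nseq m s)) = m%:R * local_energy a s.
Proof.
move=> fa; elim: m => [|m [IH1 IH2]] /=; first by rewrite mul0r.
by rewrite last_excess_cat fa local_energy_cat fa IH1 IH2 -natr1; split=> //; ring.
Qed.

Fixpoint excess_list a s k : R :=
  lam * (if k is j.+1 then excess_list a s j else a) + s`_k.

Lemma excess_list_cons a w s k :
  excess_list a (w :: s) k.+1 = excess_list (lam * a + w) s k.
Proof. by elim: k => [|k IH] //; rewrite -[LHS]/(lam * excess_list a (w :: s) k.+1 + _) IH. Qed.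

Lemma local_energy_sum a s : local_energy a s =
  \sum_(k < size s) (f s`_k + al * excess_list a s k ^+ 2).
Proof.
elim: s a => [|w s IH] a; first by rewrite big_ord0.
rewrite [RHS]big_ord_recl /= IH; congr (_ + _); apply: eq_bigr => k _.
by rewrite -excess_list_cons.
Qed.

Definition profile s k : R := \sum_(j < k) s`_j.

Lemma profile_size s : profile s (size s) = \sum_(w <- s) w.
Proof. by rewrite /profile (big_nth 0) big_mkord. Qed.

Lemma profile_diff s k : profile s k.+1 - profile s k = s`_k.
Proof. by rewrite /profile big_ord_recr /= addrAC subrr add0r. Qed.

End Accumulation.

(** * Periodic states *)
Section Cycles.
Variables (R : realType) (ft f : R -> R) (lam al C : R).
Hypothesis M : chain ft lam al.
Hypothesis C_gt0 : 0 < C.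
Hypotheses (f_ge0 : forall w, 0 <= f w) (f_le_ft : forall w, f w <= ft w)
  (f_le : forall w, 0 <= w -> f w <= C).
Let Hft := chain_potential M.
Let lam_gt0 := chain_lam_gt0 M.
Let lam_lt1 := chain_lam_lt1 M.
Let al_gt0 := chain_al_gt0 M.
Local Notation zeta := (zeta ft).
Local Notation fts := (fts ft).
Local Notation block := (block ft lam al).
Local Notation link := (link ft lam al).
Local Notation g := (block_cost ft lam al).
Local Notation cost_slope := (cost_slope ft lam al).
Local Notation curv := (curv lam al).
Local Notation threshold := (threshold ft lam al).
Local Notation optimal := (optimal ft lam al C).
Local Notation conj_density := (conj_density ft lam al C).
Local Notation local_energy := (local_energy f lam al).
Local Notation last_excess := (last_excess lam).
Implicit Types (p a w z e t : R) (n k m N : nat) (s : seq R).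

Lemma local_energy_ge0 a s : 0 <= local_energy a s.
Proof.
elim: s a => [|w s IH] a //=; rewrite addr_ge0 // addr_ge0 // mulr_ge0 ?sqr_ge0 //.
exact: ltW.
Qed.

Lemma local_energy_mkseq (x : nat -> R) n :
  last_excess (x 0%N) (mkseq (fun k => x k.+1 - lam * x k) n) = x n /\
  local_energy (x 0%N) (mkseq (fun k => x k.+1 - lam * x k) n) =
    \sum_(k < n) (f (x k.+1 - lam * x k) + al * x k.+1 ^+ 2).
Proof.
elim: n => [|n [IH1 IH2]]; first by rewrite big_ord0.
have E : lam * x n + (x n.+1 - lam * x n) = x n.+1 by rewrite addrC subrK.
by rewrite mkseqS -cats1 last_excess_cat local_energy_cat IH1 IH2 big_ord_recr /= E addr0.
Qed.

(** The excess of a periodically repeated block after its first k increments, the first of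
which is the broken bond; at k = 0 it is the excess left by the previous block. *)
Definition block_excess p n k : R :=
  tension lam p (block p n) (if k is j.+1 then j else n.-1) / (2 * al).

Definition block_incr p n k : R :=
  block_excess p n k.+1 - lam * block_excess p n k.

(** At the intact bonds stationarity says that the increment is dual to the flux. *)
Lemma block_incrS p n k : block_incr p n k.+1 = zeta (block p n k.+1).
Proof.
have a0 := lt0r_neq0 al_gt0.
rewrite /block_incr /block_excess mulrA -mulrBl -(block_euler M).
by field.
Qed.

Lemma block_incr_ge0 p n k : 0 < p -> (0 < n)%N -> 0 <= block_incr p n k.
Proof.
move=> p0; case: k => [|k]; last by rewrite block_incrS (zeta_ge0 Hft).
case: n => // n _; rewrite /block_incr /block_excess mulrA -mulrBl divr_ge0 //; last first.
  by rewrite mulr_ge0 // ltW.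
rewrite /tension /= (block_end M p0) // block0.
have -> : (1 - lam) * p - 0 + lam * block p n.+1 1
    - lam * ((1 - lam) * p - block p n.+1 n + lam * 0) =
   (1 - lam) ^+ 2 * p + (lam * block p n.+1 1 + lam * block p n.+1 n) by ring.
have l0 := ltW lam_gt0; apply: addr_ge0; first by rewrite mulr_ge0 ?sqr_ge0 // ltW.
by apply: addr_ge0; apply: mulr_ge0 => //; exact: (block_ge0 M).
Qed.

Lemma block_excess_end p n : (0 < n)%N -> block_excess p n n = block_excess p n 0.
Proof. by case: n. Qed.

Lemma block_incr_sum p n : 0 < p -> (0 < n)%N ->
  \sum_(k < n) block_incr p n k = cost_slope p n.
Proof.
move=> p0 n0; have a0 := lt0r_neq0 al_gt0.
have E : \sum_(k < n) block_excess p n k = \sum_(k < n) block_excess p n k.+1.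
  case: n n0 => // n _; rewrite big_ord_recl [RHS]big_ord_recr /= addrC.
  by congr (_ + _).
by rewrite sumrB -mulr_sumr E /block_excess -mulr_suml (cost_slope_tension M) //; field.
Qed.

(** Equality in the duality: the energy of the block is its Legendre dual, up to what the
truncated potential saves with respect to the relaxed one. *)
Lemma block_energy p n : 0 < p -> (0 < n)%N ->
  let s := mkseq (block_incr p n) n in let a := block_excess p n 0 in
  [/\ {in s, forall w, 0 <= w}, 0 <= a, last_excess a s = a, \sum_(w <- s) w = cost_slope p n &
  local_energy a s + (C - f (block_incr p n 0)) +
     \sum_(k < n.-1) (ft (block_incr p n k.+1) - f (block_incr p n k.+1))
   = p * cost_slope p n - (g p n - C)].
Proof.
move=> p0 n0 s a; have a0 := lt0r_neq0 al_gt0.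
have [fin en] := local_energy_mkseq (block_excess p n) n.
have sp : {in s, forall w, 0 <= w}.
  by move=> w /mapP[k _ ->]; exact: block_incr_ge0.
have finE : last_excess a s = a by rewrite -[RHS](block_excess_end p n0).
split=> //.
- have := last_excess_ge lam_gt0 a sp; rewrite finE size_mkseq -subr_ge0 -{1}(mul1r a) -mulrBl.
  by rewrite pmulr_rge0 // subr_gt0 exprn_ilt1 // ?ltW // -lt0n.
- by rewrite big_map -(block_incr_sum p0 n0) -(big_mkord predT (block_incr p n)) /index_iota subn0.
rewrite [local_energy a s]en big_split /=.
have -> : \sum_(k < n) f (block_excess p n k.+1 - lam * block_excess p n k) =
   f (block_incr p n 0) + \sum_(k < n.-1) f (block_incr p n k.+1).
  by case: n n0 @s @a fin en sp finE => // n *; rewrite big_ord_recl /=.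
rewrite (sumrB _ predT (fun k : 'I_n.-1 => ft (block_incr p n k.+1))).
have -> : \sum_(k < n.-1) ft (block_incr p n k.+1) =
   \sum_(k < n) (block p n k * zeta (block p n k) - fts (block p n k)).
  case: n n0 @s @a fin en sp finE => // n *.
  rewrite big_ord_recl /= block0 mul0r (fts0 Hft) subrr add0r.
  by apply: eq_bigr => k _; rewrite block_incrS ft_zeta.
set B := block p n.
have := block_sum_by_parts M p0 n0 (block0 _ _ _ _ _) (block_end M p0 n0); rewrite -/B.
rewrite big_split /= => /eqP; rewrite addr_eq0 => /eqP S0.
have E : \sum_(k < n) (tension lam p B k * ((1 - lam) * p) / (2 * al)) = p * cost_slope p n.
  by rewrite -mulr_suml -mulr_suml (sum_tension M) // /cost_slope -/B; field.
rewrite -E /block_cost /cost -/B.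
have -> : \sum_(k < n) (B k * zeta (B k) - fts (B k)) =
    \sum_(k < n) zeta (B k) * B k - \sum_(k < n) fts (B k).
  by rewrite -sumrB; apply: eq_bigr => k _; rewrite mulrC.
have -> : \sum_(k < n) link p (B k) (B k.+1) =
    \sum_(k < n) fts (B k) + \sum_(k < n) tension lam p B k ^+ 2 / (4 * al).
  by rewrite -big_split.
rewrite S0 -sumrN.
have -> : \sum_(k < n) al * block_excess p n k.+1 ^+ 2 =
   \sum_(k < n) (tension lam p B k) ^+ 2 / (4 * al).
  by apply: eq_bigr => k _; rewrite /block_excess -/B; field.
have -> : \sum_(k < n) - (tension lam p B k * (- B k + lam * B k.+1) / (2 * al)) =
  \sum_(k < n) (tension lam p B k * ((1 - lam) * p) / (2 * al)) -
   2 * \sum_(k < n) (tension lam p B k) ^+ 2 / (4 * al).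
  rewrite mulr_sumr -sumrB; apply: eq_bigr => k _.
  by rewrite {3}/tension /tension; field.
ring.
Qed.

Definition periodic_state z e : Prop := exists s a,
  [/\ {in s, forall w, 0 <= w}, (0 < size s)%N, 0 <= a, last_excess a s = a &
      \sum_(w <- s) w = (size s)%:R * z /\ local_energy a s <= (size s)%:R * e].

Lemma block_periodic p n : 0 < p -> (0 < n)%N ->
  periodic_state (cost_slope p n / n%:R) ((p * cost_slope p n - (g p n - C)) / n%:R).
Proof.
move=> p0 n0; have nn : (n%:R : R) != 0 by rewrite pnatr_eq0 -lt0n.
have [sp a0 fin sm en] := block_energy p0 n0.
exists (mkseq (block_incr p n) n), (block_excess p n 0).
rewrite size_mkseq; split=> //; split; first by rewrite mulrC divfK.
rewrite [leRHS]mulrC divfK // -en -addrA lerDl addr_ge0 //.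
  by rewrite subr_ge0 f_le // block_incr_ge0.
by apply: sumr_ge0 => k _; rewrite subr_ge0.
Qed.

(** The state is a repeated block of optimal length if there is one, equal increments
otherwise. *)
Lemma load_state p : 0 < p -> exists z,
  [/\ 0 <= z, z <= 2 * curv * p & periodic_state z (p * z - conj_density p)].
Proof.
move=> p0; have d0 : 0 < 1 - lam by rewrite subr_gt0.
have [[n0 [n00 thr0]]|nex] := pselect (exists n, (0 < n)%N /\ C <= threshold p n).
  have ex : exists n, (0 < n)%N && (C <= threshold p n) by exists n0; rewrite n00.
  case: (ex_minnP ex) => n /andP[n1 thr] nmin.
  have nR : (0 : R) < n%:R by rewrite ltr0n.
  have opt : optimal p n.
    apply: (optimalP M) => // m nE; rewrite leNgt; apply/negP => /ltW h.
    by have := nmin m.+1; rewrite h nE ltnn => /(_ isT).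
  exists (cost_slope p n / n%:R); split.
  - by rewrite divr_ge0 ?(cost_slope_ge0 M).
  - by rewrite ler_pdivrMr // [leRHS]mulrC (cost_slope_le M).
  have := block_periodic p0 n1; rewrite (conj_density_optimal M C_gt0 p0 n1 opt).
  have -> : (p * cost_slope p n - n%:R * conj_density p) / n%:R =
      p * (cost_slope p n / n%:R) - conj_density p.
    by field; rewrite pnatr_eq0 -lt0n.
  by [].
have thr n : (0 < n)%N -> threshold p n < C.
  by move=> n0; rewrite ltNge; apply/negP => h; apply: nex; exists n.
have [y [y0 yp yE q]] := uniform_flux M C_gt0 p0 thr.
have l0 := lt0r_neq0 d0; have a0 := lt0r_neq0 al_gt0.
have zE : zeta y = (1 - lam) ^+ 2 * (p - y) / (2 * al) by rewrite yE; field.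
exists (zeta y); split; first exact: (zeta_ge0 Hft).
  rewrite zE /curv -subr_ge0.
  have -> : 2 * ((1 - lam) ^+ 2 / (4 * al)) * p - (1 - lam) ^+ 2 * (p - y) / (2 * al) =
    (1 - lam) ^+ 2 * y / (2 * al) by field.
  by rewrite divr_ge0 ?mulr_ge0 ?sqr_ge0 // ltW.
exists [:: zeta y], (zeta y / (1 - lam)); split => //=.
- by move=> w; rewrite inE => /eqP->; exact: (zeta_ge0 Hft).
- by rewrite divr_ge0 ?(zeta_ge0 Hft) // ltW.
- by field.
split; first by rewrite big_seq1 mul1r.
rewrite mul1r addr0; have -> : lam * (zeta y / (1 - lam)) + zeta y = zeta y / (1 - lam) by field.
apply: le_trans (_ : p * zeta y - link p y y <= _); last by rewrite lerD2l lerN2.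
apply: le_trans (_ : ft (zeta y) + al * (zeta y / (1 - lam)) ^+ 2 <= _); first by rewrite lerD2r.
rewrite ft_zeta /link le_eqVlt; apply/orP; left; apply/eqP.
have -> : p = y + 2 * al * zeta y / (1 - lam) ^+ 2.
  by rewrite -yE; field.
by field; rewrite a0.
Qed.

End Cycles.

(** * Mixing periodic states *)
Section Mixing.
Variables (R : realType) (ft f : R -> R) (lam al C : R).
Hypothesis M : chain ft lam al.
Hypothesis C_gt0 : 0 < C.
Hypotheses (f_ge0 : forall w, 0 <= f w) (f_le_ft : forall w, f w <= ft w)
  (f_le : forall w, 0 <= w -> f w <= C).
Let Hft := chain_potential M.
Let lam_gt0 := chain_lam_gt0 M.
Let lam_lt1 := chain_lam_lt1 M.
Let al_gt0 := chain_al_gt0 M.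
Local Notation g := (block_cost ft lam al).
Local Notation curv := (curv lam al).
Local Notation conj_density := (conj_density ft lam al C).
Local Notation local_energy := (local_energy f lam al).
Local Notation last_excess := (last_excess lam).
Local Notation periodic_state := (periodic_state f lam al).
Implicit Types (p a w z e t : R) (n k m N : nat) (s : seq R).

Lemma sum_flatten_nseq m s : \sum_(w <- flatten (nseq m s)) w = m%:R * \sum_(w <- s) w.
Proof.
elim: m => [|m IH] /=; first by rewrite big_nil mul0r.
by rewrite big_cat /= IH -natr1; ring.
Qed.

Lemma size_flatten_nseq m s : size (flatten (nseq m s)) = (m * size s)%N.
Proof. by elim: m => //= m IH; rewrite size_cat IH mulSn. Qed.

Lemma mem_flatten_nseq m s w : w \in flatten (nseq m s) -> w \in s.
Proof. by elim: m => //= m IH; rewrite mem_cat => /orP[|/IH]. Qed.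

Lemma mem_le_sum s w : {in s, forall v, 0 <= v} -> w \in s -> w <= \sum_(v <- s) v.
Proof.
elim: s => // v s IH sp; rewrite inE big_cons.
have v0 : 0 <= v by rewrite sp ?mem_head.
have sp' : {in s, forall v, 0 <= v} by move=> x xs; rewrite sp // inE xs orbT.
case/predU1P => [->|ws]; last by rewrite (le_trans (IH sp' ws)) // lerDr.
by rewrite lerDl big_seq sumr_ge0.
Qed.

Lemma euclid_real (x : R) n : 0 <= x -> (0 < n)%N ->
  exists m, exists r, [/\ x = m%:R * n%:R + r, 0 <= r & r <= n%:R].
Proof.
move=> x0 n0; have nR : (0 : R) < n%:R by rewrite ltr0n.
have /truncn_itv/andP[h1 h2] : 0 <= x / n%:R by rewrite divr_ge0 // ltW.
exists (Num.truncn (x / n%:R)), (x - (Num.truncn (x / n%:R))%:R * n%:R); split.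
- by rewrite addrC subrK.
- by rewrite subr_ge0 -ler_pdivlMr.
- rewrite ler_pdivlMr // in h1; rewrite ltr_pdivrMr // in h2.
  by rewrite -natr1 in h2; lra.
Qed.

(** Repeat the first state, then the second one, and finish with equal increments that
restore the mean strain exactly.  The junctions and the bounded number of last bonds cost
a bounded amount. *)
Lemma mix_states z1 e1 z2 e2 t : periodic_state z1 e1 -> periodic_state z2 e2 -> 0 <= t -> t <= 1 ->
  exists c, forall N, exists s, [/\ {in s, forall w, 0 <= w}, size s = N,
     \sum_(w <- s) w = N%:R * ((1 - t) * z1 + t * z2) &
     local_energy 0 s <= N%:R * ((1 - t) * e1 + t * e2) + c].
Proof.
move=> [s1 [a1 [sp1 n1 a10 f1 [m1 h1]]]] [s2 [a2 [sp2 n2 a20 f2 [m2 h2]]]] t0 t1.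
have d0 : 0 < 1 - lam by rewrite subr_gt0.
have n1R : (0 : R) < (size s1)%:R by rewrite ltr0n.
have n2R : (0 : R) < (size s2)%:R by rewrite ltr0n.
have sum1 : 0 <= \sum_(w <- s1) w by rewrite big_seq sumr_ge0.
have sum2 : 0 <= \sum_(w <- s2) w by rewrite big_seq sumr_ge0.
have z10 : 0 <= z1 by rewrite -(pmulr_rge0 _ n1R) -m1.
have z20 : 0 <= z2 by rewrite -(pmulr_rge0 _ n2R) -m2.
(* K bounds all the increments that occur, and A all the excesses. *)
pose K := \sum_(w <- s1) w + \sum_(w <- s2) w + z1 + z2.
have K0 : 0 <= K by rewrite !addr_ge0.
pose A := K / (1 - lam) + a1 + a2.
have KA : K <= (1 - lam) * A.
  rewrite /A 2!mulrDr mulrCA divff ?lt0r_neq0 // mulr1 -addrA lerDl.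
  by rewrite addr_ge0 // mulr_ge0 // ltW.
have z1K : z1 <= K by rewrite /K; lra.
have z2K : z2 <= K by rewrite /K; lra.
have s1K : \sum_(w <- s1) w <= K by rewrite /K; lra.
have s2K : \sum_(w <- s2) w <= K by rewrite /K; lra.
have A0 : 0 <= A by rewrite !addr_ge0 // divr_ge0 // ltW.
have a1A : a1 <= A by rewrite /A addrAC lerDr addr_ge0 // divr_ge0 // ltW.
have a2A : a2 <= A by rewrite /A lerDr addr_ge0 // divr_ge0 // ltW.
pose c := (size s1)%:R * `|e1| + (size s2)%:R * `|e2|
   + al * (2 * A * A + A ^+ 2) / (1 - lam)
   + ((size s1)%:R + (size s2)%:R) * (C + al * A ^+ 2).
exists c => N.
have t1N : 0 <= (1 - t) * N%:R by rewrite mulr_ge0 // subr_ge0.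
have t2N : 0 <= t * N%:R by rewrite mulr_ge0.
have [k1 [r1 [E1 r10 r1n]]] := euclid_real t1N n1.
have [k2 [r2 [E2 r20 r2n]]] := euclid_real t2N n2.
pose r := (N - (k1 * size s1 + k2 * size s2))%N.
have NE : (N%:R : R) = (k1 * size s1 + k2 * size s2)%:R + (r1 + r2).
  by rewrite natrD !natrM; move: E1 E2; lra.
have Nle : (k1 * size s1 + k2 * size s2 <= N)%N.
  by rewrite -(ler_nat R) NE lerDl addr_ge0.
have rE : (r%:R : R) = r1 + r2 by rewrite /r natrB // NE addrC addKr.
pose w := (r1 * z1 + r2 * z2) / r%:R.
have wE : r%:R * w = r1 * z1 + r2 * z2.
  rewrite /w; have [r0|rn] := eqVneq (r%:R : R) 0; last by rewrite mulrC divfK.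
  rewrite r0 mul0r; move: r0; rewrite rE => /eqP; rewrite paddr_eq0 // => /andP[/eqP-> /eqP->].
  by rewrite !mul0r addr0.
have w0 : 0 <= w by rewrite divr_ge0 // addr_ge0 // mulr_ge0.
have wK : w <= K.
  rewrite /w; have [r0|rn] := eqVneq (r%:R : R) 0; first by rewrite r0 invr0 mulr0.
  have rp : (0 : R) < r%:R by rewrite lt_neqAle eq_sym rn ler0n.
  by rewrite ler_pdivrMr // rE mulrDr lerD // mulrC ler_wpM2r.
have in1 m : {in flatten (nseq m s1), forall v, 0 <= v <= (1 - lam) * A}.
  move=> v /mem_flatten_nseq vs; rewrite sp1 //=; apply: le_trans KA.
  exact: le_trans (mem_le_sum sp1 vs) s1K.
have in2 m : {in flatten (nseq m s2), forall v, 0 <= v <= (1 - lam) * A}.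
  move=> v /mem_flatten_nseq vs; rewrite sp2 //=; apply: le_trans KA.
  exact: le_trans (mem_le_sum sp2 vs) s2K.
have pos s' : {in s', forall v, 0 <= v <= (1 - lam) * A} -> {in s', forall v, 0 <= v}.
  by move=> h v /h /andP[].
have inw : {in nseq r w, forall v, 0 <= v <= (1 - lam) * A}.
  by move=> v /nseqP[-> _]; rewrite w0 (le_trans wK).
exists (flatten (nseq k1 s1) ++ flatten (nseq k2 s2) ++ nseq r w); split.
- move=> v; rewrite !mem_cat => /or3P[] h.
  + exact: (pos _ (in1 k1)).
  + exact: (pos _ (in2 k2)).
  + exact: (pos _ inw).
- by rewrite !size_cat !size_flatten_nseq size_nseq addnA subnKC.
- rewrite !big_cat /= !sum_flatten_nseq m1 m2 big_nseq iter_addr addr0.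
  rewrite -[w *+ r]mulr_natl wE.
  have -> : N%:R * ((1 - t) * z1 + t * z2) = (1 - t) * N%:R * z1 + t * N%:R * z2 by ring.
  by rewrite E1 E2; ring.
set S1 := flatten (nseq k1 s1); set S2 := flatten (nseq k2 s2).
rewrite local_energy_cat local_energy_cat.
have [F1 L1] := local_energy_periodic f al k1 f1; have [F2 L2] := local_energy_periodic f al k2 f2.
have b1 : local_energy 0 S1 <= (1 - t) * N%:R * e1 + (size s1)%:R * `|e1|.
  apply: le_trans (local_energy_le f lam_gt0 al_gt0 (pos _ (in1 k1)) (lexx _) a10) _.
  rewrite L1; apply: (le_trans (ler_wpM2l (ler0n R k1) h1)).
  rewrite E1 mulrDl -mulrA -addrA lerDl -lerBlDl sub0r -mulrN.
  apply: le_trans (_ : r1 * `|e1| <= _); last by rewrite ler_wpM2r.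
  by rewrite ler_wpM2l // -normrN ler_norm.
set g1 := last_excess 0 S1.
have g10 : 0 <= g1 by apply: (last_excess_ge0 lam_gt0 (pos _ (in1 k1))).
have g1A : g1 <= A by apply: (last_excess_bound lam_gt0 (in1 k1)).
have b2 : local_energy g1 S2 <= t * N%:R * e2 + (size s2)%:R * `|e2|
     + al * (2 * A * A + A ^+ 2) / (1 - lam).
  apply: le_trans (local_energy_le f lam_gt0 al_gt0 (pos _ (in2 k2)) g10 (_ : g1 <= a2 + A)) _.
    by rewrite ler_wpDl.
  apply: (le_trans (local_energy_shift f lam_gt0 lam_lt1 al_gt0 (in2 k2) a20 a2A A0)).
  rewrite lerD2r L2; apply: (le_trans (ler_wpM2l (ler0n R k2) h2)).
  rewrite E2 mulrDl -mulrA -addrA lerDl -lerBlDl sub0r -mulrN.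
  apply: le_trans (_ : r2 * `|e2| <= _); last by rewrite ler_wpM2r.
  by rewrite ler_wpM2l // -normrN ler_norm.
set g2 := last_excess g1 S2.
have g20 : 0 <= g2 by apply: (last_excess_ge0 lam_gt0 (pos _ (in2 k2))).
have g2A : g2 <= A by apply: (last_excess_bound lam_gt0 (in2 k2)).
have b3 : local_energy g2 (nseq r w) <= r%:R * (C + al * A ^+ 2).
  elim: (r) (g2) g20 g2A => [|j IH] x x0 xA /=; first by rewrite mul0r.
  have y0 : 0 <= lam * x + w by rewrite addr_ge0 // mulr_ge0 // ltW.
  have yA : lam * x + w <= A.
    by have := ler_wpM2l (ltW lam_gt0) xA; have := le_trans wK KA; lra.
  have := IH _ y0 yA; have := f_le w0.
  have : al * (lam * x + w) ^+ 2 <= al * A ^+ 2 by rewrite ler_wpM2l ?(ltW al_gt0) // lerXn2r.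
  by rewrite -natr1; lra.
have b4 : r%:R * (C + al * A ^+ 2) <= ((size s1)%:R + (size s2)%:R) * (C + al * A ^+ 2).
  rewrite ler_wpM2r ?rE ?lerD // addr_ge0 ?(ltW C_gt0) // mulr_ge0 ?sqr_ge0 //; exact: ltW.
have -> : N%:R * ((1 - t) * e1 + t * e2) = (1 - t) * N%:R * e1 + t * N%:R * e2 by ring.
rewrite /c; move: b1 b2 b3 b4; lra.
Qed.

(** Take the supremum P of the loads that have a state with strain at most z.  States at
loads just below and just above P have strains on either side of z, and mixing them
costs P z minus the conjugate at P, up to a small error, since the conjugate is
Lipschitz continuous. *)
Lemma realize_strain z : 0 < z -> exists p, 0 < p /\ forall eps, 0 < eps ->
  exists c, forall N, exists s, [/\ {in s, forall w, 0 <= w}, size s = N,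
    \sum_(w <- s) w = N%:R * z &
    local_energy 0 s <= N%:R * (p * z - conj_density p + eps) + c].
Proof.
move=> z0; have c0 := curv_gt0 M.
pose S := [set p | 0 < p /\ exists z', z' <= z /\ periodic_state z' (p * z' - conj_density p)].
have S1 : S (z / (2 * curv)).
  have p0 : 0 < z / (2 * curv) by rewrite divr_gt0 // mulr_gt0.
  split=> //; have [z' [_ zc cy]] := load_state M C_gt0 f_le_ft f_le p0.
  exists z'; split=> //; apply: le_trans zc _.
  by rewrite mulrC divfK // lt0r_neq0 // mulr_gt0.
have ubS : ubound S (Num.max 1 ((z + C) / curv)).
  move=> p [p0 [z' [zz' [s [a [sp n0 a0 _ [sm en]]]]]]].
  have nR : (0 : R) < (size s)%:R by rewrite ltr0n.
  have e0 : 0 <= p * z' - conj_density p.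
    by rewrite -(pmulr_rge0 _ nR) (le_trans _ en) // (local_energy_ge0 M).
  have q1 := conj_density_ge M C_gt0 p0 (ltnSn 0); rewrite (gcost1 M p0) mul1r in q1.
  rewrite le_max orbC; have [p1|p1] := leP p 1; rewrite ?orbT // orbF.
  rewrite ler_pdivlMr // -(ler_pM2l p0).
  have h1 := ler_wpM2l (ltW p0) zz'.
  have h2 : C <= p * C by rewrite ler_peMl // ltW.
  have -> : p * (p * curv) = curv * p ^+ 2 by ring.
  lra.
have hS : has_sup S by split; [exists (z / (2 * curv))|exists (Num.max 1 ((z + C) / curv))].
pose P := sup S; have P0 : 0 < P.
  apply: lt_le_trans (_ : z / (2 * curv) <= P); first by rewrite divr_gt0 // mulr_gt0.
  by apply: ub_le_sup; [exact: hS.2|].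
exists P; split=> // eps eps0.
have K0 : 0 < 4 * curv * (P + 1) by apply: mulr_gt0; [exact: mulr_gt0|rewrite addr_gt0].
pose eta := Num.min 1 (eps / (4 * curv * (P + 1))).
have eta0 : 0 < eta by rewrite lt_min ltr01 divr_gt0.
have [P1 [P10 [z1 [z1z cy1]]] etaP] := sup_adherent eta0 hS.
have P1P : P1 <= P by apply: ub_le_sup; [exact: hS.2|split=> //; exists z1].
have P20 : 0 < P + eta by rewrite addr_gt0.
have [z2 [z20 z2c cy2]] := load_state M C_gt0 f_le_ft f_le P20.
have zz2 : z < z2.
  rewrite ltNge; apply/negP => h.
  have : P + eta <= P by apply: ub_le_sup; [exact: hS.2|split=> //; exists z2].
  by rewrite gerDl leNgt eta0.
have d0 : 0 < z2 - z1 by rewrite subr_gt0 (le_lt_trans z1z).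
pose t := (z - z1) / (z2 - z1).
have t0 : 0 <= t by apply: divr_ge0; [rewrite subr_ge0|exact: ltW].
have t1 : t <= 1 by rewrite ler_pdivrMr // mul1r lerD2r ltW.
have tz : (1 - t) * z1 + t * z2 = z by rewrite /t; field; rewrite lt0r_neq0.
have [c mx] := mix_states cy1 cy2 t0 t1; exists c => N.
have [s [sp sn sm en]] := mx N; exists s; split=> //; first by rewrite sm tz.
apply: (le_trans en); rewrite lerD2r ler_wpM2l //.
have eta1 : eta <= 1 by rewrite ge_min lexx.
have etaK : 4 * curv * (P + 1) * eta <= eps.
  by rewrite mulrC -ler_pdivlMr // ge_min lexx orbT.
have PP1 : P <= P + 1 by rewrite lerDl.
have /andP[q1 q2] := conj_density_lipschitz M C_gt0 P10 P1P PP1.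
have q3 : conj_density P <= conj_density (P + eta).
  have PPe : P <= P + eta by rewrite lerDl ltW.
  by have /andP[h _] := conj_density_lipschitz M C_gt0 P0 PPe (lexx _); rewrite -subr_ge0.
have z10 : 0 <= z1.
  case: cy1 => s1 [a1 [sp1 n1 _ _ [m1 _]]].
  have nR : (0 : R) < (size s1)%:R by rewrite ltr0n.
  by rewrite -(pmulr_rge0 _ nR) -m1 big_seq sumr_ge0.
have B0 : 0 <= 2 * curv * (P + 1).
  by apply: mulr_ge0; [apply: mulr_ge0 => //; exact: ltW|rewrite addr_ge0 // ltW].
pose B := 2 * curv * (P + 1) * eta.
have h1 : conj_density P - conj_density P1 <= B.
  by apply: (le_trans q2); rewrite /B ler_wpM2l // lerBlDr addrC -lerBlDr ltW.
have h2 : eta * z2 <= B.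
  rewrite /B [leRHS]mulrC ler_wpM2l ?(ltW eta0) //; apply: (le_trans z2c).
  apply: ler_wpM2l; last by rewrite lerD2l.
  by apply: mulr_ge0 => //; exact: ltW.
have h3 : 0 <= (P - P1) * z1 by rewrite mulr_ge0 // subr_ge0.
have t1' : 0 <= 1 - t by rewrite subr_ge0.
have k1 : (1 - t) * (P1 * z1 - conj_density P1) <= (1 - t) * (P * z1 - conj_density P + B).
  by rewrite ler_wpM2l //; lra.
have k2 : t * ((P + eta) * z2 - conj_density (P + eta)) <= t * (P * z2 - conj_density P + B).
  by rewrite ler_wpM2l //; lra.
apply: (le_trans (lerD k1 k2)).
have -> : (1 - t) * (P * z1 - conj_density P + B) + t * (P * z2 - conj_density P + B) =
   P * ((1 - t) * z1 + t * z2) - conj_density P + B by ring.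
rewrite tz lerD2l; apply: le_trans etaK; rewrite /B.
have -> : 4 * curv * (P + 1) * eta = 2 * (2 * curv * (P + 1) * eta) by ring.
by rewrite ler_peMl ?ler1n //; apply: mulr_ge0 => //; exact: ltW.
Qed.

End Mixing.

(** * From finite chains to the limit densities *)
Section Limits.
Variables (R : realType) (f : R -> R) (sigma zstar : R).
Hypothesis sigma_gt0 : 0 < sigma.
Local Notation lam := (expR (- sigma)).
Implicit Types (z L t theta : R) (N k : nat).

Definition nodes N (u : 'I_N.+1 -> R) (k : nat) : R := u (inord k).

Lemma incrE N (u : 'I_N.+1 -> R) (i : 'I_N) : incr u i = nodes u i.+1 - nodes u i.
Proof.
rewrite /incr /nodes; congr (u _ - u _); apply: val_inj => /=.
  by rewrite inordK // ltnS.
by rewrite inordK // ltnS ltnW.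
Qed.

Lemma F1E N (u : 'I_N.+1 -> R) : F1 f sigma u = energy f lam N (nodes u).
Proof.
rewrite /F1 /energy /quad; congr (_ + _); first by apply: eq_bigr => i _; rewrite incrE.
apply: eq_bigr => i _; apply: eq_bigr => j _; rewrite /nodes !inord_val; congr (_ * _).
by rewrite /exp_kernel -mulNr mulrC expRM_natl.
Qed.

Lemma nodes_ends N z (u : 'I_N.+1 -> R) : admissible z u -> nodes u N - nodes u 0 = N%:R * z.
Proof.
case=> u0 uN; rewrite /nodes -uN -[RHS]subr0 -u0; congr (u _ - u _).
  by apply: val_inj; rewrite /= inordK.
by apply: val_inj; rewrite /= inordK.
Qed.

Lemma kernel_gt0 : 0 < lam. Proof. exact: expR_gt0. Qed.
Lemma kernel_lt1 : lam < 1. Proof. by rewrite -expR0 ltr_expR oppr_lt0. Qed.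

Lemma realize_list N z (s : seq R) : size s = N -> \sum_(w <- s) w = N%:R * z ->
  exists u : 'I_N.+1 -> R, [/\ admissible z u, forall i : 'I_N, incr u i = s`_i &
    F1 f sigma u <= local_energy f lam (stiffness lam) 0 s].
Proof.
move=> sN sz; pose u (i : 'I_N.+1) := profile s i.
have uE k : (k <= N)%N -> nodes u k = profile s k.
  by move=> kN; rewrite /nodes /u inordK.
have dE (i : 'I_N) : nodes u i.+1 - nodes u i = s`_i.
  by rewrite !uE ?profile_diff // ltnW.
exists u; split.
- by split; rewrite /u /= -?sN ?profile_size ?sN //; rewrite /profile big_ord0.
- by move=> i; rewrite incrE dE.
rewrite F1E /energy local_energy_sum big_split /= -mulr_sumr sN.
rewrite (eq_bigr (fun i : 'I_N => f s`_i)); last by move=> i _; rewrite dE.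
rewrite lerD2l.
have -> : quad lam N (nodes u) = quad lam N (profile s).
  by apply: eq_bigr => i _; apply: eq_bigr => j _; rewrite !uE // -ltnS.
apply: (quad_le_excess kernel_gt0 kernel_lt1).
  by rewrite profile_diff /= mulr0 add0r.
by move=> k; rewrite profile_diff /= addrC.
Qed.

Lemma min_energy_ge N (A : set ('I_N.+1 -> R)) (L : R) :
  (forall u, A u -> L <= F1 f sigma u) -> (L%:E <= min_energy f sigma A)%E.
Proof. by move=> H; apply/ereal_infP => _ [u Au <-]; rewrite lee_fin H. Qed.

Lemma min_energy_le N (A : set ('I_N.+1 -> R)) (L : R) u :
  A u -> F1 f sigma u <= L -> (min_energy f sigma A <= L%:E)%E.
Proof.
move=> Au FL; apply: (@le_trans _ _ (F1 f sigma u)%:E); last by rewrite lee_fin.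
by apply: ereal_inf_lbound; exists u.
Qed.

Lemma scaled_ge N (m : \bar R) (L : R) : (0 < N)%N -> ((N%:R * L)%:E <= m)%E ->
  (L%:E <= (N%:R^-1)%:E * m)%E.
Proof.
move=> N0 h; have nR : (0 : R) < N%:R by rewrite ltr0n.
have := lee_wpmul2l (_ : (0 <= (N%:R^-1 : R)%:E)%E) h; rewrite lee_fin invr_ge0 ltW // => /(_ isT).
by rewrite -EFinM mulrA mulVf ?mul1r // lt0r_neq0.
Qed.

Lemma scaled_le N (m : \bar R) (L : R) : (0 < N)%N -> (m <= (N%:R * L)%:E)%E ->
  ((N%:R^-1)%:E * m <= L%:E)%E.
Proof.
move=> N0 h; have nR : (0 : R) < N%:R by rewrite ltr0n.
have := lee_wpmul2l (_ : (0 <= (N%:R^-1 : R)%:E)%E) h; rewrite lee_fin invr_ge0 ltW // => /(_ isT).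
by rewrite -EFinM mulrA mulVf ?mul1r // lt0r_neq0.
Qed.

Lemma eventually_small (K e : R) : 0 < e ->
  exists N0, forall N, (N0 <= N)%N -> (0 < N)%N /\ K <= N%:R * e.
Proof.
move=> e0; exists (Num.truncn (`|K| / e)).+1 => N N0; split; first exact: leq_trans N0.
rewrite -ler_pdivrMr // ltW //; apply: le_lt_trans (_ : `|K| / e < _).
  by rewrite ler_wpM2r ?ler_norm // invr_ge0 ltW.
by apply: (lt_le_trans (truncnS_gt _)); rewrite ler_nat.
Qed.

Lemma Qhat_eq z L :
  (exists K, forall N (u : 'I_N.+1 -> R), admissible z u -> N%:R * L - K <= F1 f sigma u) ->
  (forall eps, 0 < eps -> exists K, forall N, exists u : 'I_N.+1 -> R,
     admissible z u /\ F1 f sigma u <= N%:R * (L + eps) + K) ->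
  Qhat f sigma z = L%:E.
Proof.
move=> [K lo] up; apply: cvg_lim => //.
have near e : 0 < e -> \forall N \near \oo,
   ((L - e)%:E <= (N%:R^-1)%:E * min_energy f sigma (@admissible R N z) <= (L + e)%:E)%E.
  move=> e0; have e2 : 0 < e / 2 by rewrite divr_gt0.
  have [K' up'] := up _ e2.
  have [N1 H1] := eventually_small K e0; have [N2 H2] := eventually_small K' e2.
  exists (maxn N1 N2) => // N /=; rewrite geq_max => /andP[/H1[N0 k1] /H2[_ k2]].
  apply/andP; split.
    apply: scaled_ge => //; apply: min_energy_ge => u /lo; apply: le_trans.
    by rewrite mulrBr lerD2l lerN2.
  have [u [Au Fu]] := up' N; apply: scaled_le => //; apply: (min_energy_le Au).
  apply: (le_trans Fu); apply: (le_trans (lerD (lexx _) k2)).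
  by rewrite -mulrDr -addrA -splitr.
apply/fine_cvgP; split.
  near=> N; have : ((L - 1)%:E <= (N%:R^-1)%:E * min_energy f sigma (@admissible R N z)
      <= (L + 1)%:E)%E by near: N; exact: near.
  move=> /andP[h1 h2]; rewrite fin_numE; apply/andP; split.
    by apply/eqP => h; move: h1; rewrite h.
  by apply/eqP => h; move: h2; rewrite h.
apply/cvgrPdist_le => e e0; near=> N.
have : ((L - e)%:E <= (N%:R^-1)%:E * min_energy f sigma (@admissible R N z)
      <= (L + e)%:E)%E by near: N; exact: near.
rewrite /=; case: (_ * _)%E => [r| |] //=; rewrite ?lee_fin => /andP[h1 h2].
by rewrite ler_norml; apply/andP; split; lra.
Unshelve. all: by end_near. Qed.

Local Notation V N theta := (@prescribed_phases R zstar N theta).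

Lemma Qhat_rat_ge theta z L :
  (exists K, forall N (u : 'I_N.+1 -> R), admissible z u -> V N theta u ->
     N%:R * L - K <= F1 f sigma u) ->
  (L%:E <= Qhat_rat f sigma zstar theta z)%E.
Proof.
move=> [K lo]; rewrite /Qhat_rat limf_einfE; apply/lee_subgt0Pr => e e0.
have [N1 H1] := eventually_small K e0.
apply: le_ereal_sup_tmp; eexists.
  exists [set N | (N1 <= N)%N] => /=; last by reflexivity.
  by apply: filterS (nbhs_infty_ge N1) => N /=.
rewrite -EFinB; apply/ereal_infP => _ [N /= /H1[N0 k1] <-].
apply: scaled_ge => //; apply: min_energy_ge => u [Au Vu]; apply: le_trans (lo _ _ Au Vu).
by rewrite mulrBr lerD2l lerN2.
Qed.

Lemma Qhat_rat_le theta z L :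
  (forall N0, exists N, [/\ (N0 <= N)%N, (0 < N)%N, theta * N%:R \is a Num.nat &
     exists u : 'I_N.+1 -> R, [/\ admissible z u, V N theta u & F1 f sigma u <= N%:R * L]]) ->
  (Qhat_rat f sigma zstar theta z <= L%:E)%E.
Proof.
move=> up; rewrite /Qhat_rat limf_einfE; apply: ge_ereal_sup => _ [W WF <-].
have [N1 _ H1] : \forall N \near \oo, theta * N%:R \is a Num.nat -> W N by exact: WF.
have [N [N1N N0 tN [u [Au Vu Fu]]]] := up N1.
apply: ge_ereal_inf; eexists; first by exists N => //; exact: H1.
by apply: scaled_le => //; exact: (min_energy_le (conj Au Vu)).
Qed.

(** Affine bounds are continuous in the fraction, and rational fractions are dense.  The
second case is the default value of a limit that would fail to exist. *)
Lemma Qhat_phase_ge theta z c0 c1 : 0 <= theta <= 1 ->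
  (forall t, 0 <= t <= 1 -> ((c0 + c1 * t)%:E <= Qhat_rat f sigma zstar t z)%E) ->
  ((c0 + c1 * theta)%:E <= Qhat_phase f sigma zstar theta z)%E \/
  Qhat_phase f sigma zstar theta z = 0%E.
Proof.
move=> t01 lo; rewrite /Qhat_phase; case: ifP => [_|irr]; first by left; exact: lo.
set F := _ @[t --> _].
have [cv|ncv] := pselect (cvg F); last by right; rewrite (dvgP ncv).
left; have /andP[th0 th1] := t01.
have ne (q : rat) : theta != ratr q.
  apply/negP => /eqP e; move: irr; rewrite /F; move/negP; apply.
  by rewrite inE; exists q.
have th0' : 0 < theta.
  by rewrite lt_neqAle th0 andbT eq_sym; have := ne 0; rewrite rmorph0.
have th1' : theta < 1.
  by rewrite lt_neqAle th1 andbT; have := ne 1; rewrite rmorph1.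
have prop : ProperFilter (within (@rational R `&` `[0, 1]) (nbhs theta)).
  apply: within_nbhs_proper => B /nbhs_ballP[e /= e0 eB].
  have lt : Num.max 0 (theta - e) < Num.min 1 (theta + e).
    by rewrite gt_max !lt_min ltr01 /=; apply/and3P; split; lra.
  have [q] := rat_in_itvoo lt; rewrite in_itv /= gt_max lt_min => /andP[/andP[q0 qe] /andP[q1 qe']].
  exists (ratr q); split; first split.
  - by exists q.
  - by rewrite /= in_itv /= !ltW.
  - by apply: eB; rewrite /ball /= ltr_norml; apply/andP; split; lra.
apply/lee_subgt0Pr => e e0; rewrite -EFinB.
apply: lime_ge => //; rewrite /within /=.
have e1 : 0 < e / (`|c1| + 1) by rewrite divr_gt0 // ltr_wpDl.
apply/nbhs_ballP; exists (e / (`|c1| + 1)) => //= t; rewrite /ball /= => tb [_].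
rewrite /= in_itv /= => t01'; apply: le_trans (lo t t01'); rewrite lee_fin.
rewrite lerBlDr -addrA lerD2l -lerBlDl -mulrBr.
apply: (le_trans (ler_norm _)); rewrite normrM.
apply: le_trans (_ : (`|c1| + 1) * (e / (`|c1| + 1)) <= _).
  by apply: ler_pM => //; [rewrite lerDl|exact: ltW].
by rewrite mulrC divfK // lt0r_neq0 // ltr_wpDl.
Qed.

End Limits.

(** * Fractions that are not locking states *)
Section Truncated.
Variables (R : realType) (sigma zstar : R) (ft : R -> R).
Hypotheses (sigma_gt0 : 0 < sigma) (zstar_gt0 : 0 < zstar) (Hft : potential ft).
Local Notation lam := (expR (- sigma)).
Local Notation al := (stiffness lam).
Local Notation f := (truncated ft zstar).
Local Notation C := (ft zstar).
Local Notation g := (block_cost ft lam al).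
Local Notation cost_slope := (cost_slope ft lam al).
Local Notation curv := (curv lam al).
Local Notation threshold := (threshold ft lam al).
Local Notation conj_density := (conj_density ft lam al C).
Local Notation V N theta := (@prescribed_phases R zstar N theta).
Implicit Types (p z t theta w L : R) (N n m k : nat).

Lemma truncated_chain : chain ft lam al.
Proof.
split=> //; [exact: kernel_gt0|exact: kernel_lt1|].
by apply: stiffness_gt0; [exact: kernel_gt0|exact: kernel_lt1].
Qed.
Let M := truncated_chain.

Lemma break_cost_gt0 : 0 < C.
Proof. by rewrite -(potential0 Hft) (ft_increasing Hft). Qed.
Let C_gt0 := break_cost_gt0.

Lemma truncated_ge0 w : 0 <= f w.
Proof. by rewrite /truncated; case: ifP => _; exact: (potential_ge0 Hft). Qed.

Lemma truncated_broken w : zstar <= w -> f w = C.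
Proof.
rewrite /truncated le_eqVlt => /predU1P[<-|zw]; first by rewrite lexx.
by rewrite leNgt zw.
Qed.

Lemma truncated_intact w : w <= zstar -> f w = ft w.
Proof. by rewrite /truncated => ->. Qed.

Lemma truncated_le_potential w : f w <= ft w.
Proof.
have [wz|zw] := leP w zstar; first by rewrite truncated_intact.
by rewrite truncated_broken ?ltW // (ft_increasing Hft) // ltW.
Qed.

Lemma truncated_le_cost w : 0 <= w -> f w <= C.
Proof.
move=> w0; have [zw|wz] := leP zstar w; first by rewrite truncated_broken.
by rewrite truncated_intact ltW // (ft_increasing Hft).
Qed.

Lemma sum_incr N (u : 'I_N.+1 -> R) (P : pred R) :
  \sum_(k < N) (P (nodes u k.+1 - nodes u k))%:R = #|[pred i | P (incr u i)]|%:R :> R.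
Proof.
rewrite -sum1_card natr_sum [RHS]big_mkcond /=; apply: eq_bigr => i _.
by rewrite inE /= incrE; case: (P _).
Qed.

(** Increments equal to zstar count as broken or intact at will. *)
Lemma phases_broken N t (u : 'I_N.+1 -> R) : V N t u ->
  \sum_(k < N) (zstar < nodes u k.+1 - nodes u k)%R%:R <= t * N%:R /\
  t * N%:R <= \sum_(k < N) (zstar <= nodes u k.+1 - nodes u k)%R%:R.
Proof.
case=> h1 h2; split; first by rewrite (sum_incr u (fun w => zstar < w)).
rewrite (sum_incr u (fun w => zstar <= w)).
have E : #|[predC [pred i | incr u i < zstar]]| = #|[pred i | zstar <= incr u i]|.
  by apply: eq_card => i; rewrite !inE -leNgt.
have := cardC [pred i | incr u i < zstar]; rewrite card_ord E => /(congr1 (fun n => n%:R : R)).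
rewrite natrD.
by move=> h3; move: h2; rewrite -h3; lra.
Qed.

Lemma F1_lower p z : 0 < p -> exists K, forall N (u : 'I_N.+1 -> R), admissible z u ->
  N%:R * (p * z - conj_density p) - K <= F1 f sigma u.
Proof.
move=> p0; have [c c0 H] := energy_lower f M.
exists (C + conj_density p + c * p ^+ 2) => N u Au.
have := H p C (conj_density p) C N (nodes u) (fun k => zstar < nodes u k.+1 - nodes u k) p0.
rewrite F1E (nodes_ends Au) subrr mul0r subr0 => h; apply: le_trans (h _ _ _).
- by rewrite -natr1; lra.
- by move=> m m0; have := conj_density_ge M C_gt0 p0 m0; lra.
- by move=> k _ /ltW zw; rewrite truncated_broken.
- by move=> k _; rewrite -leNgt => wz; rewrite truncated_intact.
Qed.

(** The value at t of the gain per bond when a fraction t of the bonds is broken and the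
blocks have m or m + 1 bonds; it is the perspective of a chord of the block cost. *)
Definition phase_conj m p t : R :=
  t * (g p m - C - m%:R * (g p m.+1 - g p m)) + (g p m.+1 - g p m).

(** The chord of the block cost between m and m + 1 serves as the affine bound of
[energy_lower]. *)
Lemma Qhat_rat_lower p z m t : 0 < p -> (0 < m)%N ->
  ((p * z - phase_conj m p t)%:E <= Qhat_rat f sigma zstar t z)%E.
Proof.
move=> p0 m0; have [c c0 H] := energy_lower f M.
pose B := g p m.+1 - g p m; pose A := g p m - m%:R * B.
have gAB n : (0 < n)%N -> g p n <= A + B * n%:R.
  by move=> n0; have := block_cost_chord M p0 m0 n0; rewrite /A /B; lra.
apply: Qhat_rat_ge; exists (A + B + c * p ^+ 2) => N u Au Vu.
have [r1 r2] := phases_broken Vu.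
(* The bonds with increment zstar are assigned according to the sign of A - C. *)
have [b [bb bi] br] : exists2 b : pred R,
    (forall w, b w -> zstar <= w) /\ (forall w, ~~ b w -> w <= zstar) &
    (A - C) * (\sum_(k < N) (b (nodes u k.+1 - nodes u k))%:R) <= (A - C) * (t * N%:R).
  have [AC|AC] := leP 0 (A - C).
    exists (fun w => zstar < w); last by rewrite ler_wpM2l.
    by split=> w; [exact: ltW|rewrite -leNgt].
  exists (fun w => zstar <= w); last by rewrite ler_wnM2l // ltW.
  by split=> w //; rewrite -ltNge => /ltW.
have := H p A B C N (nodes u) (fun k => b (nodes u k.+1 - nodes u k)) p0 gAB.
rewrite F1E (nodes_ends Au) => h; apply: le_trans (h _ _).
- by rewrite /phase_conj -/B -natr1; move: br; rewrite /A; lra.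
- by move=> k _ /bb zw; rewrite truncated_broken.
- by move=> k _ /bi wz; rewrite truncated_intact.
Qed.

Lemma F1_compare z L L' :
  (exists K, forall N (u : 'I_N.+1 -> R), admissible z u -> N%:R * L' - K <= F1 f sigma u) ->
  (forall eps, 0 < eps -> exists K, forall N, exists u : 'I_N.+1 -> R,
     admissible z u /\ F1 f sigma u <= N%:R * (L + eps) + K) -> L' <= L.
Proof.
move=> [K lo] up; rewrite leNgt; apply/negP => lt; have d0 : 0 < (L' - L) / 2.
  by rewrite divr_gt0 // subr_gt0.
have [K' up'] := up _ d0; have d1 : 0 < (L' - L) / 4 by rewrite divr_gt0 // subr_gt0.
have [N0 /(_ _ (leqnn _))[N00 H]] := eventually_small (`|K + K'| + (L' - L) / 8) d1.
have [u [Au Fu]] := up' N0; have := le_trans (lo _ _ Au) Fu.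
have := ler_norm (K + K').
have N1 : (0 : R) < N0%:R by rewrite ltr0n.
have : 0 < N0%:R * (L' - L) by rewrite mulr_gt0 // subr_gt0.
by lra.
Qed.

Lemma Qhat_conj z : 0 < z -> exists p, [/\ 0 < p, Qhat f sigma z = (p * z - conj_density p)%:E &
  0 < p * z - conj_density p].
Proof.
move=> z0; have [p [p0 up]] := realize_strain M C_gt0 truncated_ge0
  truncated_le_potential truncated_le_cost z0.
have up' eps : 0 < eps -> exists K, forall N, exists u : 'I_N.+1 -> R,
     admissible z u /\ F1 f sigma u <= N%:R * (p * z - conj_density p + eps) + K.
  move=> /up[K H]; exists K => N; have [s [_ sN sz en]] := H N.
  have [u [Au _ Fu]] := realize_list f sigma_gt0 sN sz.
  by exists u; split=> //; exact: le_trans Fu en.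
exists p; split=> //; first by apply: Qhat_eq => //; exact: F1_lower.
have c0 := curv_gt0 M; have p'0 : 0 < z / (2 * curv) by rewrite divr_gt0 // mulr_gt0.
have := F1_compare (F1_lower z p'0) up'; apply: lt_le_trans.
have := conj_density_quadratic M C_gt0 p'0; rewrite subr_gt0 => /le_lt_trans; apply.
have -> : curv * (z / (2 * curv)) ^+ 2 = z / (2 * curv) * z / 2 by field; exact: lt0r_neq0.
by rewrite ltr_pdivrMr // ltr_pMr ?ltr1n // mulr_gt0.
Qed.

(** A line that stays below a function touched from above by a parabola is tangent to
both. *)
Lemma tangent_unique (p s z K : R) : 0 < p -> 0 < K ->
  (forall d, - p < d -> (z - s) * d <= K * d ^+ 2) -> z = s.
Proof.
move=> p0 K0 H; apply/eqP; rewrite -subr_eq0; apply/negPn/negP => n0.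
have a0 : 0 < `|z - s| by rewrite normr_gt0.
pose tau := Num.min ((2 * K)^-1) (p / (2 * `|z - s|)).
have tau0 : 0 < tau by rewrite lt_min invr_gt0 divr_gt0 ?mulr_gt0.
have t1 : tau * (2 * K) <= 1.
  by rewrite -ler_pdivlMr ?mulr_gt0 // mul1r ge_min lexx.
have t2 : tau * (2 * `|z - s|) <= p.
  by rewrite -ler_pdivlMr ?mulr_gt0 // ge_min lexx orbT.
have q0 : 0 < tau * (z - s) ^+ 2 by rewrite mulr_gt0 // exprn_even_gt0.
have := H (tau * (z - s)); rewrite ltrNl => h.
have {h} : (z - s) * (tau * (z - s)) <= K * (tau * (z - s)) ^+ 2.
  apply: h; apply: (le_lt_trans (ler_norm _)); rewrite normrN normrM (gtr0_norm tau0).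
  by have : 0 < tau * `|z - s|; [rewrite mulr_gt0|lra].
have -> : (z - s) * (tau * (z - s)) = tau * (z - s) ^+ 2 by ring.
have -> : K * (tau * (z - s)) ^+ 2 = (tau * (2 * K)) * (tau * (z - s) ^+ 2) / 2 by field.
by have := ler_wpM2r (ltW q0) t1; rewrite mul1r; lra.
Qed.

(** The conjugate density is the weighted mean of its values along m and m + 1 only if
both lengths are optimal, hence tie.  The strain is then determined by tangency, because
keeping the fluxes fixed bounds the block costs above by parabolas in the load. *)
Lemma phase_conj_touch m theta p z : (0 < m)%N -> 0 < p ->
  m%:R * theta < 1 -> 1 < m.+1%:R * theta ->
  (forall p', 0 < p' -> p' * z - phase_conj m p' theta <= p * z - conj_density p) ->
  threshold p m = C /\
  z = (m.+1%:R * theta - 1) * cost_slope p m + (1 - m%:R * theta) * cost_slope p m.+1.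
Proof.
move=> m0 p0 th1 th2 H.
pose a := m.+1%:R * theta - 1; pose b := 1 - m%:R * theta.
have a0 : 0 < a by rewrite subr_gt0.
have b0 : 0 < b by rewrite subr_gt0.
have pcE p' : phase_conj m p' theta = a * (g p' m - C) + b * (g p' m.+1 - C).
  by rewrite /phase_conj /a /b -natr1; ring.
have q1 := conj_density_ge M C_gt0 p0 m0; have q2 := conj_density_ge M C_gt0 p0 (ltn0Sn m).
have ab : a * (m%:R * conj_density p) + b * (m.+1%:R * conj_density p) = conj_density p.
  by rewrite /a /b -natr1; ring.
have := H p p0; rewrite lerD2l lerN2 pcE => h.
have k1 : 0 <= a * (m%:R * conj_density p - (g p m - C)) by rewrite mulr_ge0 ?subr_ge0 // ltW.
have k2 : 0 <= b * (m.+1%:R * conj_density p - (g p m.+1 - C)) by rewrite mulr_ge0 ?subr_ge0 // ltW.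
have e1 : a * (m%:R * conj_density p - (g p m - C)) = 0 by apply/eqP; rewrite eq_le k1 andbT; lra.
have e2 : b * (m.+1%:R * conj_density p - (g p m.+1 - C)) = 0.
  by apply/eqP; rewrite eq_le k2 andbT; lra.
move: e1 e2 => /eqP; rewrite mulf_eq0 (negbTE (lt0r_neq0 a0)) subr_eq0 => /eqP e1.
move=> /eqP; rewrite mulf_eq0 (negbTE (lt0r_neq0 b0)) subr_eq0 => /eqP e2.
have gm : g p m = m%:R * conj_density p + C by rewrite e1 subrK.
have gm1 : g p m.+1 = m.+1%:R * conj_density p + C by rewrite e2 subrK.
split; first by rewrite /threshold gm gm1 -natr1; ring.
apply: (tangent_unique p0 (curv_gt0 M)) => d dp.
have pd : 0 < p + d by rewrite -ltrBlDl sub0r.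
have := H _ pd; rewrite pcE -ab e1 e2.
have u1 := block_cost_upper M p0 pd m0; have u2 := block_cost_upper M p0 pd (ltn0Sn m).
rewrite [p + d - p]addrC addKr in u1 u2.
have {}u1 := ler_wpM2l (ltW a0) u1; have {}u2 := ler_wpM2l (ltW b0) u2.
have cE : curv * d ^+ 2 = a * (m%:R * curv * d ^+ 2) + b * (m.+1%:R * curv * d ^+ 2).
  by rewrite /a /b -natr1; ring.
rewrite cE -/a -/b; move: u1 u2; lra.
Qed.

Definition uniform z : R := uniform_density ft lam z.

Lemma uniform_gt0 z : z != 0 -> 0 < uniform z.
Proof.
move=> z0; have h := stiffness_gt0 (kernel_gt0 sigma) (kernel_lt1 sigma_gt0).
rewrite ltr_wpDl ?(potential_ge0 Hft) //.
rewrite divr_gt0 ?exprn_gt0 ?subr_gt0 ?(kernel_lt1 sigma_gt0) //.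
by apply: mulr_gt0 => //; rewrite exprn_even_gt0.
Qed.

(** The tangent at a negative strain has a negative slope, so it stays below the truncated
potential, and beyond zstar by at least its gap at zstar. *)
Lemma F1_lower_uniform z : z < 0 -> exists K, exists2 de, 0 < de &
  forall N (u : 'I_N.+1 -> R), admissible z u ->
    N%:R * uniform z
     + de * (\sum_(k < N) (zstar <= nodes u k.+1 - nodes u k)%R%:R) - K <= F1 f sigma u.
Proof.
move=> z0; have [s sz] := subgradient_exists Hft z.
have s0 : s < 0 by exact: (subgradient_mono Hft sz (subgradient0 Hft)).
have zz : zstar != z by rewrite gt_eqF // (lt_trans z0).
have [c c0 H] := energy_lower_neg f M.
exists (c * (2 * al * z / (1 - lam) ^+ 2) ^+ 2), (C - (ft z + s * (zstar - z))).
  by rewrite subr_gt0 (subgradient_lt Hft).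
move=> N u Au; rewrite F1E.
apply: (H s z _ N (nodes u) (fun k => zstar <= nodes u k.+1 - nodes u k)); last exact: nodes_ends.
move=> k _; set w := _ - nodes u k; have [zw|wz] := leP zstar w.
  rewrite mulr1 truncated_broken //.
  have : s * (w - z) <= s * (zstar - z) by rewrite ler_wnM2l ?(ltW s0) // lerD2r.
  by lra.
by rewrite mulr0 addr0 (truncated_intact (ltW wz)); exact: sz.
Qed.

Lemma local_energy_constant a z N : `|a| <= `|z| / (1 - lam) ->
  local_energy f lam al a (nseq N z) <= N%:R * (f z + al * z ^+ 2 / (1 - lam) ^+ 2).
Proof.
have l0 : 0 < 1 - lam by rewrite subr_gt0 (kernel_lt1 sigma_gt0).
elim: N a => [|N IH] a az /=; first by rewrite mul0r.
have bz : `|lam * a + z| <= `|z| / (1 - lam).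
  apply: (le_trans (ler_normD _ _)); rewrite normrM (gtr0_norm (kernel_gt0 _)).
  have -> : `|z| / (1 - lam) = lam * (`|z| / (1 - lam)) + `|z| by field; exact: lt0r_neq0.
  by rewrite lerD2r ler_wpM2l // ltW // kernel_gt0.
have b2 : (lam * a + z) ^+ 2 <= z ^+ 2 / (1 - lam) ^+ 2.
  have -> : z ^+ 2 / (1 - lam) ^+ 2 = (`|z| / (1 - lam)) ^+ 2.
    by rewrite expr_div_n real_normK ?num_real.
  by rewrite -[leLHS]real_normK ?num_real // lerXn2r ?nnegrE // divr_ge0 // ltW.
have al0 := ltW (chain_al_gt0 M).
have := IH _ bz; have := ler_wpM2l al0 b2; rewrite -natr1 mulrA; lra.
Qed.

Lemma uniform_upper z N : z < 0 -> exists u : 'I_N.+1 -> R,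
  [/\ admissible z u, forall i : 'I_N, incr u i = z & F1 f sigma u <= N%:R * uniform z].
Proof.
move=> z0; have sz : \sum_(w <- nseq N z) w = N%:R * z.
  by rewrite big_nseq iter_addr addr0 mulr_natl.
have [u [Au iu Fu]] := realize_list f sigma_gt0 (size_nseq N z) sz; exists u; split=> //.
  by move=> i; rewrite iu nth_nseq ltn_ord.
apply: (le_trans Fu); have h : `|0 : R| <= `|z| / (1 - lam).
  by rewrite normr0 divr_ge0 // subr_ge0 ltW // (kernel_lt1 sigma_gt0).
apply: (le_trans (local_energy_constant N h)).
by rewrite truncated_intact // ltW // (lt_trans z0).
Qed.

Lemma Qhat_uniform z : z < 0 -> Qhat f sigma z = (uniform z)%:E.
Proof.
move=> z0; apply: Qhat_eq.
  have [K [de de0 H]] := F1_lower_uniform z0; exists K => N u Au.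
  apply: le_trans (H N u Au); rewrite lerD2r lerDl mulr_ge0 ?sumr_ge0 //; exact: ltW.
move=> e e0; exists 0 => N; have [u [Au _ Fu]] := uniform_upper N z0; exists u; split=> //.
by rewrite addr0 (le_trans Fu) // ler_wpM2l // lerDl ltW.
Qed.

Lemma Qhat_rat_lower_uniform z : z < 0 -> exists2 de, 0 < de &
  forall t, 0 <= t <= 1 -> ((uniform z + de * t)%:E <= Qhat_rat f sigma zstar t z)%E.
Proof.
move=> z0; have [K [de de0 H]] := F1_lower_uniform z0; exists de => // t _.
apply: Qhat_rat_ge; exists K => N u Au Vu; apply: le_trans (H N u Au).
rewrite lerD2r mulrDr lerD2l mulrCA ler_wpM2l ?(ltW de0) // mulrC.
by have [] := phases_broken Vu.
Qed.

(** In an interval of strains with equality, a negative strain contradicts the extra cost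
of broken bonds; two positive strains would both have the unique load at which the
lengths m and m + 1 tie, and both be the derivative at that load of the same function. *)
Lemma not_locking theta : 0 <= theta <= 1 -> theta != 0 ->
  (forall n, (0 < n)%N -> theta != n%:R^-1) -> ~ locking_state f sigma zstar theta.
Proof.
move=> th01 th0 thn [_ [a [b [ab H']]]].
have H z : a < z -> z < b -> Qhat_phase f sigma zstar theta z = Qhat f sigma z.
  by move=> az zb; apply: H'; rewrite /= in_itv /= az.
have th_gt0 : 0 < theta by rewrite lt_neqAle eq_sym th0; case/andP: th01.
have th_lt1 : theta < 1.
  by rewrite lt_neqAle; have := thn 1%N isT; rewrite invr1 => ->; case/andP: th01.
have [a0|a0] := ltP a 0.
  have [z [az zb z0]] : exists z, [/\ a < z, z < b & z < 0].
    have m0 : a < Num.min b 0 by rewrite lt_min ab.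
    exists ((a + Num.min b 0) / 2); split.
    - by lra.
    - by apply: lt_le_trans (_ : Num.min b 0 <= _); [lra|rewrite ge_min lexx].
    - by apply: lt_le_trans (_ : Num.min b 0 <= _); [lra|rewrite ge_min lexx orbT].
  have := H z az zb; rewrite (Qhat_uniform z0) => e.
  have [de de0 lo] := Qhat_rat_lower_uniform z0.
  have [] := Qhat_phase_ge th01 lo; rewrite e.
    by rewrite lee_fin leNgt ltrDl mulr_gt0.
  by move=> [e0]; have := uniform_gt0 (ltr0_neq0 z0); rewrite e0 ltxx.
pose m := Num.truncn theta^-1.
have /truncn_itv/andP[h1 h2] : 0 <= theta^-1 by rewrite invr_ge0 ltW.
have m0 : (0 < m)%N by rewrite truncn_gt0 -[X in X <= _]invr1 lef_pV2 ?posrE ?ltW.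
have mR : (0 : R) < m%:R by rewrite ltr0n.
have th1 : m%:R * theta < 1.
  rewrite -ltr_pdivlMr // div1r lt_neqAle h1 andbT; apply/negP => /eqP e.
  by have := thn _ m0; rewrite /m e invrK eqxx.
have th2 : 1 < m.+1%:R * theta by rewrite -ltr_pdivrMr // div1r.
have key z : 0 < z -> a < z -> z < b -> exists p, [/\ 0 < p, threshold p m = C &
  z = (m.+1%:R * theta - 1) * cost_slope p m + (1 - m%:R * theta) * cost_slope p m.+1].
  move=> z0 az zb; have e := H z az zb; have [p [p0 qE qpos]] := Qhat_conj z0.
  rewrite qE in e; exists p.
  have touchz p' : 0 < p' -> p' * z - phase_conj m p' theta <= p * z - conj_density p.
    move=> p'0; pose c0 := p' * z - (g p' m.+1 - g p' m).
    pose c1 := - (g p' m - C - m%:R * (g p' m.+1 - g p' m)).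
    have lo t : 0 <= t <= 1 -> ((c0 + c1 * t)%:E <= Qhat_rat f sigma zstar t z)%E.
      move=> _; apply: le_trans (Qhat_rat_lower z t p'0 m0).
      by rewrite lee_fin /phase_conj /c0 /c1; lra.
    have [] := Qhat_phase_ge th01 lo; rewrite e.
      by rewrite lee_fin /phase_conj /c0 /c1; lra.
    by move=> [e0]; rewrite e0 ltxx in qpos.
  by have [h3 h4] := phase_conj_touch m0 p0 th1 th2 touchz.
pose z1 := a + (b - a) / 3; pose z2 := a + 2 * (b - a) / 3.
have z10 : 0 < z1 by rewrite /z1; lra.
have z20 : 0 < z2 by rewrite /z2; lra.
have [||p1 [p10 t1 E1]] := key z1 z10; rewrite /z1; [lra|lra|].
have [||p2 [p20 t2 E2]] := key z2 z20; rewrite /z2; [lra|lra|].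
have pp : p1 = p2.
  have [lt|lt|//] := ltgtP p1 p2.
    by have := threshold_increasing M p10 lt m0; rewrite t1 t2 ltxx.
  by have := threshold_increasing M p20 lt m0; rewrite t1 t2 ltxx.
have : z1 < z2 by rewrite /z1 /z2; lra.
by rewrite E1 E2 pp ltxx.
Qed.

Lemma Qhat_phase_rational t z : @rational R t ->
  Qhat_phase f sigma zstar t z = Qhat_rat f sigma zstar t z.
Proof. by move=> rt; rewrite /Qhat_phase mem_set. Qed.

Lemma locking_zero : locking_state f sigma zstar 0.
Proof.
split; first by rewrite lexx ler01.
exists (-1), 0; split; first by rewrite oppr_lt0.
move=> z; rewrite /= in_itv /= => /andP[_ z0].
rewrite Qhat_phase_rational; last by exists 0 => //; rewrite rmorph0.
rewrite Qhat_uniform //; apply/eqP; rewrite eq_le; apply/andP; split.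
  apply: Qhat_rat_le => N0; exists N0.+1; split=> //; first by rewrite mul0r.
  have [u [Au iu Fu]] := uniform_upper N0.+1 z0; exists u; split=> //; split.
    rewrite mul0r eq_card0 // => i; rewrite !inE iu; apply/negbTE.
    by rewrite -leNgt ltW // (lt_trans z0).
  by rewrite subr0 mul1r ler_nat -[leqRHS]card_ord max_card.
have [de de0 lo] := Qhat_rat_lower_uniform z0.
by have := lo 0; rewrite mulr0 addr0; apply; rewrite lexx ler01.
Qed.

End Truncated.

(** * Locking at the inverse integers *)
Section Locking.
Variables (R : realType) (sigma zstar : R) (ft : R -> R).
Hypotheses (sigma_gt0 : 0 < sigma) (zstar_gt0 : 0 < zstar) (Hft : potential ft).
Local Notation lam := (expR (- sigma)).
Local Notation al := (stiffness lam).
Local Notation f := (truncated ft zstar).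
Local Notation C := (ft zstar).
Local Notation g := (block_cost ft lam al).
Local Notation cost_slope := (cost_slope ft lam al).
Local Notation curv := (curv lam al).
Local Notation threshold := (threshold ft lam al).
Local Notation optimal := (optimal ft lam al C).
Local Notation conj_density := (conj_density ft lam al C).
Local Notation block_incr := (block_incr ft lam al).
Local Notation block_excess := (block_excess ft lam al).
Local Notation local_energy := (local_energy f lam al).
Local Notation last_excess := (last_excess lam).
Let M : chain ft lam al := truncated_chain sigma_gt0 Hft.
Let C_gt0 : 0 < C := break_cost_gt0 zstar_gt0 Hft.
Implicit Types (p z t theta w L : R) (N n m k : nat).

(** The threshold of n lies strictly above that of n - 1, so beyond the load at which n
ties with n + 1 there is room before n - 1 takes over. *)
Lemma optimal_interval n : (0 < n)%N -> exists p1 p2,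
  [/\ 0 < p1, p1 < p2 & forall p, p1 <= p -> p <= p2 -> optimal p n].
Proof.
move=> n0; have [p1 p10 t1] := threshold_hit M C_gt0 n0.
have up p : p1 <= p -> C <= threshold p n.
  rewrite le_eqVlt => /predU1P[<-|lt]; first by rewrite t1.
  by rewrite -t1 ltW // (threshold_increasing M).
case: n n0 t1 up => [//|[|n]] n0 t1 up.
  exists p1, (p1 + 1); split=> //; first by rewrite ltrDl.
  by move=> p p1p _; apply: (optimalP M) => //; [exact: lt_le_trans p1p|exact: up].
have gap : threshold p1 n.+1 < C by rewrite -t1 (threshold_lt M).
pose K := 2 * n.+2%:R * n.+2%:R * (2 * curv * (p1 + 1)).
have K0 : 0 <= K.
  have c0 := ltW (curv_gt0 M); apply: mulr_ge0; first by rewrite !mulr_ge0.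
  by apply: mulr_ge0; [exact: mulr_ge0|rewrite addr_ge0 // ltW].
pose h := Num.min 1 ((C - threshold p1 n.+1) / (K + 1)).
have K1 : 0 < K + 1 by rewrite ltr_wpDl.
have h0 : 0 < h by rewrite lt_min ltr01 divr_gt0 // subr_gt0.
exists p1, (p1 + h); split=> //; first by rewrite ltrDl.
move=> p p1p pp2; apply: (optimalP M) => //; [exact: lt_le_trans p1p|exact: up|].
move=> m [<-]; have pP : p <= p1 + 1.
  by apply: (le_trans pp2); rewrite lerD2l ge_min lexx.
have := threshold_lipschitz M p10 p1p pP (ltn0Sn n); rewrite -/K => /(le_trans (ler_norm _)) l.
have : K * (p - p1) <= (K + 1) * h.
  by apply: ler_pM => //; rewrite ?subr_ge0 ?lerDl ?lerBlDl.
have : (K + 1) * h <= C - threshold p1 n.+1.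
  by rewrite mulrC -ler_pdivlMr // ge_min lexx orbT.
lra.
Qed.

(** Minimise the block cost minus a linear function of slope v: the minimum is interior. *)
Lemma cost_slope_between n p1 p2 (v : R) : (0 < n)%N -> 0 < p1 -> p1 < p2 ->
  cost_slope p1 n < v -> v < cost_slope p2 n ->
  exists p, [/\ p1 <= p, p <= p2 & cost_slope p n = v].
Proof.
move=> n0 p10 p12 v1 v2; have p20 := lt_trans p10 p12; have c0 := curv_gt0 M.
have nR : (0 : R) < n%:R by rewrite ltr0n.
pose h p := g p n - v * p.
have L0 : 0 <= n%:R * (2 * curv * p2) + `|v|.
  apply: addr_ge0 => //; apply: mulr_ge0 => //; apply: mulr_ge0; last exact: ltW.
  by apply: mulr_ge0 => //; exact: ltW.
have hc : {within `[p1, p2], continuous h}.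
  apply: (lipschitz_within L0) => x y px xy yp.
  have /andP[l1 l2] := block_cost_lipschitz M (lt_le_trans p10 px) xy yp n0.
  have -> : h y - h x = (g y n - g x n) - v * (y - x) by rewrite /h; ring.
  have yx : 0 <= y - x by rewrite subr_ge0.
  apply: (le_trans (ler_normB _ _)); rewrite normrM (ger0_norm l1) (ger0_norm yx) mulrDl.
  by rewrite lerD2r.
have [p pin pmin] := EVT_min (ltW p12) hc.
move: (pin); rewrite in_itv /= => /andP[pp1 pp2]; exists p; split=> //.
have p0 := lt_le_trans p10 pp1; have K0 : 0 < n%:R * curv by exact: mulr_gt0.
have mini d : p1 <= p + d -> p + d <= p2 -> (v - cost_slope p n) * d <= n%:R * curv * d ^+ 2.
  move=> d1 d2; have pd0 := lt_le_trans p10 d1.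
  have := pmin (p + d); rewrite in_itv /= d1 d2 => /(_ isT).
  have := block_cost_upper M p0 pd0 n0; rewrite [p + d - p]addrC addKr /h; lra.
have small (e : R) : 0 < e -> exists2 d, 0 < d & d <= e /\ n%:R * curv * d < e.
  move=> e0; exists (Num.min e (e / (n%:R * curv) / 2)).
    by rewrite lt_min e0 !divr_gt0.
  split; first by rewrite ge_min lexx.
  rewrite -ltr_pdivlMl // [ltRHS]mulrC; apply: (@le_lt_trans _ _ (e / (n%:R * curv) / 2)).
    by rewrite ge_min lexx orbT.
  by rewrite ltr_pdivrMr // ltr_pMr ?divr_gt0 // ltr1n.
apply/eqP; rewrite eq_le; apply/andP; split; rewrite leNgt; apply/negP => lt.
  (* The minimum is not at the left end, so the load can be decreased. *)
  have pl : p1 < p by rewrite lt_neqAle pp1 andbT; apply: contraTneq lt => <-; rewrite -leNgt ltW.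
  have e0 : 0 < Num.min (p - p1) (cost_slope p n - v) by rewrite lt_min !subr_gt0 pl.
  have [d d0 [d1 d2]] := small _ e0.
  have := d1; rewrite le_min => /andP[d3 _]; have := d2; rewrite lt_min => /andP[_ d4].
  have := mini (- d); rewrite sqrrN => /(_ _ _) h1.
  have : (v - cost_slope p n) * - d <= n%:R * curv * d ^+ 2 by apply: h1; lra.
  have : n%:R * curv * d * d < (cost_slope p n - v) * d by rewrite ltr_pM2r.
  lra.
have pr : p < p2 by rewrite lt_neqAle pp2 andbT; apply: contraTneq lt => ->; rewrite -leNgt ltW.
have e0 : 0 < Num.min (p2 - p) (v - cost_slope p n) by rewrite lt_min !subr_gt0 pr.
have [d d0 [d1 d2]] := small _ e0.
have := d1; rewrite le_min => /andP[d3 _]; have := d2; rewrite lt_min => /andP[_ d4].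
have : (v - cost_slope p n) * d <= n%:R * curv * d ^+ 2 by apply: mini; lra.
have : n%:R * curv * d * d < (v - cost_slope p n) * d by rewrite ltr_pM2r.
lra.
Qed.

Lemma count_flatten_nseq (P : pred R) m (s : seq R) :
  count P (flatten (nseq m s)) = (m * count P s)%N.
Proof. by elim: m => //= m IH; rewrite count_cat IH mulSn. Qed.

Lemma card_nth_count (P : pred R) N (s : seq R) (w : 'I_N -> R) : size s = N ->
  (forall i : 'I_N, w i = s`_i) -> #|[pred i | P (w i)]| = count P s.
Proof.
move=> sN ws; rewrite -sum1_card -sum1_count big_mkcond [RHS]big_mkcond /= (big_nth 0) big_mkord sN.
by apply: eq_bigr => i _; rewrite inE /= ws.
Qed.

Section Block.
Variables (n : nat) (p : R).
Hypotheses (n_gt0 : (0 < n)%N) (p_gt0 : 0 < p) (p_opt : optimal p n).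
Let z := cost_slope p n / n%:R.
Let s := mkseq (block_incr p n) n.

Let nR : (0 : R) < n%:R. Proof. by rewrite ltr0n. Qed.

Lemma block_list m : size (flatten (nseq m s)) = (m * n)%N /\
  \sum_(w <- flatten (nseq m s)) w = (m * n)%:R * z.
Proof.
rewrite size_flatten_nseq size_mkseq; split=> //.
have [_ _ _ sm _] := block_energy f C M p_gt0 n_gt0.
by rewrite sum_flatten_nseq sm /z natrM -mulrA [n%:R * _]mulrC divfK // lt0r_neq0.
Qed.

Lemma block_list_energy m : local_energy 0 (flatten (nseq m s)) <=
  m%:R * local_energy (block_excess p n 0) s.
Proof.
have [sp a0 fin _ _] := block_energy f C M p_gt0 n_gt0.
have [_ <-] := local_energy_periodic f al m fin.
apply: (local_energy_le f (kernel_gt0 sigma) (chain_al_gt0 M)) => //.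
by move=> w /mem_flatten_nseq; exact: sp.
Qed.

(** An intact bond beyond zstar or a broken bond below it would make the truncated energy of
the repeated block strictly smaller than its relaxed energy, which is already the lower
bound for all chains. *)
Lemma block_feasible :
  [/\ zstar <= block_incr p n 0, forall k, (k < n.-1)%N -> block_incr p n k.+1 <= zstar &
      local_energy (block_excess p n 0) s = n%:R * (p * z - conj_density p)].
Proof.
have [sp a0 fin sm en] := block_energy f C M p_gt0 n_gt0.
have E : p * cost_slope p n - (g p n - C) = n%:R * (p * z - conj_density p).
  rewrite (conj_density_optimal M C_gt0 p_gt0 n_gt0 p_opt) /z.
  by field; exact: lt0r_neq0.
have [K lo] := F1_lower sigma_gt0 zstar_gt0 Hft z p_gt0.
set E0 := local_energy _ _ in en *.
have ge : n%:R * (p * z - conj_density p) <= E0.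
  rewrite leNgt -subr_gt0; apply/negP => d0.
  have d2 : 0 < (n%:R * (p * z - conj_density p) - E0) / 2 by rewrite divr_gt0.
  have [m /(_ _ (leqnn _))[m0 Km]] := eventually_small K d2.
  have [sz sS] := block_list m; have [u [Au _ Fu]] := realize_list f sigma_gt0 sz sS.
  have := le_trans (le_trans (lo _ _ Au) Fu) (block_list_energy m); rewrite -/E0 natrM.
  have : 0 < m%:R * (n%:R * (p * z - conj_density p) - E0) by rewrite mulr_gt0 // ltr0n.
  lra.
have b0 k : 0 <= block_incr p n k by exact: (block_incr_ge0 M).
have g0 : 0 <= C - f (block_incr p n 0) by rewrite subr_ge0 truncated_le_cost.
have gk k : 0 <= ft (block_incr p n k.+1) - f (block_incr p n k.+1).
  by rewrite subr_ge0 truncated_le_potential.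
have gS : 0 <= \sum_(k < n.-1) (ft (block_incr p n k.+1) - f (block_incr p n k.+1)).
  by apply: sumr_ge0 => k _.
rewrite E in en.
have e0 : C - f (block_incr p n 0) = 0 by apply/eqP; rewrite eq_le g0 andbT; lra.
have eS : \sum_(k < n.-1) (ft (block_incr p n k.+1) - f (block_incr p n k.+1)) = 0.
  by apply/eqP; rewrite eq_le gS andbT; lra.
split.
- rewrite leNgt; apply/negP => lt; move: e0; rewrite truncated_intact ?ltW // => e0.
  by have := ft_increasing Hft (b0 0%N) lt; rewrite -subr_gt0 e0 ltxx.
- move=> k kn; rewrite leNgt; apply/negP => lt.
  have /psumr_eq0P := eS => /(_ (fun i _ => gk i)) /(_ (Ordinal kn) isT) /=.
  rewrite truncated_broken ?ltW // => e1.
  by have := ft_increasing Hft (ltW zstar_gt0) lt; rewrite -subr_gt0 e1 ltxx.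
- by move: en; rewrite e0 eS !addr0.
Qed.

Lemma block_counts : (count (fun w => (zstar < w)%R) s <= 1)%N /\
  (count (fun w => (w < zstar)%R) s <= n.-1)%N.
Proof.
have [h0 hk _] := block_feasible.
have sE : s = block_incr p n 0 :: mkseq (fun k => block_incr p n k.+1) n.-1.
  rewrite /s; case: n n_gt0 => // n' _; rewrite /mkseq /= (iotaDl 1) -map_comp //.
have tail : {in mkseq (fun k => block_incr p n k.+1) n.-1, forall w, w <= zstar}.
  by move=> w /mapP[k]; rewrite mem_iota add0n => kn ->; exact: hk.
rewrite sE /= [(_ < zstar)%R in X in _ /\ X]ltNge h0 /= add0n; split.
  rewrite (eq_in_count (a2 := pred0)) ?count_pred0 ?addn0 ?leq_b1 //.
  by move=> w /tail; rewrite leNgt => /negbTE.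
by rewrite (leq_trans (count_size _ _)) // size_mkseq.
Qed.

Lemma block_locked : Qhat_phase f sigma zstar n%:R^-1 z = Qhat f sigma z.
Proof.
have [_ _ en] := block_feasible; have [cb ci] := block_counts.
have lo := F1_lower sigma_gt0 zstar_gt0 Hft z p_gt0.
have -> : Qhat f sigma z = (p * z - conj_density p)%:E.
  apply: Qhat_eq => // eps eps0.
  have cy := block_periodic M (truncated_le_potential zstar_gt0 Hft)
     (truncated_le_cost zstar Hft) p_gt0 n_gt0.
  have [c mx] := mix_states M C_gt0 (truncated_le_cost zstar Hft) cy cy (lexx 0) ler01.
  exists c => N; have [s' [_ sN sz en']] := mx N.
  rewrite subr0 mul1r mul0r addr0 -/z in sz.
  have [u [Au _ Fu]] := realize_list f sigma_gt0 sN sz; exists u; split=> //.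
  apply: (le_trans Fu); apply: (le_trans en').
  rewrite subr0 mul1r mul0r addr0 lerD2r ler_wpM2l //.
  rewrite (conj_density_optimal M C_gt0 p_gt0 n_gt0 p_opt) /z.
  have -> : (p * cost_slope p n - n%:R * conj_density p) / n%:R =
      p * (cost_slope p n / n%:R) - conj_density p.
    by field; exact: lt0r_neq0.
  by rewrite lerDl ltW.
rewrite Qhat_phase_rational; last first.
  by exists (n%:R^-1) => //; rewrite rmorphV ?unitfE ?pnatr_eq0 -?lt0n // rmorph_nat.
apply/eqP; rewrite eq_le; apply/andP; split; last first.
  by apply: Qhat_rat_ge; have [K H] := lo; exists K => N u Au _; exact: H.
apply: Qhat_rat_le => N0; exists (N0.+1 * n)%N; split.
- by rewrite (leq_trans (leqnSn N0)) // leq_pmulr.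
- by rewrite muln_gt0.
- by rewrite natrM mulrCA mulVf ?mulr1 ?natr_nat // lt0r_neq0.
have [sz sS] := block_list N0.+1.
have [u [Au iu Fu]] := realize_list f sigma_gt0 sz sS; exists u; split=> //; last first.
  by apply: (le_trans Fu); apply: (le_trans (block_list_energy _)); rewrite en natrM mulrA.
have tE : n%:R^-1 * (N0.+1 * n)%:R = N0.+1%:R :> R.
  by rewrite natrM mulrCA mulVf ?mulr1 // lt0r_neq0.
split; rewrite ?mulrBl ?mul1r tE.
  rewrite (card_nth_count (fun w => zstar < w) sz iu) count_flatten_nseq ler_nat.
  by rewrite -[leqRHS]muln1 leq_mul2l cb orbT.
rewrite (card_nth_count (fun w => w < zstar) sz iu) count_flatten_nseq.
have -> : (N0.+1 * n)%:R - N0.+1%:R = (N0.+1 * n.-1)%:R :> R.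
  by rewrite -subn1 mulnBr muln1 natrB // leq_pmulr.
by rewrite ler_nat leq_mul2l ci orbT.
Qed.

End Block.

Lemma locking_inv n : (0 < n)%N -> locking_state f sigma zstar n%:R^-1.
Proof.
move=> n0; have nR : (0 : R) < n%:R by rewrite ltr0n.
split; first by rewrite invr_ge0 ltW // invf_le1 // ler1n.
have [p1 [p2 [p10 p12 opt]]] := optimal_interval n0.
exists (cost_slope p1 n / n%:R), (cost_slope p2 n / n%:R); split.
  by rewrite ltr_pM2r ?invr_gt0 // (cost_slope_lt M).
move=> z; rewrite /= in_itv /= ltr_pdivrMr // ltr_pdivlMr // => /andP[z1 z2].
have [p [pp1 pp2 pz]] := cost_slope_between n0 p10 p12 z1 z2.
have -> : z = cost_slope p n / n%:R by rewrite pz mulfK // lt0r_neq0.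
by apply: block_locked => //; [exact: lt_le_trans pp1|exact: opt].
Qed.

End Locking.

Theorem theorem5p23 (R : realType) (sigma zstar : R) (ft : R -> R)
  (sigma_gt0 : 0 < sigma) (zstar_gt0 : 0 < zstar)
  (ft_ge0 : forall z : R, 0 <= ft z)
  (ft_convex : strictly_convex ft)
  (ft0 : ft 0 = 0)
  (f_growth : exists c : R, 0 < c /\
     forall z : R, truncated ft zstar z <= c * (z ^+ 2 + 1))
  (ft_growth : exists c1 c2 : R, 0 < c1 /\ 0 < c2 /\
     forall z : R, 0 <= z -> c1 * z ^+ 2 - c2 <= ft z) :
  [set theta : R | locking_state (truncated ft zstar) sigma zstar theta] =
  [set N%:R^-1 | N in [set N : nat | (1 <= N)%N]] `|` [set 0].
Proof.
have Hft : potential ft by split.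
apply/seteqP; split=> theta /=.
  move=> lock; have [->|th0] := eqVneq theta 0; first by right.
  left; have [//|none] := pselect (exists2 N, (1 <= N)%N & N%:R^-1 = theta).
  case: (not_locking sigma_gt0 zstar_gt0 Hft lock.1 th0) => // n n0.
  by apply/eqP => e; apply: none; exists n.
case=> [[N N1 <-]|->]; first exact: locking_inv.
exact: locking_zero.
Qed.
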